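(* For $c>0$ put $\ell=2\pi/c$ and $B(c)=\inf_{U\in\mathcal{X}_c}\int_{C_\ell}e^U$, where $\mathcal{X}_c$ is the set of functions $U$ on $C_\ell=(0,\ell)\times\mathbb{S}^1$ for which there exist finitely many points $q_1,\dots,q_m\in\overline{C_\ell}$, weights $\beta_1,\dots,\beta_m\ge0$ and a function $\psi$ such that $$\Delta U+e^U=\sum_{j=1}^m\beta_j\delta_{q_j}\ \text{ in }\overline{C_\ell},\qquad \Delta\psi+e^U\psi=0,\quad\psi>0\ \text{ in }C_\ell,\quad\psi=0\ \text{ on }\partial C_\ell .$$ Then $$B(c)=8c+o(c)\qquad\text{as }c\downarrow0 .$$
   Context: $\mathbb{S}^1=\mathbb{R}/2\pi\mathbb{Z}$ has length $2\pi$; $C_\ell$ has coordinates $(t,\theta)$ and the flat metric $dt^2+d\theta^2$, with $\Delta=\partial_t^2+\partial_\theta^2$ and area element $dt\,d\theta$; its capacity is $\operatorname{Cap}(C_\ell)=2\pi/\ell=c$. The number $m\ge0$ of points is arbitrary. The equation for $U$ is understood in the sense of distributions, with $U$ real-valued, $e^U\in L^1(C_\ell)$, $U$ of class $C^2$ in $C_\ell$ away from the points $q_j$, and $U=\frac{\beta_j}{2\pi}\log|\cdot-q_j|+O(1)$ near $q_j$. The boundary condition for $\psi$ means $\psi\in H^1_0(C_\ell)$. *)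

(* Defs.v *)
From HB Require Import structures.
From mathcomp Require Import all_boot all_order all_algebra.
From mathcomp Require Import all_classical all_reals all_analysis.
Set Implicit Arguments.
Unset Strict Implicit.
Unset Printing Implicit Defensive.
Import Order.TTheory GRing.Theory Num.Theory.
Import numFieldNormedType.Exports.
Local Open Scope classical_set_scope.
Local Open Scope ring_scope.

(* The cylinder C_l = (0, l) x (R / 2 pi Z) is handled through its universal
   cover: a point is a pair (t, theta) : R * R, a function on C_l is a function
   on R * R that is 2 pi-periodic in theta and whose values outside
   0 < t < l are irrelevant, and integrals over C_l are taken over the
   fundamental domain ]0, l[ x [0, 2 pi[. *)

Section Cylinder.
Context {R : realType}.
Implicit Types (l : R) (f g U psi phi : R * R -> R) (O : set (R * R)).

Definition periodic2pi f := forall x : R * R, f (x.1, x.2 + 2 * pi) = f x.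

Definition same_point (x y : R * R) :=
  x.1 = y.1 /\ exists k : int, x.2 = y.2 + k%:~R * (2 * pi).

Definition strip l : set (R * R) := [set x | 0 < x.1 < l].

Definition closed_strip l : set (R * R) := [set x | 0 <= x.1 <= l].

Definition fdom l : set (R * R) := `]0, l[ `*` `[0, 2 * pi[.

Local Notation area := (@lebesgue_measure R \x @lebesgue_measure R)%E.

(* `|_| on R * R is the sup norm, so the Euclidean one is written out. *)
Definition edist (x y : R * R) : R :=
  Num.sqrt ((x.1 - y.1) ^+ 2 + (x.2 - y.2) ^+ 2).

Definition dt f : R * R -> R := fun x => 'D_(1, 0) f x.
Definition dtheta f : R * R -> R := fun x => 'D_(0, 1) f x.
Definition laplacian f : R * R -> R :=
  fun x => dt (dt f) x + dtheta (dtheta f) x.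

(* O is meant to be open *)
Fixpoint classC (k : nat) O f : Prop :=
  (forall x, O x -> {for x, continuous f}) /\
  (if k is k'.+1 then
     [/\ forall x, O x -> derivable f x (1, 0) /\ derivable f x (0, 1),
         classC k' O (dt f) & classC k' O (dtheta f)]
   else True).

(* C_c^infty(C_l): compact support is required in the open cylinder *)
Definition test_function l phi : Prop :=
  [/\ periodic2pi phi,
      forall k, classC k setT phi &
      exists a b : R, [/\ 0 < a, b < l &
        forall x, phi x != 0 -> a <= x.1 <= b]].

Definition L2 l f : Prop :=
  measurable_fun (fdom l : set (measurableTypeR R * measurableTypeR R)) f /\
  area.-integrable (fdom l) (EFin \o (fun x => f x ^+ 2)).

(* g1 and g2 are the weak partial derivatives of f, and f, g1, g2 are in
   L^2(C_l), i.e. f is in H^1(C_l) with weak gradient (g1, g2) *)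
Definition H1_grad l f g1 g2 : Prop :=
  [/\ L2 l f, L2 l g1, L2 l g2 &
      forall phi, test_function l phi ->
        (\int[area]_(x in fdom l) (f x * dt phi x)) =
          - (\int[area]_(x in fdom l) (g1 x * phi x)) /\
        (\int[area]_(x in fdom l) (f x * dtheta phi x)) =
          - (\int[area]_(x in fdom l) (g2 x * phi x))].

(* H^1_0(C_l) is the closure of C_c^infty(C_l) for the H^1 norm *)
Definition H10 l f : Prop :=
  exists g1 g2, H1_grad l f g1 g2 /\
    forall e : R, 0 < e -> exists phi, test_function l phi /\
      ((\int[area]_(x in fdom l)
         ((f x - phi x) ^+ 2 + (g1 x - dt phi x) ^+ 2
            + (g2 x - dtheta phi x) ^+ 2)%:E) < e%:E)%E.

(* U solves Delta U + e^U = \sum_j beta_j delta_{q_j}.  The value of U at the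
   points q_j is arbitrary.  Test functions vanish near the boundary, so a
   boundary point q_j only enters through the logarithmic behaviour of U. *)
Definition liouville l (m : nat) (q : 'I_m -> R * R) (beta : 'I_m -> R) U :
    Prop :=
  [/\ periodic2pi U,
      area.-integrable (fdom l) (EFin \o (fun x => expR (U x))),
      classC 2 (strip l `&` [set x | forall j, ~ same_point x (q j)]) U,
      forall j, exists M : R, \forall x \near (q j)^', strip l x ->
        `|U x - beta j / (2 * pi) * ln (edist x (q j))| <= M &
      forall phi, test_function l phi ->
        (\int[area]_(x in fdom l)
           (U x * laplacian phi x + expR (U x) * phi x))
        = \sum_(j < m) beta j * phi (q j)].

(* Delta psi + e^U psi = 0 is understood in the sense of distributions; psi = 0
   on the boundary means psi \in H^1_0. *)
Definition dirichlet_ground_state l U psi : Prop :=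
  [/\ periodic2pi psi,
      H10 l psi,
      forall x, strip l x -> 0 < psi x &
      forall phi, test_function l phi ->
        (\int[area]_(x in fdom l)
           (psi x * laplacian phi x + expR (U x) * psi x * phi x)) = 0].

Definition cyl_length (c : R) : R := 2 * pi / c.

Definition admissible (c : R) : set (R * R -> R) := [set U |
  exists (m : nat) (q : 'I_m -> R * R) (beta : 'I_m -> R) psi,
    [/\ forall j, closed_strip (cyl_length c) (q j),
        forall i j, same_point (q i) (q j) -> i = j,
        forall j, 0 <= beta j,
        liouville (cyl_length c) q beta U &
        dirichlet_ground_state (cyl_length c) U psi]].

Definition B (c : R) : \bar R :=
  ereal_inf [set (\int[area]_(x in fdom (cyl_length c)) (expR (U x))%:E)%E
            | U in admissible c].

End Cylinder.

(* Main.v *)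
(* Idea.  Upper bound: for m = 0 the function of t alone given by
   e^U = 2 a^2 / cosh^2 (a s), s = t - l / 2, has the ground state
   psi = 1 - a s tanh (a s) when x0 = a l / 2 solves x0 tanh x0 = 1, and its mass
   is exactly 8 c.

   Lower bound: if the mass is less than (8 - eps) c and c is small, then
   int e^U phi^2 <= rho int |grad phi|^2 for all test functions phi, with
   rho < 1, which is incompatible with a positive psi in H^1_0 solving
   Delta psi + e^U psi = 0.  For the inequality, the logarithm u of the mean of
   e^U over the circles satisfies u'' + e^u >= 0 up to an error quadratic in the
   density (a Sobolev bound on circles), and as the cylinder is long the
   density is small.  The one-dimensional inequality follows from Barta's
   positive supersolutions 2 - (t - s) (P t - P s - c), P' = e^u, on both sides of
   a point s; they exist because the mass times the length is below 8.  The
   singular weights are nonnegative, so the singularities only help: e^U is cut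
   off there to a C^2 density satisfying almost the same inequality. *)
Require Import Defs.
From mathcomp Require Import all_boot all_order all_algebra.
From mathcomp Require Import all_classical all_reals all_analysis.
From mathcomp Require Import measurable_realfun.
From mathcomp Require Import ring lra.
Import Order.TTheory GRing.Theory Num.Theory.
Import numFieldNormedType.Exports.
Set Implicit Arguments.
Unset Strict Implicit.
Unset Printing Implicit Defensive.
Local Open Scope classical_set_scope.
Local Open Scope ring_scope.

(** * One-dimensional Liouville inequalities *)

(** The threshold 8 is twice the 4 of [1/x + 1/y >= 4/(x + y)]: on each side of [s] the
    supersolution stays positive as long as the length times the mass corrected by the slope is
    below 2, and the slope cancels between the two sides. For circle means, mass times length is the
    area integral divided by [c], whence [8 c]. The obstacle is that nothing controls [e^U] near the
    two boundary circles. There the density is only bounded by its total mass, of order [1/l], over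
    the distance to the boundary; test functions make up for this, since
    [phi ^ 2 <= distance * energy]. All losses are then of relative order [1/l], and are paid for by
    multiplying the density by a fixed factor larger than one. As [psi] is only in [H^1_0] and
    [e^U psi ^ 2] is not known to be integrable up to the boundary, the energy inequality is carried
    over to [psi] on compact boxes only, and the equation is tested with compactly supported
    approximations of [psi]. At a point of weight zero [U] is only known to be bounded; a small
    multiple of a logarithmic barrier sends it to minus infinity at all singular points before the
    cut. *)

Section Derivation.
Context {R : realType}.
Implicit Types (f g : R -> R) (x a b d e : R).

Lemma is_derive1D f g x d e : is_derive x 1 f d -> is_derive x 1 g e ->
  is_derive x 1 (fun t => f t + g t) (d + e).
Proof. by move=> ? ?; exact: is_deriveD. Qed.

Lemma is_derive1B f g x d e : is_derive x 1 f d -> is_derive x 1 g e ->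
  is_derive x 1 (fun t => f t - g t) (d - e).
Proof. by move=> ? ?; exact: is_deriveB. Qed.

Lemma is_derive1N f x d : is_derive x 1 f d ->
  is_derive x 1 (fun t => - f t) (- d).
Proof. by move=> ?; exact: is_deriveN. Qed.

Lemma is_derive1M f g x d e : is_derive x 1 f d -> is_derive x 1 g e ->
  is_derive x 1 (fun t => f t * g t) (d * g x + f x * e).
Proof.
move=> df dg; apply: (is_derive_eq (is_deriveM df dg)).
by rewrite /GRing.scale /=; ring.
Qed.

Lemma is_derive1X f n x d : is_derive x 1 f d ->
  is_derive x 1 (fun t => f t ^+ n) (f x ^+ n.-1 *+ n * d).
Proof.
move=> df; rewrite (_ : (fun t => _) = f ^+ n); last by rewrite exprfctE.
apply: (is_derive_eq (is_deriveX n df)).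
by rewrite /GRing.scale /= mulr_natl.
Qed.

Lemma is_derive1V f x d : f x != 0 -> is_derive x 1 f d ->
  is_derive x 1 (fun t => (f t)^-1) (- (d / f x ^+ 2)).
Proof.
move=> fx0 df; apply: (is_derive_eq (is_deriveV fx0 df)).
by rewrite /GRing.scale /= mulNr mulrC.
Qed.

Lemma is_derive1_comp2 f g x d e : is_derive x 1 g e ->
  is_derive (g x) 1 f d -> is_derive x 1 (fun t => f (g t)) (d * e).
Proof. by move=> dg df; exact: (is_derive1_comp df dg). Qed.

Lemma is_derive1_expR f x d : is_derive x 1 f d ->
  is_derive x 1 (fun t => expR (f t)) (expR (f x) * d).
Proof. by move=> df; exact: (is_derive1_comp2 df). Qed.

Lemma is_derive1_ln f x d : 0 < f x -> is_derive x 1 f d ->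
  is_derive x 1 (fun t => ln (f t)) (d / f x).
Proof.
move=> fx0 df; rewrite mulrC.
by apply: (is_derive1_comp2 df); exact: is_derive1_ln.
Qed.

Lemma is_derive1_sin f x d : is_derive x 1 f d ->
  is_derive x 1 (fun t => sin (f t)) (cos (f x) * d).
Proof. by move=> df; exact: (is_derive1_comp2 df). Qed.

Lemma is_derive1_cos f x d : is_derive x 1 f d ->
  is_derive x 1 (fun t => cos (f t)) (- sin (f x) * d).
Proof. by move=> df; exact: (is_derive1_comp2 df). Qed.

Lemma is_derive1_id x : is_derive x 1 (fun t : R => t) 1.
Proof. exact: is_derive_id. Qed.

Lemma is_derive1_cst x a : is_derive x 1 (fun _ : R => a) 0.
Proof. exact: is_derive_cst. Qed.

End Derivation.

(** Differentiation driven by the shape of the function; subtraction is tried before addition, since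
    [f - g] stands for [f + - g]. *)
Ltac derivation_step :=
  match goal with
  | H : is_derive ?x 1 ?f _ |- is_derive ?x 1 ?f _ => exact: H
  | H : is_derive ?x 1 ?f _ |- is_derive ?x 1 (fun t => ?f t) _ => exact: H
  | |- is_derive _ 1 (fun _ => ?c) _ => exact: is_derive1_cst
  | |- is_derive _ 1 (fun t => t) _ => exact: is_derive1_id
  | |- is_derive _ 1 (fun t => @?f t - @?g t) _ =>
      notypeclasses refine (@is_derive1B _ f g _ _ _ _ _)
  | |- is_derive _ 1 (fun t => @?f t + @?g t) _ =>
      notypeclasses refine (@is_derive1D _ f g _ _ _ _ _)
  | |- is_derive _ 1 (fun t => - @?f t) _ =>
      notypeclasses refine (@is_derive1N _ f _ _ _)
  | |- is_derive _ 1 (fun t => @?f t * @?g t) _ =>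
      notypeclasses refine (@is_derive1M _ f g _ _ _ _ _)
  | |- is_derive _ 1 (fun t => @?f t ^+ ?n) _ =>
      notypeclasses refine (@is_derive1X _ f n _ _ _)
  | |- is_derive _ 1 (fun t => (@?f t)^-1) _ =>
      notypeclasses refine (@is_derive1V _ f _ _ _ _)
  | |- is_derive _ 1 (fun t => expR (@?f t)) _ =>
      notypeclasses refine (@is_derive1_expR _ f _ _ _)
  | |- is_derive _ 1 (fun t => ln (@?f t)) _ =>
      notypeclasses refine (@is_derive1_ln _ f _ _ _ _)
  | |- is_derive _ 1 (fun t => sin (@?f t)) _ =>
      notypeclasses refine (@is_derive1_sin _ f _ _ _)
  | |- is_derive _ 1 (fun t => cos (@?f t)) _ =>
      notypeclasses refine (@is_derive1_cos _ f _ _ _)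
  end.

Ltac derivation :=
  notypeclasses refine (is_derive_eq _ _); [repeat derivation_step|..]; cbv beta.

Section Monotone.
Context {R : realType}.
Implicit Types (f df u P D : R -> R) (a b : R).

Lemma is_derive_continuous f (x d : R) : is_derive x 1 f d -> {for x, continuous f}.
Proof. by case=> + _; move/derivable1_diffP/differentiable_continuous. Qed.

Lemma derive_ge0_le f df a b : a <= b ->
  (forall x, a <= x <= b -> is_derive x 1 f (df x)) ->
  (forall x, a <= x <= b -> 0 <= df x) -> f a <= f b.
Proof.
move=> ab fdf df0; have ab' x : x \in `]a, b[ -> a <= x <= b.
  by rewrite in_itv/= => /andP[? ?]; rewrite !ltW.
have [x xab||x] := @MVT_segment _ f df a b ab.
- by apply: fdf; exact: ab'.
- apply: continuous_in_subspaceT => x /set_mem/=.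
  by rewrite in_itv/= => /fdf/is_derive_continuous.
- rewrite in_itv/= => /df0 dfx fE; rewrite -subr_ge0 fE.
  by rewrite mulr_ge0 ?subr_ge0.
Qed.

(** Cauchy-Schwarz, with a primitive [D] of [f' ^ 2] in place of its integral: for the mean slope
    [k], the square [(f' - k) ^ 2] is the derivative of [G]. The one-dimensional estimates below
    have this shape, an integral inequality read as the monotonicity of an explicit function. *)
Lemma sqr_le_energy f df D a b : a <= b ->
  (forall x, a <= x <= b -> is_derive x 1 f (df x)) ->
  (forall x, a <= x <= b -> is_derive x 1 D (df x ^+ 2)) ->
  (f b - f a) ^+ 2 <= (b - a) * (D b - D a).
Proof.
move=> ab fdf Ddf; have [ba|ba] := eqVneq a b.
  by rewrite ba !subrr mul0r expr0n.
have ba0 : 0 < b - a by rewrite subr_gt0 lt_neqAle ba.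
pose k := (f b - f a) / (b - a).
pose G x := D x - (k *+ 2) * f x + k ^+ 2 * x.
have : G a <= G b.
  apply: (@derive_ge0_le G (fun x => (df x - k) ^+ 2)) => // x xab.
    have ? := fdf _ xab; have ? := Ddf _ xab.
    by rewrite /G; derivation; ring.
  exact: sqr_ge0.
rewrite /G => H.
have kE : f b - f a = k * (b - a) by rewrite /k divfK// lt0r_neq0.
have {}H : k ^+ 2 * (b - a) <= D b - D a.
  rewrite -subr_ge0.
  suff -> : D b - D a - k ^+ 2 * (b - a) = D b - D a - (k *+ 2) * (f b - f a) + k^+2 * (b - a).
    by lra.
  by rewrite kE; ring.
have -> : (f b - f a) ^+ 2 = (b - a) * (k ^+ 2 * (b - a)) by rewrite kE; ring.
by rewrite ler_wpM2l// ltW.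
Qed.

End Monotone.

(** * Pointwise bounds for the density *)

Section Liouville1.
Context {R : realType}.
Implicit Types (u du d2u P Q : R -> R) (a b m k e : R).

(* [u] is the logarithm of the density, [P] and [Q] are primitives of the
   density and of its square. *)
Definition liouville1 a b k e u du d2u P Q :=
  forall t, a <= t <= b ->
    [/\ is_derive t 1 u (du t), is_derive t 1 du (d2u t),
        is_derive t 1 P (expR (u t)), is_derive t 1 Q (expR (u t) ^+ 2) &
        - expR (u t) - k * expR (u t) ^+ 2 - e <= d2u t].

(** The reflection [t -> - t], which turns estimates to the right of a point into estimates to its
    left. *)
Lemma liouville1N a b k e u du d2u P Q : liouville1 a b k e u du d2u P Q ->
  liouville1 (- b) (- a) k e (fun t => u (- t)) (fun t => - du (- t))
    (fun t => d2u (- t)) (fun t => - P (- t)) (fun t => - Q (- t)).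
Proof.
move=> H t tab; have [|h1 h2 h3 h4 h5] := H (- t); first by lra.
have hN : is_derive t 1 (fun s : R => - s) (- 1) by derivation.
split => //.
- by apply: (is_derive_eq (is_derive1_comp2 hN h1)); ring.
- by apply: (is_derive_eq (is_derive1N (is_derive1_comp2 hN h2))); ring.
- by apply: (is_derive_eq (is_derive1N (is_derive1_comp2 hN h3))); ring.
- by apply: (is_derive_eq (is_derive1N (is_derive1_comp2 hN h4))); ring.
Qed.

Lemma liouville1S a b a' b' k e u du d2u P Q : a <= a' -> b' <= b ->
  liouville1 a b k e u du d2u P Q -> liouville1 a' b' k e u du d2u P Q.
Proof. by move=> aa bb H t tab; apply: H; lra. Qed.

Lemma exists_max_right a b u du : a <= b ->
  (forall t, a <= t <= b -> is_derive t 1 u (du t)) ->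
  exists2 c, a <= c <= b & (forall t, a <= t <= b -> u t <= u c) /\
     [\/ c = a, c = b | du c = 0].
Proof.
move=> ab Hu.
have [c cab cmax] : exists2 c, c \in `[a, b] & forall t, t \in `[a, b] -> u t <= u c.
  apply: EVT_max => //; apply: continuous_in_subspaceT => x /set_mem/=.
  by rewrite in_itv/= => /Hu/is_derive_continuous.
move: (cab); rewrite in_itv/= => cab'.
exists c => //; split; first by move=> t tab; apply: cmax; rewrite in_itv.
have [ca|ca] := eqVneq c a; first by constructor 1.
have [cb|cb] := eqVneq c b; first by constructor 2.
constructor 3.
have cab2 : c \in `]a, b[.
  by rewrite in_itv/= !lt_neqAle cb eq_sym ca.
have dc : is_derive c 1 u 0.
  apply: (@derive1_at_max _ _ a b) => // t tab.
    have [] // : is_derive t 1 u (du t).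
    by apply: Hu; move: tab; rewrite in_itv/= => /andP[? ?]; rewrite !ltW.
  by apply: cmax; exact: subset_itv_oo_cc.
by case: dc => _ <-; case: (Hu _ cab') => _ ->.
Qed.

(** Beyond the maximum point [t2] of [u] on [[t1, t]], where [u' >= 0], the slope can only drop by
    the mass crossed, so the density itself drops by at most about [m ^ 2]. The quadratic error
    costs a further [k m ^ 2 S / 2 <= S / 2], which explains the factor 2 in the conclusion. *)
Lemma density_lower_bound a b k e m u du d2u P Q t1 t :
  liouville1 a b k e u du d2u P Q ->
  0 <= k -> 0 <= m -> k * m ^+ 2 <= 1 -> 0 <= e -> e * (b - a) <= m / 2 ->
  P b - P a <= m -> a <= t1 -> t1 <= t -> t <= b -> 0 <= du t1 ->
  expR (u t1) / 2 - m ^+ 2 <= expR (u t).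
Proof.
move=> H k0 m0 km e0 em Pm at1 t1t tb du1.
have [t2 /andP[t12 t2t] [t2max t2d]] : exists2 c, t1 <= c <= t & (forall s, t1 <= s <= t -> u s <= u c) /\
     [\/ c = t1, c = t | du c = 0].
  apply: exists_max_right => // s sab; by have [|] := H s; first lra.
have r12 : expR (u t1) <= expR (u t2) by rewrite ler_expR t2max// lexx.
have rt1 := expR_gt0 (u t1).
have [t2E|t2t'] := eqVneq t2 t.
  rewrite -t2E; suff : 0 <= m ^+ 2 by lra.
  exact: sqr_ge0.
have du2 : 0 <= du t2.
  by case: t2d => [->//|t2E|->//]; rewrite t2E eqxx in t2t'.
set S := expR (u t2).
have Pmono x y : a <= x -> x <= y -> y <= b -> P x <= P y.
  move=> ax xy yb; apply: (@derive_ge0_le _ P (fun t => expR (u t))) => // s sxy.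
    by have [|] := H s; first lra.
have rS s : t2 <= s <= t -> expR (u s) <= S.
  by move=> st; rewrite ler_expR t2max//; lra.
have ba0 : 0 <= b - a by lra.
have duge s : t2 <= s -> s <= t ->
    - (P s - P t2) * (1 + k * S) - e * (b - a) <= du s.
  move=> st2 st.
  pose G x := du x + (P x - P t2) * (1 + k * S) + e * x.
  have : G t2 <= G s.
    apply: (@derive_ge0_le _ G (fun x => d2u x + expR (u x) * (1 + k * S) + e)) => // x xs.
      have [|? ? ? ? ?] := H x; first by lra.
      by rewrite /G; derivation; ring.
    have [|_ _ _ _] := H x; first by lra.
    have rx := expR_gt0 (u x).
    have : 0 <= k * (expR (u x) * (S - expR (u x))).
      apply: mulr_ge0 => //; apply: mulr_ge0; first exact: ltW.
      by rewrite subr_ge0; apply: rS; lra.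
    by lra.
  rewrite /G.
  have : e * (s - t2) <= e * (b - a) by rewrite ler_wpM2l//; lra.
  by lra.
(* This is [duge] multiplied by the density and integrated from [t2]. *)
pose G x := expR (u x) + (P x - P t2) ^+ 2 / 2 * (1 + k * S)
           + e * (b - a) * (P x - P t2).
have : G t2 <= G t.
  apply: (@derive_ge0_le _ G (fun x => expR (u x) * (du x + (P x - P t2) * (1 + k * S) + e * (b - a)))) => // x xs.
    have [|? ? ? ? ?] := H x; first by lra.
    by rewrite /G; derivation; field.
  apply: mulr_ge0; first exact: expR_ge0.
  have := duge x; lra.
rewrite /G subrr expr0n /= mul0r mul0r mulr0 !addr0 -/S.
set p := P t - P t2.
have p0 : 0 <= p by rewrite subr_ge0; apply: Pmono; lra.
have pm : p <= m.
  have : P a <= P t2 by apply: Pmono; lra.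
  have : P t <= P b by apply: Pmono; lra.
  by rewrite /p; lra.
have p2 : p ^+ 2 <= m ^+ 2 by rewrite ler_sqr// nnegrE.
have S0 : 0 < S := expR_gt0 _.
have h1 : p ^+ 2 / 2 * (1 + k * S) <= m ^+ 2 / 2 * (1 + k * S).
  rewrite ler_wpM2r//; last by rewrite ler_wpM2r// invr_ge0.
  by rewrite addr_ge0// mulr_ge0// ltW.
have h2 : e * (b - a) * p <= m / 2 * m.
  by rewrite ler_pM// mulr_ge0.
have h3 : k * m ^+ 2 * S <= 1 * S by rewrite ler_wpM2r// ltW.
move: r12; rewrite -/S => r12.
move: h2 h3 h1 => /=.
rewrite (_ : m ^+ 2 / 2 * (1 + k * S) = m ^+2 /2 + k * m ^+ 2 * S / 2); last by field.
rewrite (_ : m / 2 * m = m ^+ 2 / 2); last by field.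
by lra.
Qed.

End Liouville1.

Section SupBound.
Context {R : realType}.
Implicit Types (u du d2u P Q : R -> R) (a b m k e : R).

(** Where [u' >= 0], the density stays above [expR (u t) / 2 - m ^+ 2] up to [b], while its integral
    there is at most [m]. As [m (b - t) <= 8], the defect [m ^ 2 (b - t)] is at most [8 m], and 18
    is [2 (1 + 8)]. *)
Lemma density_right_bound a b k e m u du d2u P Q t :
  liouville1 a b k e u du d2u P Q ->
  0 <= k -> 0 <= m -> k * m ^+ 2 <= 1 -> 0 <= e -> e * (b - a) <= m / 2 ->
  m * (b - a) <= 8 -> P b - P a <= m -> a <= t -> t <= b -> 0 <= du t ->
  expR (u t) * (b - t) <= 18 * m.
Proof.
move=> H k0 m0 km e0 em m8 Pm at1 tb dut.
have Pta : P a <= P t.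
  apply: (@derive_ge0_le _ P (fun t => expR (u t))) => // s sxy.
  by have [|] := H s; first by clear -sxy at1 tb; lra.
pose c := expR (u t) / 2 - m ^+ 2.
pose G s := P s - c * s.
have : G t <= G b.
  apply: (@derive_ge0_le _ G (fun s => expR (u s) - c)) => // s sxy.
    have [|_ _ ? _ _] := H s; first by clear -sxy at1 tb; lra.
    by rewrite /G; derivation; ring.
  rewrite subr_ge0; case/andP: sxy => ts sb.
  exact: (density_lower_bound H k0 m0 km e0 em Pm at1 ts sb dut).
rewrite /G => Gtb.
have h : c * (b - t) <= m by clear -Gtb Pm Pta; lra.
have h2 : m * (b - t) <= 8.
  by apply: le_trans m8; rewrite ler_wpM2l//; clear -at1; lra.
have h3 : m * (m * (b - t)) <= m * 8 by rewrite ler_wpM2l.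
move: h h3; rewrite /c.
rewrite (_ : (expR (u t) / 2 - m ^+ 2) * (b - t) = expR (u t) * (b - t) / 2 - m * (m * (b - t))); last by field.
by set x := expR _ * _; set y := m * (m * _); clear; lra.
Qed.

(* A bump of height [r] is at least [1/r] wide, since the curvature is bounded
   by the mass; so the density is at most a multiple of the mass over the
   distance to the boundary. *)
Lemma density_bound a b k e m u du d2u P Q t :
  liouville1 a b k e u du d2u P Q ->
  0 <= k -> 0 <= m -> k * m ^+ 2 <= 1 -> 0 <= e -> e * (b - a) <= m / 2 ->
  m * (b - a) <= 8 -> P b - P a <= m -> a <= t -> t <= b ->
  expR (u t) * Num.min (t - a) (b - t) <= 18 * m.
Proof.
move=> H k0 m0 km e0 em m8 Pm at1 tb.
have r0 := expR_ge0 (u t).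
have [dut|dut] := leP 0 (du t).
  apply: le_trans (density_right_bound H k0 m0 km e0 em m8 Pm at1 tb dut).
  by rewrite ler_wpM2l// ge_min lexx orbT.
have ba : - a - - b = b - a by ring.
have := @density_right_bound (- b) (- a) k e m _ _ _ _ _ (- t) (liouville1N H).
rewrite ba !opprK !lerN2 => /(_ k0 m0 km e0 em m8).
rewrite (addrC (- P a)) (addrC (- a)).
move=> /(_ Pm tb at1); rewrite oppr_ge0 ltW// => /(_ isT).
by apply: le_trans; rewrite ler_wpM2l// ge_min lexx.
Qed.

End SupBound.

(** * The energy inequality on intervals *)

Section HalfLine.
Context {R : realType}.
Implicit Types (u du d2u P Q phi dphi D A : R -> R) (a b m k e s : R).

(* [h = 2 - (t - s) (P t - P s - c)] is a supersolution of [h'' + r h <= 0] up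
   to the error terms: in the equality case it is the derivative of [u] along
   the dilations around [s].  The inequality is Barta's, written with
   [p = - h' / h]. *)
Lemma half_line_energy s b k e m c d K u du d2u P Q phi dphi D A :
  s < b -> liouville1 s b k e u du d2u P Q ->
  0 <= k -> 0 <= m -> 0 <= e -> 0 < d -> d <= 2 -> 0 <= K ->
  P b - P s <= m -> c <= du s -> (b - s) * (P b - P s - c) <= 2 - d ->
  (forall t, s <= t <= b -> expR (u t) * (b - t) <= K) ->
  (forall t, s <= t <= b -> is_derive t 1 phi (dphi t)) -> phi b = 0 ->
  (forall t, s <= t <= b -> is_derive t 1 D (dphi t ^+ 2)) ->
  (forall t, s <= t <= b -> is_derive t 1 A (expR (u t) * phi t ^+ 2)) ->
  A b - A s <= D b - D s + c / 2 * phi s ^+ 2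
    + (b - s) * (k * K * m + e * (b - s) ^+ 2) / d * m * (D b - D s).
Proof.
move=> sb H k0 m0 e0 d0 d2 K0 Pm cdu hc rK phid phib Dd Ad.
have sb' := ltW sb.
have Pmono x y : s <= x -> x <= y -> y <= b -> P x <= P y.
  move=> sx xy yb; apply: (@derive_ge0_le _ P (fun t => expR (u t))) => // t txy.
  by have [|] := H t; first by clear -sx yb txy; lra.
pose h t := 2 - (t - s) * (P t - P s - c).
pose dh t := - (P t - P s - c) - (t - s) * expR (u t).
have hd t : s <= t <= b -> d <= h t.
  move=> /andP[st tb]; rewrite /h.
  have [Pc|Pc] := leP (P t - P s - c) 0.
    have : 0 <= (t - s) * (- (P t - P s - c)) by rewrite mulr_ge0 ?subr_ge0// oppr_ge0.
    by clear -d2; lra.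
  have : (t - s) * (P t - P s - c) <= (b - s) * (P b - P s - c).
    have Ptb := Pmono _ _ st tb (lexx b).
    apply: ler_pM; [by rewrite subr_ge0|exact: ltW|by rewrite lerB|by rewrite !lerB].
  by clear -hc; lra.
have hgt0 t : s <= t <= b -> 0 < h t by move=> /hd; exact: lt_le_trans.
pose E t := k * (Q t - Q s) + e * (b - s).
(* Without errors [u' >= c - (P t - P s)], which is exactly what makes [h] a supersolution; [E] is
   the integrated error. *)
have duE t : s <= t <= b -> c - (P t - P s) - E t <= du t.
  move=> /andP[st tb].
  pose G x := du x + P x + k * Q x + e * x.
  have : G s <= G t.
    apply: (@derive_ge0_le _ G (fun x => d2u x + expR (u x) + k * expR (u x) ^+ 2 + e)) => // x xs.
      have [|? ? ? ? ?] := H x; first by clear -xs tb; lra.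
      by rewrite /G; derivation; ring.
    have [|_ _ _ _] := H x; first by clear -xs tb; lra.
    by clear; lra.
  rewrite /G /E.
  have : e * (t - s) <= e * (b - s) by rewrite ler_wpM2l// lerB.
  by clear -cdu; lra.
have DbDs t : s <= t <= b -> phi t ^+ 2 <= (b - t) * (D b - D s).
  move=> /andP[st tb].
  have := @sqr_le_energy _ phi dphi D t b tb.
  rewrite phib sub0r sqrrN => phi2.
  apply: (le_trans (phi2 _ _)).
  - by move=> x /andP[tx xb]; apply: phid; rewrite (le_trans st tx).
  - by move=> x /andP[tx xb]; apply: Dd; rewrite (le_trans st tx).
  rewrite ler_wpM2l ?subr_ge0// lerB//.
  apply: (@derive_ge0_le _ D (fun x => dphi x ^+ 2)) => // x /andP[sx xt].
    by apply: Dd; rewrite sx (le_trans xt tb).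
  exact: sqr_ge0.
(* The integral of the squared density may be large near [b], but the weight [b - t] absorbs one
   factor: [(b - x) expR (u x) <= K]. *)
have bsE t : s <= t <= b -> (b - t) * E t <= k * K * m + e * (b - s) ^+ 2.
  move=> /andP[st tb].
  pose G x := K * P x - (b - t) * Q x.
  have : G s <= G t.
    apply: (@derive_ge0_le _ G (fun x => expR (u x) * (K - (b - t) * expR (u x)))) => // x xs.
      have [|? ? ? ? ?] := H x; first by clear -xs tb; lra.
      by rewrite /G; derivation; ring.
    rewrite mulr_ge0 ?expR_ge0// subr_ge0 mulrC.
    apply: (@le_trans _ _ (expR (u x) * (b - x))).
      by rewrite ler_wpM2l ?expR_ge0// lerB//; case/andP: xs.
    by apply: rK; clear -xs tb; lra.
  rewrite /G /E mulrDr => Gst.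
  have h1 : k * ((b - t) * (Q t - Q s)) <= k * (K * m).
    rewrite ler_wpM2l//; apply: (@le_trans _ _ (K * (P t - P s))).
      by clear -Gst; lra.
    rewrite ler_wpM2l//; apply: le_trans Pm.
    by rewrite lerB// (Pmono t b).
  have h2 : (b - t) * (e * (b - s)) <= e * (b - s) ^+ 2.
    rewrite mulrCA expr2 ler_wpM2l// ler_wpM2r ?subr_ge0//.
    by rewrite lerB.
  rewrite -mulrA; apply: le_trans (lerD h1 h2).
  by rewrite le_eqVlt; apply/orP; left; apply/eqP; ring.
(* Bound for the error left after completing the square: the weight [b - t] of [bsE] comes from
   [phi ^ 2 <= (b - t) (D b - D s)], and [h >= d] bounds the denominator. *)
pose c0 := (b - s) * (k * K * m + e * (b - s) ^+ 2) / d * (D b - D s).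
have D0 : 0 <= D b - D s.
  rewrite subr_ge0; apply: (@derive_ge0_le _ D (fun x => dphi x ^+ 2)) => // x _; exact: sqr_ge0.
have E0 t : s <= t <= b -> 0 <= E t.
  move=> /andP[st tb]; rewrite /E addr_ge0 ?mulr_ge0 ?subr_ge0//.
  apply: (@derive_ge0_le _ Q (fun t => expR (u t) ^+ 2)) => // x /andP[sx xt].
  by have [|] := H x; first by rewrite sx (le_trans xt tb).
pose p t := - dh t / h t.
pose dp t := (expR (u t) * (2 + (t - s) * du t)) / h t + p t ^+ 2.
have pd t : s <= t <= b -> is_derive t 1 p (dp t).
  move=> st; have [? ? ? ? ?] := H _ st; have hn := lt0r_neq0 (hgt0 _ st).
  rewrite /p /dp /p /dh /h in hn *; derivation; [exact: hn|].
  by field; exact: hn.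
(* Barta's argument: the derivative of [p phi ^ 2 + D - A] is [(p phi + phi') ^ 2] plus the density
   times the defect of [h] as a supersolution. The term [c0 P] pays for the defect. *)
pose G t := p t * phi t ^+ 2 + D t - A t + c0 * P t.
have : G s <= G b.
  apply: (@derive_ge0_le _ G (fun t => dp t * phi t ^+ 2 + p t * (phi t * dphi t) *+ 2 + dphi t ^+ 2 - expR (u t) * phi t ^+ 2 + c0 * expR (u t))) => // t st.
    have [? ? ? ? ?] := H _ st.
    have ? := pd _ st; have ? := phid _ st; have ? := Dd _ st; have ? := Ad _ st.
    by rewrite /G; derivation; ring.
  have -> : dp t * phi t ^+ 2 + p t * (phi t * dphi t) *+ 2 + dphi t ^+ 2 - expR (u t) * phi t ^+ 2 + c0 * expR (u t)
    = (p t * phi t + dphi t) ^+ 2 + expR (u t) * (c0 + (t - s) * (du t + (P t - P s - c)) * phi t ^+ 2 / h t).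
    rewrite /dp; have := lt0r_neq0 (hgt0 _ st).
    move: (p t) => pt; rewrite /h => hn; field; exact: hn.
  rewrite addr_ge0 ?sqr_ge0// mulr_ge0 ?expR_ge0//.
  have [st1 st2] := andP st.
  have ht := hgt0 _ st.
  have le1 : - ((t - s) * E t * phi t ^+ 2 / h t) <= (t - s) * (du t + (P t - P s - c)) * phi t ^+ 2 / h t.
    rewrite -!mulNr ler_wpM2r ?invr_ge0 ?(ltW ht)//.
    rewrite ler_wpM2r ?sqr_ge0// mulNr -mulrN ler_wpM2l ?subr_ge0//.
    by have := duE _ st; clear; lra.
  have le2 : (t - s) * E t * phi t ^+ 2 / h t <= c0.
    apply: (@le_trans _ _ ((b - s) * E t * ((b - t) * (D b - D s)) / d)).
      apply: ler_pM.
      - by apply: mulr_ge0; [apply: mulr_ge0; [rewrite subr_ge0|exact: E0]|exact: sqr_ge0].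
      - by rewrite invr_ge0 ltW.
      - apply: ler_pM; rewrite ?sqr_ge0//.
        + by apply: mulr_ge0; [rewrite subr_ge0|exact: E0].
        + by apply: ler_wpM2r; [exact: E0|rewrite lerB].
        + exact: DbDs.
      - by rewrite lef_pV2 ?posrE// hd.
    rewrite /c0.
    rewrite (_ : _ / d = (b - s) * (D b - D s) / d * ((b - t) * E t)); last by ring.
    rewrite (_ : _ / d * (D b - D s) = (b - s) * (D b - D s) / d * (k * K * m + e * (b - s) ^+ 2)); last by ring.
    rewrite ler_wpM2l ?(bsE _ st)//.
    by rewrite !mulr_ge0 ?subr_ge0// ?invr_ge0 ?(ltW d0)// -subr_ge0.
  by clear -le1 le2; lra.
rewrite /G phib expr0n /= mulr0 add0r.
(* [h s = 2] and [h' s = c], whence the boundary term [c / 2 * phi s ^+ 2]. *)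
have -> : p s = - (c / 2).
  by rewrite /p /dh /h !subrr !mul0r !subr0 !sub0r; field.
have : c0 * (P b - P s) <= c0 * m.
  rewrite ler_wpM2l//; apply: mulr_ge0 => //.
  apply: mulr_ge0; last by rewrite invr_ge0 ltW.
  apply: mulr_ge0; first by rewrite subr_ge0.
  by apply: addr_ge0; apply: mulr_ge0; rewrite ?sqr_ge0//; apply: mulr_ge0.
have -> : c0 * m = (b - s) * (k * K * m + e * (b - s) ^+ 2) / d * m * (D b - D s).
  by rewrite /c0; ring.
set x := _ / d * m * _; clear; lra.
Qed.

End HalfLine.

Section Interval.
Context {R : realType}.
Implicit Types (u du d2u P Q phi dphi D A : R -> R) (a b m k e s c : R).

(** The first alternative is the half-line estimate with its constants made explicit. The second one
    serves a point [s] at distance one from the end: there [phi ^ 2] is at most the energy, so the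
    weighted integral is at most [m] times the energy, and the energy itself pays for the boundary
    term as long as [- c <= 2]. *)
Lemma right_piece_energy a b k e m d u du d2u P Q phi dphi D A s c :
  liouville1 a b k e u du d2u P Q ->
  0 <= k -> 0 <= m -> k * m ^+ 2 <= 1 -> 0 <= e -> e * (b - a) <= m / 2 ->
  e * (b - a) ^+ 3 <= 1 -> 0 < d -> d <= 1 -> 1 <= b - a ->
  m * (b - a) <= 8 -> P b - P a <= m ->
  a + 1 <= s -> s <= b - 1 ->
  (forall t, a <= t <= b -> is_derive t 1 phi (dphi t)) -> phi b = 0 ->
  (forall t, a <= t <= b -> is_derive t 1 D (dphi t ^+ 2)) ->
  (forall t, a <= t <= b -> is_derive t 1 A (expR (u t) * phi t ^+ 2)) ->
  (c <= du s /\ (b - s) * (P b - P s - c) <= 2 - d) \/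
  (s = b - 1 /\ - c <= 2) ->
  A b - A s <= (1 + (36 * 64 * k + 1) / d * m) * (D b - D s) + c / 2 * phi s ^+ 2.
Proof.
move=> H k0 m0 km e0 em e3 d0 d1 ba m8 Pm as1 sb1 phid phib Dd Ad hc.
have sb : s < b by clear -sb1; lra.
have as' : a <= s by clear -as1; lra.
have sub t : s <= t <= b -> a <= t <= b by case/andP=> st ->; rewrite (le_trans as' st).
have Ds : 0 <= D b - D s.
  rewrite subr_ge0; apply: (@derive_ge0_le _ D (fun x => dphi x ^+ 2)).
  - exact: ltW.
  - by move=> x /sub; exact: Dd.
  - by move=> x _; exact: sqr_ge0.
have Pas : P a <= P s.
  apply: (@derive_ge0_le _ P (fun t => expR (u t))) => // t /andP[at1 ts].
  by have [|] := H t; first by rewrite at1 (le_trans ts (ltW sb)).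
have Psm : P b - P s <= m by clear -Pm Pas; lra.
have id1 : 1 <= d^-1 by rewrite invf_ge1.
have c0ge : m <= (36 * 64 * k + 1) / d * m.
  rewrite ler_peMl//; apply: (@le_trans _ _ (1 / d)); first by rewrite mul1r.
  by rewrite ler_wpM2r ?invr_ge0 ?(ltW d0)// lerDr !mulr_ge0 ?ler0n.
case: hc => [[cdu hc]|[sE c2]].
(* If [t] is closer to [a], then [t - a >= 1] bounds the density by [18 m]; otherwise the density
   bound already has the weight [b - t]. *)
- have rK t : s <= t <= b -> expR (u t) * (b - t) <= 18 * m * (1 + (b - a)).
    move=> st; have /andP[st1 tb] := st; have /andP[at1 _] := sub _ st.
    have := density_bound H k0 m0 km e0 em m8 Pm at1 tb.
    have h18 : 0 <= 18 * m * (b - a).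
      by rewrite mulr_ge0 ?mulr_ge0//; clear -ba; lra.
    rewrite minEle; case: ifP => [h1|_ h2].
      have r18 : expR (u t) * 1 <= expR (u t) * (t - a).
        by rewrite ler_wpM2l ?expR_ge0//; clear -as1 st1; lra.
      move=> h2.
      have : expR (u t) * (b - t) <= 18 * m * (b - a).
        apply: ler_pM; [exact: expR_ge0|by rewrite subr_ge0| |by rewrite lerB].
        by clear -r18 h2; lra.
      by clear -m0; lra.
    by clear -h2 h18 m0; lra.
  have Hs := liouville1S as' (lexx b) H.
  have K0 : 0 <= 18 * m * (1 + (b - a)).
    by apply: mulr_ge0; [exact: mulr_ge0|clear -ba; lra].
  have d2 : d <= 2 by clear -d1; lra.
  have := @half_line_energy _ s b k e m c d _ u du d2u P Q phi dphi D A sb Hs k0 m0 e0 d0 d2 K0 Psm cdu hc rK (fun t st => phid _ (sub _ st)) phib (fun t st => Dd _ (sub _ st)) (fun t st => Ad _ (sub _ st)).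
  set B := (b - s) * _.
  suff hB : B <= 36 * 64 * k + 1.
    have : B / d * m * (D b - D s) <= (36 * 64 * k + 1) / d * m * (D b - D s).
      do 2 (rewrite ler_wpM2r//).
      by rewrite ler_wpM2r// invr_ge0 ltW.
    set x := B / d * m * _; set y := (_ + 1) / d * m.
    by rewrite mulrDl mul1r; clear; lra.
  (* With [K = 18 m (1 + (b - a)) <= 36 m (b - a)] the first term is at most [36 k (m (b - a)) ^ 2],
     hence [36 * 64 * k]; the second is at most [e (b - a) ^ 3 <= 1]. *)
  rewrite /B mulrDr; apply: lerD.
    rewrite (_ : _ * _ = k * ((b - s) * (18 * m * (1 + (b - a))) * m)); last by ring.
    rewrite mulrC ler_wpM2r//.
    apply: (@le_trans _ _ ((b - a) * (18 * m * ((b - a) + (b - a))) * m)).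
      rewrite ler_wpM2r//; apply: ler_pM => //.
      - by rewrite subr_ge0 ltW.
      - by rewrite lerB.
      - by rewrite ler_wpM2l ?mulr_ge0// lerD2r.
    rewrite (_ : _ * _ * _ = 36 * (m * (b - a)) ^+ 2); last by ring.
    have : (m * (b - a)) ^+ 2 <= 8 ^+ 2.
      rewrite ler_sqr ?nnegrE ?ler0n//; apply: mulr_ge0 => //.
      by clear -ba; lra.
    by clear; lra.
  apply: le_trans e3; rewrite mulrCA ler_wpM2l// -exprS.
  apply: lerXn2r; rewrite ?nnegrE ?subr_ge0 ?lerB ?(ltW sb)//.
  by clear -ba; lra.
have bs1 : b - s = 1 by rewrite sE; ring.
have phi2 t : s <= t <= b -> phi t ^+ 2 <= (b - t) * (D b - D s).
  move=> /andP[st tb].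
  have := @sqr_le_energy _ phi dphi D t b tb.
  rewrite phib sub0r sqrrN => phi2.
  apply: (le_trans (phi2 _ _)).
  - by move=> x /andP[tx xb]; apply: phid; apply: sub; rewrite (le_trans st tx).
  - by move=> x /andP[tx xb]; apply: Dd; apply: sub; rewrite (le_trans st tx).
  rewrite ler_wpM2l ?subr_ge0// lerB//.
  apply: (@derive_ge0_le _ D (fun x => dphi x ^+ 2)) => // x /andP[sx xt].
    by apply: Dd; apply: sub; rewrite sx (le_trans xt tb).
  exact: sqr_ge0.
pose G x := (D b - D s) * P x - A x.
have : G s <= G b.
  apply: (@derive_ge0_le _ G (fun x => expR (u x) * ((D b - D s) - phi x ^+ 2))).
  - exact: ltW.
  - move=> x /sub xs; have [? ? ? ? _] := H _ xs; have ? := Ad _ xs.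
    by rewrite /G; derivation; ring.
  - move=> x xs; rewrite mulr_ge0 ?expR_ge0// subr_ge0.
    apply: (le_trans (phi2 _ xs)); rewrite ler_piMl//.
    by case/andP: xs => sx _; clear -sx bs1; lra.
rewrite /G => hG.
have h1 : (D b - D s) * (P b - P s) <= (D b - D s) * m by rewrite ler_wpM2l.
have h2 : m * (D b - D s) <= (36 * 64 * k + 1) / d * m * (D b - D s).
  by rewrite ler_wpM2r.
have h3 : - c * phi s ^+ 2 <= 2 * (D b - D s).
  have := phi2 s; rewrite lexx (ltW sb) bs1 mul1r => /(_ isT) h3.
  have [cn|cp] := leP (- c) 0.
    apply: (@le_trans _ _ 0); last by rewrite mulr_ge0.
    by rewrite mulr_le0_ge0// sqr_ge0.
  by apply: ler_pM => //; [exact: ltW|exact: sqr_ge0].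
move: h2; rewrite [X in _ -> _ <= X + _]mulrDl mul1r.
set y := (36 * 64 * k + 1) / d * m * (D b - D s).
by clear -h1 h3 hG; lra.
Qed.

(** Under reflection the slope [c] changes sign, so the boundary terms of the two pieces cancel when
    added. *)
Lemma left_piece_energy a b k e m d u du d2u P Q phi dphi D A s c :
  liouville1 a b k e u du d2u P Q ->
  0 <= k -> 0 <= m -> k * m ^+ 2 <= 1 -> 0 <= e -> e * (b - a) <= m / 2 ->
  e * (b - a) ^+ 3 <= 1 -> 0 < d -> d <= 1 -> 1 <= b - a ->
  m * (b - a) <= 8 -> P b - P a <= m ->
  a + 1 <= s -> s <= b - 1 ->
  (forall t, a <= t <= b -> is_derive t 1 phi (dphi t)) -> phi a = 0 ->
  (forall t, a <= t <= b -> is_derive t 1 D (dphi t ^+ 2)) ->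
  (forall t, a <= t <= b -> is_derive t 1 A (expR (u t) * phi t ^+ 2)) ->
  (du s <= c /\ (s - a) * (P s - P a + c) <= 2 - d) \/
  (s = a + 1 /\ c <= 2) ->
  A s - A a <= (1 + (36 * 64 * k + 1) / d * m) * (D s - D a) - c / 2 * phi s ^+ 2.
Proof.
move=> H k0 m0 km e0 em e3 d0 d1 ba m8 Pm as1 sb1 phid phia Dd Ad hc.
have baE : - a - - b = b - a by ring.
have := @right_piece_energy (- b) (- a) k e m d _ _ _ _ _ (fun t => phi (- t))
  (fun t => - dphi (- t)) (fun t => - D (- t)) (fun t => - A (- t)) (- s) (- c)
  (liouville1N H) k0 m0 km e0.
rewrite baE /= !opprK !(addrC (- P a)) !(addrC (- A a)) !(addrC (- D a)).
rewrite (_ : - c / 2 * phi s ^+ 2 = - (c / 2 * phi s ^+ 2)); last by ring.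
have hN (t : R) : is_derive t 1 (fun s : R => - s) (- 1) by derivation.
apply => //.
- by clear -sb1; lra.
- by clear -as1; lra.
- move=> t tab; have tab' : a <= - t <= b by clear -tab; lra.
  by apply: (is_derive_eq (is_derive1_comp2 (hN t) (phid _ tab'))); ring.
- move=> t tab; have tab' : a <= - t <= b by clear -tab; lra.
  by apply: (is_derive_eq (is_derive1N (is_derive1_comp2 (hN t) (Dd _ tab')))); ring.
- move=> t tab; have tab' : a <= - t <= b by clear -tab; lra.
  by apply: (is_derive_eq (is_derive1N (is_derive1_comp2 (hN t) (Ad _ tab')))); ring.
- case: hc => [[h1 h2]|[-> h2]]; [left|right].
    split; first by rewrite lerN2.
    apply: le_trans h2; rewrite le_eqVlt; apply/orP; left; apply/eqP; ring.
  by split; first ring.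
Qed.

(* [s] is chosen so that both half lines have a positive supersolution with
   the same slope at [s]; if neither condition held at [s], the total mass would
   exceed [(2 - d) (1 / (b - s) + 1 / (s - a)) >= 4 (2 - d) / (b - a)]. *)
Lemma interval_energy a b k e m d u du d2u P Q phi dphi D A :
  liouville1 a b k e u du d2u P Q ->
  0 <= k -> 0 <= m -> k * m ^+ 2 <= 1 -> 0 <= e -> e * (b - a) <= m / 2 ->
  e * (b - a) ^+ 3 <= 1 -> 0 < d -> d <= 1 -> 2 <= b - a -> m <= 1 ->
  m * (b - a) <= 8 - 4 * d -> P b - P a <= m ->
  (forall t, a <= t <= b -> is_derive t 1 phi (dphi t)) ->
  phi a = 0 -> phi b = 0 ->
  (forall t, a <= t <= b -> is_derive t 1 D (dphi t ^+ 2)) ->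
  (forall t, a <= t <= b -> is_derive t 1 A (expR (u t) * phi t ^+ 2)) ->
  A b - A a <= (1 + (36 * 64 * k + 1) / d * m) * (D b - D a).
Proof.
move=> H k0 m0 km e0 em e3 d0 d1 ba m1 m8 Pm phid phia phib Dd Ad.
suff [s [c [as1 sb1 hr hl]]] : exists s c, [/\ a + 1 <= s, s <= b - 1,
    (c <= du s /\ (b - s) * (P b - P s - c) <= 2 - d) \/
    (s = b - 1 /\ - c <= 2) &
    (du s <= c /\ (s - a) * (P s - P a + c) <= 2 - d) \/
    (s = a + 1 /\ c <= 2)].
  have ba1 : 1 <= b - a by clear -ba; lra.
  have m8' : m * (b - a) <= 8 by clear -m8 d0; lra.
  have := right_piece_energy H k0 m0 km e0 em e3 d0 d1 ba1 m8' Pm as1 sb1 phid phib Dd Ad hr.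
  have := left_piece_energy H k0 m0 km e0 em e3 d0 d1 ba1 m8' Pm as1 sb1 phid phia Dd Ad hl.
  set y := 1 + _; set z := c / 2 * _ => h1 h2.
  rewrite (_ : y * (D b - D a) = y * (D b - D s) + y * (D s - D a)); last by ring.
  by clear -h1 h2; lra.
have Pmono x y : a <= x -> x <= y -> y <= b -> P x <= P y.
  move=> sx xy yb; apply: (@derive_ge0_le _ P (fun t => expR (u t))) => // t txy.
  by have [|] := H t; first by clear -sx yb txy; lra.
pose f s := (b - s) * (P b - P s - du s).
pose g s := (s - a) * (P s - P a + du s).
(* In [(s - a) f s + (b - s) g s] the slope disappears and only the total mass remains; then
   [4 (s - a) (b - s) <= (b - a) ^ 2] contradicts the bound [8 - 4 d]. *)
have fg s : a < s -> s < b -> 2 - d <= f s -> 2 - d < g s -> False.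
  move=> as1 sb1 fs gs.
  have x0 : 0 < s - a by rewrite subr_gt0.
  have y0 : 0 < b - s by rewrite subr_gt0.
  have xy := mulr_gt0 x0 y0.
  have h1 : (s - a) * (2 - d) <= (s - a) * f s by rewrite ler_wpM2l// ltW.
  have h2 : (b - s) * (2 - d) < (b - s) * g s by rewrite ltr_pM2l.
  have h3 : (b - a) * (2 - d) < (s - a) * (b - s) * (P b - P a).
    have -> : (s - a) * (b - s) * (P b - P a) = (s - a) * f s + (b - s) * g s.
      by rewrite /f /g; ring.
    by clear -h1 h2; lra.
  have h4 : (s - a) * (b - s) * (P b - P a) <= (s - a) * (b - s) * m.
    by rewrite ler_wpM2l// ltW.
  have h5 : ((s - a) * (b - s)) * (m * (b - a)) <= (s - a) * (b - s) * (8 - 4 * d).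
    by rewrite ler_wpM2l// ltW.
  have ba0 : 0 < b - a by clear -ba; lra.
  have h6 : (b - a) * ((b - a) * (2 - d)) < (b - a) * ((s - a) * (b - s) * m).
    by rewrite ltr_pM2l//; exact: lt_le_trans h4.
  have h7 : 0 <= (2 - d) * ((s - a) - (b - s)) ^+ 2.
    by rewrite mulr_ge0 ?sqr_ge0//; clear -d1; lra.
  by clear -h5 h6 h7; nra.
(* If the left condition fails at [a + 1], the right one holds there by [fg]. Capping the slope at 2
   opens the unit-segment alternative on the left; should the cap be attained, the right bracket is
   negative, as the mass is at most one. *)
have [ga|ga] := ltP (2 - d) (g (a + 1)).
  have fa : f (a + 1) < 2 - d.
    by rewrite ltNge; apply/negP => fa; apply: (@fg (a + 1)) => //; clear -ba; lra.
  exists (a + 1), (Num.min (du (a + 1)) 2).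
  have P1 : P b - P (a + 1) <= 1.
    have : P a <= P (a + 1) by apply: Pmono; clear -ba; lra.
    by clear -Pm m1; lra.
  split; [by []|by clear -ba; lra| |by right; rewrite ge_min lexx orbT].
  left; split; first by rewrite ge_min lexx.
  rewrite minEle; case: ifP => _; first by move: fa; rewrite /f => /ltW.
  apply: (@le_trans _ _ 0); last by clear -d1; lra.
  rewrite pmulr_rle0; first by clear -P1; lra.
  by clear -ba; lra.
have [fb|fb] := ltP (2 - d) (f (b - 1)).
  have gb : g (b - 1) <= 2 - d.
    by rewrite leNgt; apply/negP => gb; apply: (@fg (b - 1)) => //; [clear -ba; lra|clear -ba; lra|exact: ltW].
  exists (b - 1), (Num.max (du (b - 1)) (- 2)).
  have P1 : P (b - 1) - P a <= 1.
    have : P (b - 1) <= P b by apply: Pmono; clear -ba; lra.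
    by clear -Pm m1; lra.
  split; [by clear -ba; lra|by []|right; split => //|].
    by rewrite lerNl le_max lexx orbT.
  left; split; first by rewrite le_max lexx.
  rewrite maxEle; case: ifP => _; last by move: gb; rewrite /g.
  apply: (@le_trans _ _ 0); last by clear -d1; lra.
  rewrite pmulr_rle0; first by clear -P1; lra.
  by clear -ba; lra.
have [fa|fa] := leP (f (a + 1)) (2 - d).
  exists (a + 1), (du (a + 1)); split; [by []|by clear -ba; lra|left|left]; by split.
(* Now [f] crosses the level [2 - d] between [a + 1] and [b - 1]; at a crossing the right condition
   holds with equality, and [fg] gives the left one. *)
have [s sab fs] : exists2 s, s \in `[a + 1, b - 1] & f s = 2 - d.
  apply: IVT.
  - by clear -ba; lra.
  - apply: continuous_in_subspaceT => x /set_mem/=; rewrite in_itv/= => xab.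
    have [|? ? ? ? _] := H x; first by clear -xab; lra.
    have : is_derive x 1 f (- (P b - P x - du x) + (b - x) * (- expR (u x) - d2u x)).
      by rewrite /f; derivation; ring.
    exact: is_derive_continuous.
  - by rewrite ge_min le_max fb (ltW fa) orbT.
move: sab; rewrite in_itv/= => /andP[as1 sb1].
exists s, (du s); split => //; left; split => //; first by rewrite -/(f s) fs.
rewrite -/(g s) leNgt; apply/negP => gs; apply: (@fg s) => //.
- by clear -as1; lra.
- by clear -sb1; lra.
- by rewrite fs.
Qed.

End Interval.

(** * Integrals over rectangles *)

Section Plane.
Context {R : realType}.
Local Notation mu := (@lebesgue_measure R).
Local Notation area := (@lebesgue_measure R \x @lebesgue_measure R)%E.
Local Notation plane := (measurableTypeR R * measurableTypeR R)%type.
Implicit Types (F G : R * R -> R) (D : set (R * R)).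

(** The product sigma-algebra contains the open sets of the plane, as each is a countable union of
    boxes with rational sides. *)
Lemma open_measurable2 (O : set (R * R)) : open O ->
  measurable (O : set plane).
Proof.
move=> oO.
pose box (q : rat * rat * (rat * rat)) : set (R * R) :=
  `]ratr q.1.1, ratr q.1.2[ `*` `]ratr q.2.1, ratr q.2.2[.
have -> : O = \bigcup_q (if `[< box q `<=` O >] then box q else set0).
  apply/seteqP; split; last first.
    by move=> x [q _]; case: ifPn => // /asboolP; apply.
  move=> [x y] Oxy.
  have /nbhs_ballP [e /= e0 eO] : nbhs (x, y) O by move: oO; rewrite openE; apply.
  have [p1] := @rat_in_itvoo R (x - e) x ltac:(by rewrite gtrBl).
  have [p2] := @rat_in_itvoo R x (x + e) ltac:(by rewrite ltrDl).
  have [p3] := @rat_in_itvoo R (y - e) y ltac:(by rewrite gtrBl).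
  have [p4] := @rat_in_itvoo R y (y + e) ltac:(by rewrite ltrDl).
  rewrite !in_itv/= => /andP[h1 h2] /andP[h3 h4] /andP[h5 h6] /andP[h7 h8].
  exists ((p1, p2), (p3, p4)) => //.
  rewrite ifT; first by split; rewrite /= in_itv/=; apply/andP; split.
  apply/asboolP => -[x' y'] [/=]; rewrite !in_itv/= => /andP[k1 k2] /andP[k3 k4].
  apply: eO; split; rewrite /ball/= ltr_distlC.
    by rewrite (lt_trans h7 k1) (lt_trans k2 h6).
  by rewrite (lt_trans h3 k3) (lt_trans k4 h2).
apply: countable_bigcupT_measurable => //= q; case: ifP => // _.
by apply: measurableX; exact: measurable_itv.
Qed.

(** Continuity is assumed at the points of [D] only, where the preimage of an open interval can be
    replaced by its interior, an open set. *)
Lemma continuous_at_measurable2 D F : measurable (D : set plane) ->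
  (forall x, D x -> {for x, continuous F}) ->
  measurable_fun (D : set plane) F.
Proof.
move=> mD cF; apply: (measurability _ (measurable_realfun.RGenOpens.measurableE R)).
move=> _ [_ [a [b ->] <-]].
rewrite [X in measurable X](_ : _ = D `&` (F @^-1` `]a, b[)°).
  by apply: measurableI => //; apply: open_measurable2; exact: open_interior.
apply/seteqP; split => x [Dx]; last by move/interior_subset.
move=> Fx; split => //; apply: (cF _ Dx).
by apply: open_nbhs_nbhs; split => //; exact: interval_open.
Qed.

Lemma continuous_at_compact_bounded D F : compact D ->
  (forall x, D x -> {for x, continuous F}) ->
  exists M, 0 < M /\ forall x, D x -> `|F x| <= M.
Proof.
move=> cD cF.
have cF' : {within D, continuous F}.
  by apply: continuous_in_subspaceT => x /set_mem; exact: cF.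
have [M [_ hM]] := compact_bounded (continuous_compact cF' cD).
exists (`|M| + 1); split; first by rewrite ltr_wpDl.
by move=> x Dx; apply: hM; [rewrite ltr_pwDr// ler_norm|exists x].
Qed.

Lemma integrable_rectangle F (a b c d : R) (A B : set (measurableTypeR R)) :
  measurable A -> measurable B -> A `<=` `[a, b] -> B `<=` `[c, d] ->
  (forall x, (`[a, b] `*` `[c, d]) x -> {for x, continuous F}) ->
  area.-integrable (A `*` B) (EFin \o F).
Proof.
move=> mA mB Aab Bcd cF.
have mAB : measurable (A `*` B : set plane) by exact: measurableX.
have sAB : A `*` B `<=` `[a, b] `*` `[c, d].
  by move=> x [Ax Bx]; split; [exact: Aab|exact: Bcd].
have [M [M0 FM]] : exists M, 0 < M /\
    forall x, (`[a, b] `*` `[c, d]) x -> `|F x| <= M.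
  apply: continuous_at_compact_bounded => //.
  by apply: compact_setX; exact: segment_compact.
apply: measurable_bounded_integrable => //.
- rewrite [X in (X < _)%E](_ : _ = (mu A * mu B)%E); last first.
    exact: product_measure1E.
  have fin (C : set R) (u v : R) : measurable C -> C `<=` `[u, v] ->
      (mu C \is a fin_num)%E.
    move=> mC Cuv; rewrite ge0_fin_numE//.
    apply: (@le_lt_trans _ _ (mu `[u, v])).
      by apply: le_measure; rewrite ?inE//; exact: measurable_itv.
    by rewrite lebesgue_measure_itv/=; case: ifP => _; rewrite -?EFinB ltry.
  by rewrite ltey_eq fin_numM// (fin _ _ _ mA Aab, fin _ _ _ mB Bcd).
- by apply: continuous_at_measurable2 => // x /sAB; exact: cF.
- exists M; split; first exact: num_real.
  move=> N MN x /= /sAB /FM h; exact: le_trans (ltW MN).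
Qed.

Lemma integrable_segment (f : R -> R) (a b : R) (A : set (measurableTypeR R)) :
  measurable A -> A `<=` `[a, b] ->
  (forall x, `[a, b]%classic x -> {for x, continuous f}) ->
  mu.-integrable A (EFin \o f).
Proof.
move=> mA Aab cf; apply: (@integrableS _ (measurableTypeR R) R mu `[a, b]%classic A) => //.
apply: continuous_compact_integrable; first exact: segment_compact.
by apply: continuous_in_subspaceT => x /set_mem; exact: cf.
Qed.

(** Extension by zero reduces this to Fubini on the whole plane; the integrability of every slice
    makes the inner integrals finite, so that [fine] commutes with the outer one. *)
Lemma Fubini_rectangle F (A B : set (measurableTypeR R)) :
  measurable A -> measurable B ->
  area.-integrable (A `*` B) (EFin \o F) ->
  (forall x, A x -> mu.-integrable B (EFin \o (fun y => F (x, y)))) ->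
  (forall y, B y -> mu.-integrable A (EFin \o (fun x => F (x, y)))) ->
  (\int[area]_(z in A `*` B) F z =
     \int[mu]_(x in A) (\int[mu]_(y in B) F (x, y))) /\
  (\int[area]_(z in A `*` B) F z =
     \int[mu]_(y in B) (\int[mu]_(x in A) F (x, y))).
Proof.
move=> mA mB iF iB iA.
have mAB : measurable (A `*` B : set plane) by exact: measurableX.
have iF' : area.-integrable setT ((EFin \o F) \_ (A `*` B)).
  by apply/(@integrable_mkcond _ plane R area (A `*` B) (EFin \o F) mAB).
have restrE x y : ((EFin \o F) \_ (A `*` B)) (x, y) =
    if (x \in A) && (y \in B) then (F (x, y))%:E else 0%E.
  by rewrite patchE in_setX.
split; rewrite /Rintegral; congr fine; rewrite integral_mkcond.
- rewrite -(integral12_prod_meas1 iF') [RHS]integral_mkcond.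
  apply: eq_integral => x _; rewrite /fubini_F patchE.
  have [xA|xA] := boolP (x \in A).
    rewrite fineK; last first.
      by apply: integrable_fin_num => //; apply: iB; exact: set_mem.
    rewrite [RHS]integral_mkcond; apply: eq_integral => y _.
    by rewrite restrE patchE xA.
  by apply: integral0_eq => y _; rewrite restrE (negbTE xA).
- rewrite -(integral21_prod_meas1 iF') [RHS]integral_mkcond.
  apply: eq_integral => y _; rewrite /fubini_G patchE.
  have [yB|yB] := boolP (y \in B).
    rewrite fineK; last first.
      by apply: integrable_fin_num => //; apply: iA; exact: set_mem.
    rewrite [RHS]integral_mkcond; apply: eq_integral => x _.
    by rewrite restrE patchE yB andbT.
  by apply: integral0_eq => x _; rewrite restrE (negbTE yB) andbF.
Qed.

End Plane.

(** * Integrals over segments and their dependence on a parameter *)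

Section IntegralOnSegment.
Context {R : realType}.
Local Notation mu := (@lebesgue_measure R).
Implicit Types (f g df : R -> R) (F G : R * R -> R) (a b c d k : R).

Definition int1 a b f : R := \int[mu]_(x in `[a, b]) f x.

(** Continuity is two-sided even at the endpoints: functions are controlled on slightly larger
    intervals, and no one-sided limits occur. *)
Definition cont1 a b f := forall x, a <= x <= b -> {for x, continuous f}.

Lemma int1_integrable a b f : cont1 a b f ->
  mu.-integrable `[a, b] (EFin \o f).
Proof.
by move=> cf; exact: (@integrable_segment _ f a b).
Qed.

Lemma int1_eq a b f g : (forall x, a <= x <= b -> f x = g x) ->
  int1 a b f = int1 a b g.
Proof.
by move=> fg; apply: eq_Rintegral => x; rewrite inE/= in_itv/=; exact: fg.
Qed.

Lemma int1D a b f g : cont1 a b f -> cont1 a b g ->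
  int1 a b (fun x => f x + g x) = int1 a b f + int1 a b g.
Proof. by move=> cf cg; rewrite /int1 RintegralD//; exact: int1_integrable. Qed.

Lemma int1B a b f g : cont1 a b f -> cont1 a b g ->
  int1 a b (fun x => f x - g x) = int1 a b f - int1 a b g.
Proof. by move=> cf cg; rewrite /int1 RintegralB//; exact: int1_integrable. Qed.

Lemma int1Z a b k f : cont1 a b f ->
  int1 a b (fun x => k * f x) = k * int1 a b f.
Proof. by move=> cf; rewrite /int1 RintegralZl//; exact: int1_integrable. Qed.

Lemma int1_le a b f g : cont1 a b f -> cont1 a b g ->
  (forall x, a <= x <= b -> f x <= g x) -> int1 a b f <= int1 a b g.
Proof.
by move=> cf cg fg; apply: le_Rintegral => //; exact: int1_integrable.
Qed.

Lemma int1_ge0 a b f : (forall x, a <= x <= b -> 0 <= f x) -> 0 <= int1 a b f.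
Proof.
by move=> f0; apply: Rintegral_ge0 => x; rewrite /= in_itv/=; exact: f0.
Qed.

Lemma int1_cst a b k : a <= b -> int1 a b (fun=> k) = k * (b - a).
Proof.
move=> ab; rewrite /int1 Rintegral_cst//; congr (_ * _).
suff h : mu `[a, b] = (b - a)%:E by exact: (f_equal fine h).
rewrite lebesgue_measure_itv/= lte_fin.
by case: ltgtP ab => // -> _; rewrite subrr.
Qed.

Lemma int1_FTC a b f df : a <= b -> cont1 a b df ->
  (forall x, a <= x <= b -> is_derive x 1 f (df x)) ->
  int1 a b df = f b - f a.
Proof.
rewrite le_eqVlt => /orP[/eqP <- _ _|ab cdf fdf].
  by rewrite /int1 set_itv1 Rintegral_set1 subrr.
have cf x : a <= x <= b -> {for x, continuous f}.
  by move/fdf/is_derive_continuous.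
rewrite /int1 /Rintegral (@continuous_FTC2 _ df f)//.
- by apply: continuous_in_subspaceT => x /set_mem/=; rewrite in_itv/=; exact: cdf.
- split.
  + move=> x; rewrite in_itv/= => /andP[ax xb].
    by have [] := fdf x ltac:(by rewrite !ltW).
  + by apply: cvg_at_right_filter; apply: cf; rewrite lexx ltW.
  + by apply: cvg_at_left_filter; apply: cf; rewrite lexx ltW.
- move=> x; rewrite in_itv/= => /andP[ax xb].
  by rewrite derive1E; have [_ ->] := fdf x ltac:(by rewrite !ltW).
Qed.

(** The integration starts at a point of []a', a[], so that the primitive has a two-sided derivative
    at [a] and [b] as well. *)
Lemma primitive a b a' b' f : a' < a -> b < b' ->
  (forall x, a' < x < b' -> {for x, continuous f}) ->
  exists P, forall x, a <= x <= b -> is_derive x 1 P (f x).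
Proof.
move=> a'a bb' cf.
have [c /andP[a'c ca]] : exists c, a' < c < a.
  by exists ((a' + a) / 2); rewrite !midf_lt.
have [d /andP[bd db']] : exists d, b < d < b'.
  by exists ((b + b') / 2); rewrite !midf_lt.
exists (fun x => int1 c x f) => x /andP[ax xb].
have xd : x < d := le_lt_trans xb bd.
have fi : mu.-integrable `[c, d] (EFin \o f).
  apply: int1_integrable => y /andP[cy yd]; apply: cf.
  by rewrite (lt_le_trans a'c cy) (le_lt_trans yd db').
have cx : c < x := lt_le_trans ca ax.
have cfx : {for x, continuous f}.
  by apply: cf; rewrite (lt_le_trans a'a ax) (le_lt_trans xb bb').
have [dP P'] := continuous_FTC1_closed xd fi cx cfx.
constructor; first exact: dP.
rewrite -derive1E; exact: P'.
Qed.

Lemma continuous_section1 F x y : {for (x, y), continuous F} ->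
  {for x, continuous (fun t => F (t, y))}.
Proof.
move=> cF; apply: (@continuous_comp _ _ _ (fun t => (t, y)) F) => //.
by apply: (@cvg_pair _ _ _ (nbhs x) (nbhs x) (nbhs y)); [exact: cvg_id|exact: cvg_cst].
Qed.

Lemma continuous_section2 F x y : {for (x, y), continuous F} ->
  {for y, continuous (fun t => F (x, t))}.
Proof.
move=> cF; apply: (@continuous_comp _ _ _ (fun t => (x, t)) F) => //.
by apply: (@cvg_pair _ _ _ (nbhs y) (nbhs x) (nbhs y)); [exact: cvg_cst|exact: cvg_id].
Qed.

Lemma continuous_swap F x y : {for (x, y), continuous F} ->
  {for (y, x), continuous (fun z => F (z.2, z.1))}.
Proof.
move=> cF; apply: (@continuous_comp _ _ _ (fun z => (z.2, z.1)) F) => //.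
by apply: (@cvg_pair _ _ _ (nbhs (y, x)) (nbhs x) (nbhs y)); [exact: cvg_snd|exact: cvg_fst].
Qed.

Lemma bounded_rectangle F a b c d :
  (forall x, a <= x.1 <= b -> c <= x.2 <= d -> {for x, continuous F}) ->
  exists M, 0 < M /\
    forall x y, a <= x <= b -> c <= y <= d -> `|F (x, y)| <= M.
Proof.
move=> cF.
have [|x [/=]|M [M0 FM]] := @continuous_at_compact_bounded _ (`[a, b] `*` `[c, d]) F.
- by apply: compact_setX; exact: segment_compact.
- by rewrite !in_itv/=; exact: cF.
exists M; split => // x y xab ycd; apply: FM.
by split; rewrite /= in_itv/=.
Qed.

Lemma near_segment a b t : a < t < b ->
  exists u v, [/\ a < u, u < t, t < v & v < b].
Proof.
move=> /andP[au tb]; exists ((a + t) / 2), ((t + b) / 2).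
by split; rewrite ?midf_lt.
Qed.

Lemma param_continuous a b c d F :
  (forall x, a < x.1 < b -> c <= x.2 <= d -> {for x, continuous F}) ->
  forall t, a < t < b ->
    {for t, continuous (fun t => int1 c d (fun y => F (t, y)))}.
Proof.
move=> cF t /near_segment[u [v [au ut tv vb]]].
have sub x : u <= x <= v -> a < x < b.
  by case/andP=> ux xv; rewrite (lt_le_trans au ux) (le_lt_trans xv vb).
have sub' x : x \in (`]u, v[%classic : set R) -> u <= x <= v.
  by rewrite inE/= in_itv/= => /andP[? ?]; rewrite !ltW.
have [|M [M0 FM]] := @bounded_rectangle F u v c d.
  by move=> x /sub; exact: cF.
apply: (@continuity_under_integral _ _ _ mu (fun t y => F (t, y)) `[c, d]
   (measurable_itv _) u v _ _ (cst M)).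
- move=> x /mem_set/sub' xuv; apply: int1_integrable => y ycd.
  by apply: continuous_section2; apply: cF => //=; exact: sub.
- apply: aeW => y; rewrite /= in_itv/= => ycd x /sub' xuv.
  by apply: continuous_section1; apply: cF => //=; exact: sub.
- by apply: (@int1_integrable _ _ (cst M)) => x _; exact: cvg_cst.
- move=> x /mem_set/sub' xuv; apply: aeW => y; rewrite /= in_itv/= => ycd.
  exact: FM.
- by rewrite inE/= in_itv/= ut tv.
Qed.

(** On a compact rectangle around [t] the partial derivative is bounded, and the constant bound
    dominates the difference quotients. *)
Lemma param_derive a b c d F F1 :
  (forall x, a < x.1 < b -> c <= x.2 <= d -> {for x, continuous F}) ->
  (forall x, a < x.1 < b -> c <= x.2 <= d -> {for x, continuous F1}) ->
  (forall x y, a < x < b -> c <= y <= d ->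
    is_derive x 1 (fun s => F (s, y)) (F1 (x, y))) ->
  forall t, a < t < b ->
    is_derive t 1 (fun t => int1 c d (fun y => F (t, y)))
      (int1 c d (fun y => F1 (t, y))).
Proof.
move=> cF cF1 FF1 t tab; have [u [v [au ut tv vb]]] := near_segment tab.
have sub x : u <= x <= v -> a < x < b.
  by case/andP=> ux xv; rewrite (lt_le_trans au ux) (le_lt_trans xv vb).
have sub' x : `]u, v[%classic x -> u <= x <= v.
  by rewrite /= in_itv/= => /andP[? ?]; rewrite !ltW.
have [|M [M0 FM]] := @bounded_rectangle F1 u v c d.
  by move=> x /sub; exact: cF1.
have tuv : `]u, v[%classic t by rewrite /= in_itv/= ut tv.
have h1 : forall x, `]u, v[%classic x ->
    mu.-integrable `[c, d] (EFin \o (fun y => F (x, y))).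
  move=> x /sub' xuv; apply: int1_integrable => y ycd.
  by apply: continuous_section2; apply: cF => //=; exact: sub.
have h2 x y : `]u, v[%classic x -> `[c, d]%classic y ->
    is_derive x 1 (fun s => F (s, y)) (F1 (x, y)).
  by move=> /sub' /sub xuv; rewrite /= in_itv/= => ycd; exact: FF1.
have h3 x y : `]u, v[%classic x -> `[c, d]%classic y ->
    `|partial1of2 (fun x y => F (x, y)) x y| <= cst M y.
  move=> xuv ycd; rewrite partial1of2E; have [_ ->] := h2 _ _ xuv ycd.
  apply: FM; first exact: sub'.
  by move: ycd; rewrite /= in_itv.
have h4 x y : `]u, v[%classic x -> `[c, d]%classic y ->
  derivable (fun s => F (s, y)) x 1.
  by move=> xuv ycd; have [] := h2 _ _ xuv ycd.
have iM : mu.-integrable `[c, d] (EFin \o cst M).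
  by apply: (@int1_integrable _ _ (cst M)) => x _; exact: cvg_cst.
have M0' (y : measurableTypeR R) : 0 <= cst M y by exact: ltW.
apply: DeriveDef.
  exact: (@derivable_under_integral _ _ _ mu (fun x y => F (x, y)) `[c, d]
   (measurable_itv _) t u v tuv h1 h4 (cst M) M0' iM h3).
rewrite -derive1E.
rewrite (@differentiation_under_integral _ _ _ mu (fun x y => F (x, y)) `[c, d]
   (measurable_itv _) t u v tuv h1 h4 (cst M) M0' iM h3).
apply: eq_Rintegral => y; rewrite inE/= => ycd.
by rewrite partial1of2E; have [_ ->] := h2 _ _ tuv ycd.
Qed.

Lemma int1_swap a b c d F :
  (forall x, a <= x.1 <= b -> c <= x.2 <= d -> {for x, continuous F}) ->
  int1 a b (fun x => int1 c d (fun y => F (x, y))) =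
  int1 c d (fun y => int1 a b (fun x => F (x, y))).
Proof.
move=> cF.
have [|||x|y|h1 h2] := @Fubini_rectangle _ F `[a, b] `[c, d].
- exact: measurable_itv.
- exact: measurable_itv.
- apply: (@integrable_rectangle _ _ a b c d) => // x [/=].
  by rewrite !in_itv/=; exact: cF.
- rewrite /= in_itv/= => xab; apply: int1_integrable => y ycd.
  by apply: continuous_section2; exact: cF.
- rewrite /= in_itv/= => ycd; apply: int1_integrable => x xab.
  by apply: continuous_section1; exact: cF.
exact: etrans (esym h1) h2.
Qed.

End IntegralOnSegment.

(** * Integrals over the fundamental domain *)

Section FundamentalDomain.
Context {R : realType}.
Local Notation mu := (@lebesgue_measure R).
Local Notation area := (@lebesgue_measure R \x @lebesgue_measure R)%E.
Local Notation plane := (measurableTypeR R * measurableTypeR R)%type.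
Implicit Types (F G : R * R -> R) (a b l : R).

Lemma measurable_fdom l : measurable (fdom l : set plane).
Proof. by apply: measurableX; exact: measurable_itv. Qed.

Lemma integrable_box F a b :
  (forall x, a <= x.1 <= b -> {for x, continuous F}) ->
  area.-integrable (`[a, b] `*` `[0, 2 * pi[) (EFin \o F).
Proof.
move=> cF; apply: (@integrable_rectangle _ _ a b 0 (2 * pi)) => //.
- by apply: subset_itvl; rewrite bnd_simp.
- by move=> x [/=]; rewrite in_itv/= => xab _; exact: cF.
Qed.

Lemma integral_box F a b :
  (forall x, a <= x.1 <= b -> {for x, continuous F}) ->
  \int[area]_(x in `[a, b] `*` `[0, 2 * pi[) F x =
  int1 a b (fun t => int1 0 (2 * pi) (fun y => F (t, y))).
Proof.
move=> cF.
have [|||x|y|h1 _] := @Fubini_rectangle _ F `[a, b] `[0, 2 * pi[.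
- exact: measurable_itv.
- exact: measurable_itv.
- exact: integrable_box.
- rewrite /= in_itv/= => xab; apply: (@integrable_segment _ _ 0 (2 * pi)) => //.
    by apply: subset_itvl; rewrite bnd_simp.
  by move=> y _; apply: continuous_section2; exact: cF.
- move=> _; apply: int1_integrable => x xab.
  by apply: continuous_section1; exact: cF.
apply: (etrans h1).
apply: eq_Rintegral => x; rewrite inE/= in_itv/= => xab.
rewrite /int1 -Rintegral_itv_bndo_bndc//.
apply: (@integrable_segment _ _ 0 (2 * pi)) => //.
  by apply: subset_itvl; rewrite bnd_simp.
by move=> y _; apply: continuous_section2; exact: cF.
Qed.

Lemma subset_box_fdom a b l : 0 < a -> b < l ->
  `[a, b] `*` `[0, 2 * pi[ `<=` fdom l.
Proof.
move=> a0 bl x [/=]; rewrite !in_itv/= => /andP[ax xb] hx.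
by split; rewrite /= in_itv//= (lt_le_trans a0 ax) (le_lt_trans xb bl).
Qed.

Lemma integral_fdom_box F a b l : 0 < a -> b < l ->
  (forall x, 0 < x.1 < l -> F x != 0 -> a <= x.1 <= b) ->
  \int[area]_(x in fdom l) F x = \int[area]_(x in `[a, b] `*` `[0, 2 * pi[) F x.
Proof.
move=> a0 bl F0; rewrite [LHS]Rintegral_mkcond [RHS]Rintegral_mkcond.
congr (fine (integral _ _ _)); apply/funext => x; congr EFin; rewrite !patchE.
case: ifPn; case: ifPn => //.
- move=> nx; rewrite inE => -[/= h1 h2]; move: h1; rewrite in_itv/= => h1.
  apply/eqP; apply: contraNT nx => Fx.
  by rewrite inE; split => //=; rewrite in_itv/=; exact: F0.
- by move=> /set_mem/(subset_box_fdom a0 bl) h; rewrite notin_setE.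
Qed.

Lemma integrable_fdom_box F a b l : 0 < a -> b < l ->
  (forall x, 0 < x.1 < l -> F x != 0 -> a <= x.1 <= b) ->
  area.-integrable (`[a, b] `*` `[0, 2 * pi[) (EFin \o F) ->
  area.-integrable (fdom l) (EFin \o F).
Proof.
move=> a0 bl F0 iF.
have mbox : measurable (`[a, b] `*` `[0, 2 * pi[ : set plane).
  by apply: measurableX; exact: measurable_itv.
apply/(@integrable_mkcond _ plane R area _ _ (measurable_fdom l)).
move/(@integrable_mkcond _ plane R area _ _ mbox) : iF.
congr (integrable _ _ _); apply/funext => x; rewrite !patchE.
case: ifPn; case: ifPn => //.
- by rewrite notin_setE => h /set_mem/(subset_box_fdom a0 bl).
- rewrite inE => -[/= h1 h2] nx; move: h1; rewrite in_itv/= => h1.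
  congr EFin; apply/esym/eqP; apply: contraNT nx => Fx.
  by rewrite inE; split => //=; rewrite in_itv/=; exact: F0.
Qed.

End FundamentalDomain.

(** * The energy inequality for regular densities *)

Section Continuity.
Context {R : realType} {T : topologicalType}.
Implicit Types (f g : T -> R) (x : T).

Lemma continuous_atD f g x : {for x, continuous f} -> {for x, continuous g} ->
  {for x, continuous (fun y => f y + g y)}.
Proof. exact: cvgD. Qed.

Lemma continuous_atB f g x : {for x, continuous f} -> {for x, continuous g} ->
  {for x, continuous (fun y => f y - g y)}.
Proof. exact: cvgB. Qed.

Lemma continuous_atN f x : {for x, continuous f} ->
  {for x, continuous (fun y => - f y)}.
Proof. exact: cvgN. Qed.

Lemma continuous_atM f g x : {for x, continuous f} -> {for x, continuous g} ->
  {for x, continuous (fun y => f y * g y)}.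
Proof. exact: cvgM. Qed.

Lemma continuous_atX f n x : {for x, continuous f} ->
  {for x, continuous (fun y => f y ^+ n)}.
Proof.
move=> cf; elim: n => [|n ih]; first exact: cvg_cst.
rewrite (_ : (fun y => _) = (fun y => f y * f y ^+ n)).
  exact: continuous_atM.
by apply/funext => y; rewrite exprS.
Qed.

Lemma continuous_at_norm f x : {for x, continuous f} ->
  {for x, continuous (fun y => `|f y|)}.
Proof. exact: cvg_norm. Qed.

Lemma continuous_atV f x : f x != 0 -> {for x, continuous f} ->
  {for x, continuous (fun y => (f y)^-1)}.
Proof. by move=> fx0; exact: cvgV. Qed.

Lemma continuous_at_cst (k : R) x : {for x, continuous (fun=> k)}.
Proof. exact: cvg_cst. Qed.

Lemma continuous_at_comp f (g : R -> R) x : {for x, continuous f} ->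
  {for f x, continuous g} -> {for x, continuous (fun y => g (f y))}.
Proof. by move=> cf cg; exact: (@continuous_comp _ _ _ f g). Qed.

Lemma continuous_at_expR f x : {for x, continuous f} ->
  {for x, continuous (fun y => expR (f y))}.
Proof. by move=> cf; apply: continuous_at_comp => //; exact: continuous_expR. Qed.

End Continuity.

Ltac continuity_step :=
  match goal with
  | |- {for _, continuous (fun _ => ?c)} => exact: continuous_at_cst
  | |- {for _, continuous (fun t => @?f t - @?g t)} =>
      apply: (@continuous_atB _ _ f g)
  | |- {for _, continuous (fun t => @?f t + @?g t)} =>
      apply: (@continuous_atD _ _ f g)
  | |- {for _, continuous (fun t => - @?f t)} => apply: (@continuous_atN _ _ f)
  | |- {for _, continuous (fun t => @?f t * @?g t)} =>
      apply: (@continuous_atM _ _ f g)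
  | |- {for _, continuous (fun t => @?f t ^+ ?n)} =>
      apply: (@continuous_atX _ _ f n)
  | |- {for _, continuous (fun t => (@?f t)^-1)} =>
      apply: (@continuous_atV _ _ f)
  | |- {for _, continuous (fun t => `|@?f t|)} =>
      apply: (@continuous_at_norm _ _ f)
  | |- {for _, continuous (fun t => expR (@?f t))} =>
      apply: (@continuous_at_expR _ _ f)
  end.

Ltac continuity := repeat continuity_step.

(** * Averaging over circles *)

Section Circle.
Context {R : realType}.
Implicit Types (w dw : R -> R).

(** The Sobolev embedding in dimension one: any two values of [w] differ by at most the integral of
    its absolute derivative, and [w y - w z] is averaged over [z]. *)
Lemma circle_sup_le (L : R) w dw : 0 <= L ->
  (forall y : R, is_derive y 1 w (dw y)) ->
  (forall y, {for y, continuous dw}) ->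
  forall y, 0 <= y <= L ->
  L * w y <= int1 0 L w + L * int1 0 L (fun y => `|dw y|).
Proof.
move=> L0 wdw cdw y /andP[y0 yL].
have cw z : {for z, continuous w} by exact: is_derive_continuous (wdw z).
have cn z : {for z, continuous (fun y => `|dw y|)} by exact: continuous_at_norm.
have [P Pd] := @primitive _ 0 L (-1) (L + 1) (fun y => `|dw y|)
  ltac:(by rewrite ltrN10) ltac:(by rewrite ltrDl) (fun x _ => cn x).
have TE : int1 0 L (fun y => `|dw y|) = P L - P 0 by apply: int1_FTC.
have Pmono x z : 0 <= x -> x <= z -> z <= L -> P x <= P z.
  move=> x0 xz zL; apply: (@derive_ge0_le _ P (fun y => `|dw y|)) => // t /andP[xt tz].
  by apply: Pd; rewrite (le_trans x0 xt) (le_trans tz zL).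
have key z : 0 <= z <= L -> w y - (P L - P 0) <= w z.
  move=> /andP[z0 zL].
  have [zy|yz] := leP z y.
  - have : P z - w z <= P y - w y.
      apply: (@derive_ge0_le _ (fun t => P t - w t) (fun t => `|dw t| - dw t)) => // t /andP[zt ty].
        have ? := wdw t; have ? := Pd t ltac:(by rewrite (le_trans z0 zt) (le_trans ty yL)).
        by derivation.
      by rewrite subr_ge0 ler_norm.
    have := Pmono 0 z (lexx _) z0 zL.
    have := Pmono y L y0 yL (lexx _).
    by clear; lra.
  - have : P y + w y <= P z + w z.
      apply: (@derive_ge0_le _ (fun t => P t + w t) (fun t => `|dw t| + dw t)) => // [|t /andP[yt tz]|t _].
      + exact: ltW.
      + have ? := wdw t; have ? := Pd t ltac:(by rewrite (le_trans y0 yt) (le_trans tz zL)).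
        by derivation.
      + by rewrite -lerBlDr sub0r -normrN ler_norm.
    have := Pmono 0 y (lexx _) y0 yL.
    have := Pmono z L z0 zL (lexx _).
    by clear; lra.
have : int1 0 L (fun=> w y - (P L - P 0)) <= int1 0 L w.
  by apply: int1_le => // x _; exact: continuous_at_cst.
by rewrite int1_cst// TE; clear; lra.
Qed.

End Circle.

Section Cylinder.
Context {R : realType}.
Implicit Types (W Wt Wtt Wy Wyy X phi phit phiy : R * R -> R) (a b m e : R).

Definition cont2 a b W := forall x, a < x.1 < b -> {for x, continuous W}.

Definition derive_t a b W Wt := forall x : R * R, a < x.1 < b ->
  is_derive x.1 1 (fun s => W (s, x.2)) (Wt x).

Definition derive_y a b W Wy := forall x : R * R, a < x.1 < b ->
  is_derive x.2 1 (fun s => W (x.1, s)) (Wy x).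

(** The derivatives are separate functions given on an open strip, since the densities to come are
    piecewise defined and come with explicit formulas for them. *)
Definition C2_data a b W Wt Wtt Wy Wyy :=
  [/\ cont2 a b Wt, cont2 a b Wtt, cont2 a b Wy & cont2 a b Wyy] /\
  [/\ cont2 a b W, derive_t a b W Wt, derive_t a b Wt Wtt, derive_y a b W Wy &
      derive_y a b Wy Wyy].

Variable L : R.
Hypothesis L_gt0 : 0 < L.

Definition circle W (t : R) := int1 0 L (fun y => W (t, y)).

Lemma cont2_circle a b W : cont2 a b W ->
  forall t, a < t < b -> {for t, continuous (circle W)}.
Proof. by move=> cW; apply: param_continuous => x xab _; exact: cW. Qed.

Lemma cont2_section a b W t : cont2 a b W -> a < t < b ->
  forall y, {for y, continuous (fun y => W (t, y))}.
Proof. by move=> cW tab y; apply: continuous_section2; exact: cW. Qed.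

Lemma cont2_section1 a b W t y : cont2 a b W -> a < t < b ->
  {for t, continuous (fun t => W (t, y))}.
Proof. by move=> cW tab; apply: continuous_section1; exact: cW. Qed.

Lemma circle_derive a b W Wt : cont2 a b W -> cont2 a b Wt ->
  derive_t a b W Wt ->
  forall t, a < t < b -> is_derive t 1 (circle W) (circle Wt t).
Proof.
move=> cW cWt dW t tab.
apply: (@param_derive _ a b 0 L W Wt) => //.
- by move=> x xab _; exact: cW.
- by move=> x xab _; exact: cWt.
- by move=> x y xab _; exact: (dW (x, y)).
Qed.

(* With [rho] the circle integral of [W] and [T] that of [|W_y|], the pointwise
   bounds [W <= rho / L + T] and [rho |W_y| <= W_y^2 / W + rho^2 W / 4] make
   [T] cancel: the tangential gradient pays for the defect of [W] from its
   mean. *)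
Lemma circle_laplacian_ge a b W Wt Wtt Wy Wyy X t e : a < t < b ->
  C2_data a b W Wt Wtt Wy Wyy ->
  (forall x, a < x.1 < b -> 0 < W x) -> Wy (t, L) = Wy (t, 0) ->
  cont2 a b X ->
  (forall y, 0 <= y <= L -> - W (t, y) ^+ 2 * (W (t, y) + X (t, y)) <=
    W (t, y) * (Wtt (t, y) + Wyy (t, y)) - Wt (t, y) ^+ 2 - Wy (t, y) ^+ 2) ->
  circle (fun x => W x * X x) t <= e * circle W t ->
  let r := circle W t in
  circle Wt t ^+ 2 / r - r ^+ 2 / L - r ^+ 3 / 4 - e * r <=
  circle Wtt t.
Proof.
move=> tab [[cWt cWtt cWy cWyy] [cW dWt dWtt dWy dWyy]] W0 Wyper cX HW HX /=.
set r := circle W t.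
have cW' := cont2_section cW tab.
have cWt' := cont2_section cWt tab.
have cWtt' := cont2_section cWtt tab.
have cWy' := cont2_section cWy tab.
have cWyy' := cont2_section cWyy tab.
have cX' := cont2_section cX tab.
have r0 : 0 < r.
  have [z _ zmin] := @EVT_min R (fun y => W (t, y)) 0 L (ltW L_gt0)
    (continuous_in_subspaceT (fun x _ => cW' x)).
  have Wz : 0 < W (t, z) by exact: W0.
  apply: (@lt_le_trans _ _ (int1 0 L (fun=> W (t, z)))).
    by rewrite int1_cst ?(ltW L_gt0)// subr0 mulr_gt0.
  apply: int1_le => [x _|x _|x x0]; [exact: continuous_at_cst|exact: cW'|].
  by apply: zmin; rewrite in_itv.
have dWy0 (y : R) : is_derive y 1 (fun s => W (t, s)) (Wy (t, y)).
  exact: (dWy (t, y)).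
pose T := int1 0 L (fun y => `|Wy (t, y)|).
have Wsup y : 0 <= y <= L -> W (t, y) <= r / L + T.
  move=> y0; have := circle_sup_le (ltW L_gt0) dWy0 cWy' y0.
  move=> h; rewrite -(ler_pM2l L_gt0) mulrDr; apply: (le_trans h).
  by rewrite [leRHS](_ : _ = r + L * T)// mulrCA divff ?mulr1// lt0r_neq0.
have Wyy0 : circle Wyy t = 0.
  apply: (etrans (@int1_FTC _ 0 L (fun y => Wy (t, y)) (fun y => Wyy (t, y))
    (ltW L_gt0) (fun y _ => cWyy' y) (fun y _ => dWyy (t, y) tab))).
  by rewrite Wyper subrr.
(* [k] is the logarithmic derivative of the circle integral, the best choice in
   [Wt ^ 2 / W >= 2 k Wt - k ^ 2 W]. [A] collects all coefficients of [- W]; on integrating [G] the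
   term [r T] appears with both signs. *)
pose k := circle Wt t / r.
pose A := r ^+ 2 / 4 + r / L + T + k ^+ 2.
pose G y := (2 * k) * Wt (t, y) + (r * `|Wy (t, y)| - (A * W (t, y) + W (t, y) * X (t, y))).
have Gle : int1 0 L G <= int1 0 L (fun y => Wtt (t, y) + Wyy (t, y)).
  apply: int1_le.
  - by move=> y _; rewrite /G; continuity.
  - by move=> y _; continuity.
  move=> y y0; have Wy0 : 0 < W (t, y) by exact: W0.
  rewrite -(ler_pM2l Wy0) /G.
  have h1 := HW y y0.
  have h2 : 0 <= (Wt (t, y) - k * W (t, y)) ^+ 2 by exact: sqr_ge0.
  have h3 : 0 <= (`|Wy (t, y)| - r / 2 * W (t, y)) ^+ 2 by exact: sqr_ge0.
  have h4 : W (t, y) ^+ 2 * W (t, y) <= W (t, y) ^+ 2 * (r / L + T).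
    by rewrite ler_wpM2l ?sqr_ge0// Wsup.
  have h5 : `|Wy (t, y)| ^+ 2 = Wy (t, y) ^+ 2 by rewrite real_normK// num_real.
  move: h1 h2 h3 h4 h5; rewrite /A.
  set B := r / L; clearbody k T B; clearbody r.
  move: (W (t, y)) (Wt (t, y)) (Wtt (t, y)) (Wy (t, y)) (Wyy (t, y)) (X (t, y)) => w wt wtt wy wyy x.
  by move: `|wy| => n; clear; nra.
have GE : int1 0 L G = 2 * k * circle Wt t + (r * T - (A * r + circle (fun x => W x * X x) t)).
  rewrite /G int1D; [|by move=> y _; continuity..].
  rewrite int1Z; last by move=> y _; continuity.
  rewrite int1B; [|by move=> y _; continuity..].
  rewrite int1Z; last by move=> y _; continuity.
  rewrite int1D; [|by move=> y _; continuity..].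
  by rewrite int1Z//; move=> y _; continuity.
have RE : int1 0 L (fun y => Wtt (t, y) + Wyy (t, y)) = circle Wtt t.
  by rewrite int1D// -[X in _ + X]/(circle Wyy t) Wyy0 addr0.
move: Gle; rewrite GE RE; apply: le_trans.
have -> : circle Wt t ^+ 2 / r = 2 * k * circle Wt t - k ^+ 2 * r.
  by rewrite /k; field; rewrite lt0r_neq0.
rewrite /A; move: HX; rewrite -/r.
set B := r / L.
have -> : r ^+ 2 / L = r * B by rewrite /B; ring.
move: (circle (fun x => W x * X x) t) (circle Wt t) => v1 v2.
by clear; lra.
Qed.

(** The hypothesis on [W] says that the Laplacian of [ln W] is at least [- (W + X)]. Here [u] is the
    logarithm of the mean [circle L W t / L]; expressed through the mean, the error [r ^ 2 / 4] of
    the circle integral [r] has coefficient [L ^ 2 / 4]. *)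
Lemma density_liouville1 a b a' b' W Wt Wtt Wy Wyy X e :
  a' < a -> a <= b -> b < b' ->
  C2_data a' b' W Wt Wtt Wy Wyy ->
  (forall x, a' < x.1 < b' -> 0 < W x) ->
  (forall t, a <= t <= b -> Wy (t, L) = Wy (t, 0)) ->
  cont2 a' b' X ->
  (forall x, a <= x.1 <= b -> 0 <= x.2 <= L -> - W x ^+ 2 * (W x + X x) <=
    W x * (Wtt x + Wyy x) - Wt x ^+ 2 - Wy x ^+ 2) ->
  (forall t, a <= t <= b ->
     circle (fun x => W x * X x) t <= e * circle W t) ->
  exists u du d2u P Q, liouville1 a b (L ^+ 2 / 4) e u du d2u P Q /\
    forall t, a' < t < b' -> expR (u t) = circle W t / L.
Proof.
move=> a'a ab bb' DW W0 Wyper cX HW HX.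
have [[cWt cWtt cWy cWyy] [cW dWt dWtt dWy dWyy]] := DW.
have sub t : a <= t <= b -> a' < t < b'.
  by move=> /andP[at1 tb]; rewrite (lt_le_trans a'a at1) (le_lt_trans tb bb').
have r0 t : a' < t < b' -> 0 < circle W t.
  move=> tab; have cW' := cont2_section cW tab.
  have [z _ zmin] := @EVT_min R (fun y => W (t, y)) 0 L (ltW L_gt0)
    (continuous_in_subspaceT (fun x _ => cW' x)).
  have Wz : 0 < W (t, z) by exact: W0.
  apply: (@lt_le_trans _ _ (int1 0 L (fun=> W (t, z)))).
    by rewrite int1_cst ?(ltW L_gt0)// subr0 mulr_gt0.
  apply: int1_le => [x _|x _|x x0]; [exact: continuous_at_cst|exact: cW'|].
  by apply: zmin; rewrite in_itv.
pose u t := ln (circle W t / L).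
have uE t : a' < t < b' -> expR (u t) = circle W t / L.
  by move=> /r0 h; rewrite /u lnK// posrE divr_gt0.
have cr t : a' < t < b' -> {for t, continuous (fun t => circle W t / L)}.
  move=> tab; apply: continuous_atM; last exact: continuous_at_cst.
  exact: (cont2_circle cW).
have [P Pd] := primitive a'a bb' cr.
have [Q Qd] := primitive a'a bb' (fun x xab => @continuous_atX _ _ _ 2 x (cr x xab)).
exists u, (fun t => circle Wt t / circle W t),
  (fun t => circle Wtt t / circle W t - (circle Wt t / circle W t) ^+ 2), P, Q.
split => // t tab; have tab' := sub _ tab; have rt := r0 _ tab'.
have d1 := circle_derive cW cWt dWt tab'.
have d2 := circle_derive cWt cWtt dWtt tab'.
have rn : circle W t != 0 by exact: lt0r_neq0.
have rp : 0 < circle W t * L^-1 by rewrite divr_gt0.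
have pin : L != 0 by rewrite lt0r_neq0.
split.
- by rewrite /u; derivation => //; field; rewrite rn pin.
- by derivation => //; field.
- by rewrite uE//; exact: Pd.
- by rewrite uE//; exact: Qd.
rewrite uE//.
have := @circle_laplacian_ge a' b' W Wt Wtt Wy Wyy X t e tab' DW W0 (Wyper _ tab) cX
  (fun y => HW (t, y) tab) (HX _ tab).
have ri : 0 <= (circle W t)^-1 by rewrite invr_ge0 ltW.
move=> /= /(ler_wpM2r ri) h.
have -> : - (circle W t / L) - L ^+ 2 / 4 * (circle W t / L) ^+ 2 - e =
   (circle Wt t ^+ 2 / circle W t - circle W t ^+ 2 / L - circle W t ^+ 3 / 4 - e * circle W t) / circle W t - (circle Wt t / circle W t) ^+ 2.
  by field; rewrite rn pin.
by rewrite lerD2r.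
Qed.

End Cylinder.

Section CylinderEnergy.
Context {R : realType}.
Implicit Types (W Wt Wtt Wy Wyy X phi phit phiy : R * R -> R) (a b m e : R).

(** The integral of [W phi ^ 2] is at most the mass of the circle times the supremum of [phi ^ 2].
    The oscillation part [2 |phi phiy|] of that supremum is split by the arithmetic-geometric
    inequality with the small parameter [m] on [phiy ^ 2]. *)
Lemma circle_weighted_square_le (L : R) a b W phi phiy t m : 0 < L -> 0 < m ->
  a < t < b ->
  cont2 a b W -> cont2 a b phi -> cont2 a b phiy -> derive_y a b phi phiy ->
  (forall y, 0 <= W (t, y)) ->
  let r := circle L W t in
  circle L (fun x => W x * phi x ^+ 2) t <=
  r / L * circle L (fun x => phi x ^+ 2) t
  + r ^+ 2 / m * circle L (fun x => phi x ^+ 2) t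
  + m * circle L (fun x => phiy x ^+ 2) t.
Proof.
move=> L0 m0 tab cW cphi cphiy dphi W0 /=.
have cW' := cont2_section cW tab.
have cphi' := cont2_section cphi tab.
have cphiy' := cont2_section cphiy tab.
have dphi' (y : R) : is_derive y 1 (fun s => phi (t, s)) (phiy (t, y)).
  exact: (dphi (t, y)).
have c2 (y : R) : {for y, continuous (fun s => 2 * (phi (t, s) * phiy (t, s)))}.
  by continuity.
have d2 (y : R) : is_derive y 1 (fun s => phi (t, s) ^+ 2) (2 * (phi (t, y) * phiy (t, y))).
  by have ? := dphi' y; derivation; ring.
set r := circle L W t.
have r0 : 0 <= r by apply: int1_ge0.
pose S := int1 0 L (fun y => phi (t, y) ^+ 2).
pose T := int1 0 L (fun y => `|2 * (phi (t, y) * phiy (t, y))|).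
have sup y : 0 <= y <= L -> phi (t, y) ^+ 2 <= S / L + T.
  move=> y0; have h := circle_sup_le (ltW L0) d2 c2 y0.
  have SE : L * (S / L) = S by field; rewrite lt0r_neq0.
  by rewrite -(ler_pM2l L0) mulrDr SE; exact: h.
apply: (@le_trans _ _ (r * (S / L + T))).
  rewrite mulrC /r /circle -int1Z//; apply: int1_le => y y0.
  - by continuity.
  - by continuity.
  by rewrite mulrC ler_wpM2r// sup.
have rT : r * T <= r ^+ 2 / m * S + m * int1 0 L (fun y => phiy (t, y) ^+ 2).
  rewrite /T /S -!int1Z; try by move=> y y0; continuity.
  rewrite -int1D; try by move=> y y0; continuity.
  apply: int1_le => y y0; try by continuity.
  have h : 0 <= (r / m * `|phi (t, y)| - `|phiy (t, y)|) ^+ 2 by exact: sqr_ge0.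
  have h5 : `|phi (t, y)| ^+ 2 = phi (t, y) ^+ 2 by rewrite real_normK// num_real.
  have h6 : `|phiy (t, y)| ^+ 2 = phiy (t, y) ^+ 2 by rewrite real_normK// num_real.
  rewrite !normrM (ger0_norm (ler0n R 2)) -h5 -h6 -subr_ge0.
  rewrite (_ : _ - _ = m * (r / m * `|phi (t, y)| - `|phiy (t, y)|) ^+ 2).
    by rewrite mulr_ge0// ltW.
  by field; rewrite lt0r_neq0.
have -> : r * (S / L + T) = r / L * S + r * T by ring.
by rewrite -addrA lerD2l.
Qed.

(** Once the weight has been replaced on each circle by a function of [t], the one-dimensional
    inequality is applied along every line of constant [y] and integrated over [y]. The factor of
    [phiy ^ 2] is only [m], so the constant is decided by the [t] direction. *)
Lemma cylinder_energy (L : R) a b a' b' W Wt Wtt Wy Wyy X e m d phi phit phiy :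
  0 < L -> a' < a -> b < b' ->
  C2_data a' b' W Wt Wtt Wy Wyy ->
  (forall x, a' < x.1 < b' -> 0 < W x) ->
  (forall t, a <= t <= b -> Wy (t, L) = Wy (t, 0)) ->
  cont2 a' b' X ->
  (forall x, a <= x.1 <= b -> 0 <= x.2 <= L -> - W x ^+ 2 * (W x + X x) <=
    W x * (Wtt x + Wyy x) - Wt x ^+ 2 - Wy x ^+ 2) ->
  (forall t, a <= t <= b ->
     circle L (fun x => W x * X x) t <= e * circle L W t) ->
  0 < m -> L ^+ 2 / 4 * m ^+ 2 <= 1 -> m <= 1 ->
  0 <= e -> e * (b - a) <= m / 2 -> e * (b - a) ^+ 3 <= 1 ->
  0 < d -> d <= 1 -> 2 <= b - a -> m * (b - a) <= 8 - 4 * d ->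
  int1 a b (circle L W) <= L * m ->
  [/\ cont2 a' b' phi, cont2 a' b' phit, cont2 a' b' phiy,
      derive_t a' b' phi phit & derive_y a' b' phi phiy] ->
  (forall y, phi (a, y) = 0) -> (forall y, phi (b, y) = 0) ->
  int1 a b (circle L (fun x => W x * phi x ^+ 2)) <=
  (1 + ((36 * 64 * (L ^+ 2 / 4) + 1) / d + 18 * L ^+ 2) * m)
    * int1 a b (circle L (fun x => phit x ^+ 2))
  + m * int1 a b (circle L (fun x => phiy x ^+ 2)).
Proof.
move=> L0 a'a bb' DW W0 Wyper cX HW HX m0 km m1 e0 em e3 d0 d1 ba m8 mass.
move=> [cphi cphit cphiy dphit dphiy] phia phib.
have ab : a <= b by clear -ba; lra.
have [u [du [d2u [P [Q [H uE]]]]]] := density_liouville1 L0 a'a ab bb' DW W0 Wyper cX HW HX.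
have [_ [cW _ _ _ _]] := DW.
have sub t : a <= t <= b -> a' < t < b'.
  by move=> /andP[at1 tb]; rewrite (lt_le_trans a'a at1) (le_lt_trans tb bb').
have crho := cont2_circle cW.
set k := L ^+ 2 / 4 in H km *.
have k0 : 0 <= k by rewrite /k divr_ge0// sqr_ge0.
have m0' := ltW m0.
have cu t : a' < t < b' -> {for t, continuous (fun t => circle L W t / L)}.
  by move=> tab; apply: continuous_atM; [exact: crho|exact: continuous_at_cst].
have PE : int1 a b (fun t => circle L W t / L) = P b - P a.
  apply: int1_FTC => // t tab; first by apply: cu; exact: sub.
  by rewrite -uE ?sub//; have [] := H _ tab.
have Pm : P b - P a <= m.
  rewrite -PE -(ler_pM2l L0); apply: le_trans mass.
  rewrite -int1Z; last by move=> t tab; apply: cu; exact: sub.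
  rewrite le_eqVlt; apply/orP; left; apply/eqP/int1_eq => t _.
  by rewrite mulrCA divff ?mulr1// lt0r_neq0.
have m8' : m * (b - a) <= 8 by clear -m8 d0; lra.
(* The weight of [phi ^ 2] after the reduction on circles: the mean density, treated by
   [interval_energy], and a quadratic remainder. *)
pose rho2 t := circle L W t / L + circle L W t ^+ 2 / m.
pose G x := rho2 x.1 * phi x ^+ 2 + m * phiy x ^+ 2.
have cfst (x : R * R) (f : R -> R) : {for x.1, continuous f} ->
    {for x, continuous (fun x : R * R => f x.1)}.
  move=> cf; apply: (@continuous_comp _ _ _ fst f) => //; exact: cvg_fst.
have crho2 t : a' < t < b' -> {for t, continuous rho2}.
  by move=> tab; rewrite /rho2; continuity; exact: crho.
have cG : cont2 a' b' G.
  move=> x xab; rewrite /G; continuity; [|exact: cphi|exact: cphiy].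
  by apply: cfst; exact: crho2.
have cWp : cont2 a' b' (fun x => W x * phi x ^+ 2).
  by move=> x xab; continuity; [exact: cW|exact: cphi].
have ct2 : cont2 a' b' (fun x => phit x ^+ 2).
  by move=> x xab; continuity; exact: cphit.
have cy2 : cont2 a' b' (fun x => phiy x ^+ 2).
  by move=> x xab; continuity; exact: cphiy.
have c2 : cont2 a' b' (fun x => phi x ^+ 2).
  by move=> x xab; continuity; exact: cphi.
have cc F : cont2 a' b' F -> cont1 a b (circle L F).
  by move=> cF t tab; apply: (cont2_circle cF); exact: sub.
have swap F : cont2 a' b' F -> int1 a b (circle L F) =
    int1 0 L (fun y => int1 a b (fun t => F (t, y))).
  by move=> cF; apply: int1_swap => x /sub xab _; exact: cF.
have cswap F : cont2 a' b' F ->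
    forall y, {for y, continuous (fun y => int1 a b (fun t => F (t, y)))}.
  move=> cF y.
  apply: (@param_continuous _ (y - 1) (y + 1) a b (fun z => F (z.2, z.1))).
    by move=> [z1 z2] _ /= /sub zab; apply: continuous_swap; exact: cF.
  by rewrite ltrBlDr ltrDl ltr01.
apply: (@le_trans _ _ (int1 a b (circle L G))).
  apply: int1_le => [||t tab]; [exact: cc|exact: cc|].
  have tab' := sub _ tab.
  apply: (le_trans (circle_weighted_square_le L0 m0 tab' cW cphi cphiy dphiy _)).
    by move=> y; apply: ltW; exact: W0.
  rewrite /circle /G /= int1D; last 2 first.
  - by move=> y _; continuity; exact: (cont2_section cphi tab').
  - by move=> y _; continuity; exact: (cont2_section cphiy tab').
  rewrite !int1Z.
  - by rewrite -mulrDl.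
  - by move=> y _; exact: (cont2_section cy2 tab').
  - by move=> y _; exact: (cont2_section c2 tab').
rewrite !swap//.
set C := 1 + _ * m.
rewrite -[X in _ <= X + _]int1Z; last by move=> y _; exact: (cswap _ ct2).
rewrite -[X in _ <= _ + X]int1Z; last by move=> y _; exact: (cswap _ cy2).
rewrite -int1D; last 2 first.
- by move=> y _; continuity; exact: (cswap _ ct2).
- by move=> y _; continuity; exact: (cswap _ cy2).
apply: int1_le.
- by move=> y _; exact: (cswap _ cG).
- by move=> y _; continuity; [exact: (cswap _ ct2)|exact: (cswap _ cy2)].
move=> y y0.
have cphi1 t : a' < t < b' -> {for t, continuous (fun t => phi (t, y))}.
  exact: cont2_section1 cphi.
have cphit1 t : a' < t < b' -> {for t, continuous (fun t => phit (t, y))}.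
  exact: cont2_section1 cphit.
have cphiy1 t : a' < t < b' -> {for t, continuous (fun t => phiy (t, y))}.
  exact: cont2_section1 cphiy.
have [D Dd] := @primitive _ a b a' b' (fun t => phit (t, y) ^+ 2) a'a bb'
  (fun t tab => @continuous_atX _ _ _ 2 t (cphit1 t tab)).
have cA t : a' < t < b' ->
    {for t, continuous (fun t => circle L W t / L * phi (t, y) ^+ 2)}.
  by move=> tab; continuity; [exact: crho|exact: cphi1].
have [A Ad] := @primitive _ a b a' b' _ a'a bb' cA.
have DE : int1 a b (fun t => phit (t, y) ^+ 2) = D b - D a.
  by apply: int1_FTC => // t /sub tab; continuity; exact: cphit1.
have AE : int1 a b (fun t => circle L W t / L * phi (t, y) ^+ 2) = A b - A a.
  by apply: int1_FTC => // t /sub tab; exact: cA.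
have Ad' t : a <= t <= b -> is_derive t 1 A (expR (u t) * phi (t, y) ^+ 2).
  by move=> tab; rewrite uE ?sub//; exact: Ad.
have phid t : a <= t <= b -> is_derive t 1 (fun t => phi (t, y)) (phit (t, y)).
  by move=> /sub tab; exact: (dphit (t, y)).
have hA := interval_energy H k0 m0' km e0 em e3 d0 d1 ba m1 m8 Pm phid (phia y) (phib y) Dd Ad'.
have D0 : 0 <= D b - D a by rewrite -DE; apply: int1_ge0 => t _; exact: sqr_ge0.
have Dle s t : a <= s -> s <= t -> t <= b -> D t - D s <= D b - D a.
  move=> as1 st tb.
  have Dm x z : a <= x -> x <= z -> z <= b -> D x <= D z.
    move=> ax xz zb; apply: (@derive_ge0_le _ D (fun t => phit (t, y) ^+ 2)) => // v.
      by move=> /andP[xv vz]; apply: Dd; rewrite (le_trans ax xv) (le_trans vz zb).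
    by move=> _; exact: sqr_ge0.
  by rewrite lerB// Dm// (le_trans _ st, le_trans st _).
have phi2 t : a <= t <= b ->
    phi (t, y) ^+ 2 <= Num.min (t - a) (b - t) * (D b - D a).
  move=> /andP[at1 tb].
  have h1 : phi (t, y) ^+ 2 <= (t - a) * (D b - D a).
    have := @sqr_le_energy _ (fun t => phi (t, y)) (fun t => phit (t, y)) D a t at1.
    rewrite phia subr0 => /(_ _ _)/le_trans; apply.
    - by move=> x /andP[ax xt]; apply: phid; rewrite ax (le_trans xt tb).
    - by move=> x /andP[ax xt]; apply: Dd; rewrite ax (le_trans xt tb).
    by rewrite ler_wpM2l ?subr_ge0// Dle.
  have h2 : phi (t, y) ^+ 2 <= (b - t) * (D b - D a).
    have := @sqr_le_energy _ (fun t => phi (t, y)) (fun t => phit (t, y)) D t b tb.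
    rewrite phib sub0r sqrrN => /(_ _ _)/le_trans; apply.
    - by move=> x /andP[tx xb]; apply: phid; rewrite xb (le_trans at1 tx).
    - by move=> x /andP[tx xb]; apply: Dd; rewrite xb (le_trans at1 tx).
    by rewrite ler_wpM2l ?subr_ge0// Dle.
  by rewrite minEle; case: ifP.
(* One factor of the density is spent against [phi ^ 2 <= distance * energy], where the density
   bound gives [18 m]; the other factor integrates to at most [m]. *)
have hB : int1 a b (fun t => circle L W t ^+ 2 / m * phi (t, y) ^+ 2) <=
    18 * L ^+ 2 * m * (D b - D a).
  apply: (@le_trans _ _ (int1 a b (fun t => (18 * L ^+ 2 * (D b - D a)) * (circle L W t / L)))).
    apply: int1_le => [t /sub tab|t /sub tab|t tab].
    - by continuity; [exact: crho|exact: cphi1].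
    - by continuity; exact: crho.
    have /andP[at1 tb] := tab.
    have hb := density_bound H k0 m0' km e0 em m8' Pm at1 tb.
    rewrite uE ?sub// in hb.
    set q := circle L W t / L in hb *.
    have q0 : 0 <= q by rewrite /q -uE ?sub// expR_ge0.
    have -> : circle L W t = L * q by rewrite /q mulrCA divff ?mulr1// lt0r_neq0.
    have h1 : q * phi (t, y) ^+ 2 <= 18 * m * (D b - D a).
      apply: (@le_trans _ _ (q * (Num.min (t - a) (b - t) * (D b - D a)))).
        by rewrite ler_wpM2l// phi2.
      by rewrite mulrA ler_wpM2r.
    have h2 : 0 <= L ^+ 2 / m * q.
      by apply: mulr_ge0 => //; apply: divr_ge0 => //; exact: sqr_ge0.
    have := ler_wpM2l h2 h1.
    have -> : L ^+ 2 / m * q * (q * phi (t, y) ^+ 2) = (L * q) ^+ 2 / m * phi (t, y) ^+ 2 by ring.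
    move/le_trans; apply; rewrite le_eqVlt; apply/orP; left; apply/eqP.
    by field; rewrite lt0r_neq0.
  rewrite int1Z; last by move=> t /sub tab; exact: cu.
  rewrite PE (_ : 18 * L ^+ 2 * m * (D b - D a) = 18 * L ^+ 2 * (D b - D a) * m); last by ring.
  rewrite ler_wpM2l//; apply: mulr_ge0 => //; apply: mulr_ge0 => //.
  exact: sqr_ge0.
rewrite DE.
rewrite [X in _ <= _ + X](_ : _ = int1 a b (fun t => m * phiy (t, y) ^+ 2)); last first.
  by rewrite int1Z// => t /sub tab; continuity; exact: cphiy1.
rewrite /G /= int1D; last 2 first.
- by move=> t /sub tab; continuity; [exact: crho2|exact: cphi1].
- by move=> t /sub tab; continuity; exact: cphiy1.
rewrite lerD2r.
rewrite (@int1_eq _ _ _ _ (fun t => circle L W t / L * phi (t, y) ^+ 2 + circle L W t ^+ 2 / m * phi (t, y) ^+ 2)); last first.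
  by move=> t _; rewrite /rho2 mulrDl.
rewrite int1D; last 2 first.
- by move=> t /sub tab; exact: cA.
- by move=> t /sub tab; continuity; [exact: crho|exact: cphi1].
rewrite AE /C; apply: (le_trans (lerD hA hB)).
by rewrite le_eqVlt; apply/orP; left; apply/eqP; ring.
Qed.

End CylinderEnergy.

(** * Smooth functions and pointwise consequences of the equation *)

Section Partials.
Context {R : realType}.
Implicit Types (f : R * R -> R) (x : R * R).

Lemma is_derive_dt f x (d : R) :
  is_derive x.1 1 (fun s => f (s, x.2)) d <-> is_derive x (1, 0) f d.
Proof.
have E (h : R) : h *: (1, 0) + x = (h *: 1 + x.1, x.2) :> R * R.
  by case: x => a b; congr pair; rewrite /= scaler0 add0r.
have E' : (fun h : R => h^-1 *: (((fun s => f (s, x.2)) \o shift x.1) (h *: (1 : R))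
      - f (x.1, x.2))) = (fun h : R => h^-1 *: ((f \o shift x) (h *: (1, 0)) - f x)).
  by apply/funext => h /=; rewrite E; case: x {E}.
split => -[h1 h2]; constructor.
- by rewrite /derivable -E'.
- by rewrite -h2 /derive E'.
- by rewrite /derivable E'.
- by rewrite -h2 /derive -E'.
Qed.

Lemma is_derive_dtheta f x (d : R) :
  is_derive x.2 1 (fun s => f (x.1, s)) d <-> is_derive x (0, 1) f d.
Proof.
have E (h : R) : h *: (0, 1) + x = (x.1, h *: 1 + x.2) :> R * R.
  by case: x => a b; congr pair; rewrite /= scaler0 add0r.
have E' : (fun h : R => h^-1 *: (((fun s => f (x.1, s)) \o shift x.2) (h *: (1 : R))
      - f (x.1, x.2))) = (fun h : R => h^-1 *: ((f \o shift x) (h *: (0, 1)) - f x)).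
  by apply/funext => h /=; rewrite E; case: x {E}.
split => -[h1 h2]; constructor.
- by rewrite /derivable -E'.
- by rewrite -h2 /derive E'.
- by rewrite /derivable E'.
- by rewrite -h2 /derive -E'.
Qed.

Lemma dtE f x (d : R) : is_derive x.1 1 (fun s => f (s, x.2)) d -> dt f x = d.
Proof. by move/is_derive_dt => -[]. Qed.

Lemma dthetaE f x (d : R) : is_derive x.2 1 (fun s => f (x.1, s)) d ->
  dtheta f x = d.
Proof. by move/is_derive_dtheta => -[]. Qed.

Lemma dtP f x : derivable f x (1, 0) ->
  is_derive x.1 1 (fun s => f (s, x.2)) (dt f x).
Proof. by move=> h; apply/is_derive_dt; exact: DeriveDef. Qed.

Lemma dthetaP f x : derivable f x (0, 1) ->
  is_derive x.2 1 (fun s => f (x.1, s)) (dtheta f x).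
Proof. by move=> h; apply/is_derive_dtheta; exact: DeriveDef. Qed.

Lemma classC2 (O : set (R * R)) f : classC 2 O f -> forall x, O x ->
  [/\ {for x, continuous (dt f)}, {for x, continuous (dt (dt f))},
      {for x, continuous (dtheta f)} & {for x, continuous (dtheta (dtheta f))}] /\
  [/\ {for x, continuous f},
      is_derive x.1 1 (fun s => f (s, x.2)) (dt f x),
      is_derive x.1 1 (fun s => dt f (s, x.2)) (dt (dt f) x),
      is_derive x.2 1 (fun s => f (x.1, s)) (dtheta f x) &
      is_derive x.2 1 (fun s => dtheta f (x.1, s)) (dtheta (dtheta f) x)].
Proof.
move=> [c0 [d0 [c1 [d1 [c11 _] _]] [c2 [d2 _ [c22 _]]]]] x Ox.
have [d0t d0y] := d0 x Ox; have [d1t _] := d1 x Ox; have [_ d2y] := d2 x Ox.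
split; split.
- exact: c1.
- exact: c11.
- exact: c2.
- exact: c22.
- exact: c0.
- exact: dtP.
- exact: dtP.
- exact: dthetaP.
- exact: dthetaP.
Qed.

End Partials.

(** * Smooth functions of one variable and a flat exponential *)

Section Smooth.
Context {R : realType}.
Implicit Types (f g : R -> R) (x c r : R).

Fixpoint derivable_n (n : nat) f : Prop :=
  if n is n'.+1 then (forall x : R, derivable f x 1) /\ derivable_n n' (derive1 f)
  else True.

Definition smooth f := forall n, derivable_n n f.

Lemma derivable_nS n f : derivable_n n.+1 f -> derivable_n n f.
Proof. by elim: n f => // n ih f [df dnf]; split => //; exact: ih. Qed.

Lemma derivable_n_is_derive n f g : (forall x : R, is_derive x 1 f (g x)) ->
  derivable_n n g -> derivable_n n.+1 f.
Proof.
move=> fg dg; split; first by move=> x; have [] := fg x.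
suff -> : (derive1 f) = g by [].
by apply/funext => x; rewrite derive1E; have [_] := fg x.
Qed.

Lemma derivable_n_derive1 n f : derivable_n n.+1 f ->
  (forall x : R, is_derive x 1 f ((derive1 f) x)) /\ derivable_n n (derive1 f).
Proof.
move=> [df dnf]; split => // x; constructor; first exact: df.
by rewrite derive1E.
Qed.

Lemma derivable_n_cst n (c : R) : derivable_n n (fun=> c).
Proof.
elim: n c => // n ih c.
by apply: (@derivable_n_is_derive _ _ (fun=> 0)) => // x; exact: is_derive1_cst.
Qed.

Lemma derivable_nD n f g : derivable_n n f -> derivable_n n g ->
  derivable_n n (fun x => f x + g x).
Proof.
elim: n f g => // n ih f g /derivable_n_derive1[df f1] /derivable_n_derive1[dg g1].
apply: (derivable_n_is_derive (fun x => is_derive1D (df x) (dg x))).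
exact: ih.
Qed.

Lemma derivable_nM n f g : derivable_n n f -> derivable_n n g ->
  derivable_n n (fun x => f x * g x).
Proof.
elim: n f g => // n ih f g fn gn.
have [df f1] := derivable_n_derive1 fn; have [dg g1] := derivable_n_derive1 gn.
apply: (derivable_n_is_derive (fun x => is_derive1M (df x) (dg x))).
by apply: derivable_nD; apply: ih => //; exact: derivable_nS.
Qed.

Lemma derivable_n_comp n f g : derivable_n n f -> derivable_n n g ->
  derivable_n n (fun x => f (g x)).
Proof.
elim: n f g => // n ih f g fn gn.
have [df f1] := derivable_n_derive1 fn; have [dg g1] := derivable_n_derive1 gn.
apply: (derivable_n_is_derive (fun x => is_derive1_comp2 (dg x) (df (g x)))).
by apply: derivable_nM => //; apply: ih => //; exact: derivable_nS.
Qed.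

Lemma derivable_nV n f : (forall x, f x != 0) -> derivable_n n f ->
  derivable_n n (fun x => (f x)^-1).
Proof.
move=> f0; elim: n => // n ih fn; have [df f1] := derivable_n_derive1 fn.
have fV : derivable_n n (fun x => (f x)^-1) by apply: ih; exact: derivable_nS.
have dV (x : R) : is_derive x 1 (fun x => (f x)^-1)
    ((-1) * ((derive1 f) x * ((f x)^-1 * (f x)^-1))).
  apply: (is_derive_eq (is_derive1V (f0 x) (df x))).
  by field; exact: f0.
apply: (derivable_n_is_derive dV).
apply: derivable_nM; first exact: derivable_n_cst.
by do 2 apply: derivable_nM => //.
Qed.

Lemma smooth_cst c : smooth (fun=> c).
Proof. by move=> n; exact: derivable_n_cst. Qed.

Lemma smooth_id : smooth (fun x => x).
Proof.
case=> // n; apply: (derivable_n_is_derive (@is_derive1_id R)).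
exact: derivable_n_cst.
Qed.

Lemma smoothD f g : smooth f -> smooth g -> smooth (fun x => f x + g x).
Proof. by move=> hf hg n; exact: derivable_nD. Qed.

Lemma smoothM f g : smooth f -> smooth g -> smooth (fun x => f x * g x).
Proof. by move=> hf hg n; exact: derivable_nM. Qed.

Lemma smoothN f : smooth f -> smooth (fun x => - f x).
Proof.
move=> hf; rewrite (_ : (fun x => _) = (fun x => (-1) * f x)).
  by apply: smoothM => //; exact: smooth_cst.
by apply/funext => x; rewrite mulN1r.
Qed.

Lemma smoothB f g : smooth f -> smooth g -> smooth (fun x => f x - g x).
Proof. by move=> hf hg; apply: smoothD => //; exact: smoothN. Qed.

Lemma smooth_comp f g : smooth f -> smooth g -> smooth (fun x => f (g x)).
Proof. by move=> hf hg n; exact: derivable_n_comp. Qed.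

Lemma smoothV f : (forall x, f x != 0) -> smooth f ->
  smooth (fun x => (f x)^-1).
Proof. by move=> f0 hf n; exact: derivable_nV. Qed.

Lemma smooth_derive1 f : smooth f -> smooth (derive1 f).
Proof. by move=> hf n; have [] := hf n.+1. Qed.

Lemma smooth_is_derive f x : smooth f -> is_derive x 1 f ((derive1 f) x).
Proof. by move=> /(_ 1%N)/derivable_n_derive1[]. Qed.

Lemma smooth_continuous f x : smooth f -> {for x, continuous f}.
Proof. by move=> /(smooth_is_derive x); exact: is_derive_continuous. Qed.

Lemma smooth_expR : smooth expR.
Proof.
by elim=> // n ih; exact: (derivable_n_is_derive (@is_derive_expR R)).
Qed.

Lemma smooth_cos_sin : smooth cos /\ smooth (@sin R).
Proof.
suff H n : derivable_n n cos /\ derivable_n n (@sin R).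
  by split => n; have [] := H n.
elim: n => // n [hc hs]; split.
- have dcos (x : R) : is_derive x 1 cos ((-1) * sin x).
    by rewrite mulN1r; exact: is_derive_cos.
  apply: (derivable_n_is_derive dcos).
  by apply: derivable_nM => //; exact: derivable_n_cst.
- exact: (derivable_n_is_derive (@is_derive_sin R)).
Qed.

(* The smooth function with all derivatives vanishing at [0]; its derivatives
   are combinations of the [exp_inv n]. *)
Definition exp_inv (n : nat) x : R :=
  if 0 < x then x^-1 ^+ n * expR (- x^-1) else 0.

Lemma exp_inv_ge0 n x : 0 <= exp_inv n x.
Proof.
rewrite /exp_inv; case: ifP => // x0.
by rewrite mulr_ge0 ?expR_ge0// exprn_ge0// invr_ge0 ltW.
Qed.

Lemma exp_inv_gt0 n x : 0 < x -> 0 < exp_inv n x.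
Proof.
by move=> x0; rewrite /exp_inv x0 mulr_gt0 ?expR_gt0// exprn_gt0// invr_gt0.
Qed.

Lemma exp_inv_le0 n x : x <= 0 -> exp_inv n x = 0.
Proof. by rewrite /exp_inv leNgt => /negbTE ->. Qed.

(** [x / n <= expR (x / n)], raised to the power [n]. *)
Lemma expRN_le (n : nat) x : 0 < x -> x ^+ n * expR (- x) <= n%:R ^+ n.
Proof.
case: n => [|n] x0; first by rewrite !expr0 mul1r expR_le1 oppr_le0 ltW.
rewrite expRN -ler_pdivlMr ?invr_gt0 ?expR_gt0// invrK.
have n0 : 0 < n.+1%:R :> R by rewrite ltr0n.
pose y := n.+1%:R^-1 * x.
have xE : x = n.+1%:R * y by rewrite /y mulVKf// lt0r_neq0.
have y0 : 0 < y by rewrite mulr_gt0// invr_gt0.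
rewrite {2}xE expRM_natl -exprMn.
have h : x <= n.+1%:R * expR y.
  rewrite xE ler_pM2l//; apply: le_trans (expR_ge1Dx y).
  by rewrite lerDr ler01.
by apply: lerXn2r => //; rewrite nnegrE ?(ltW x0)// mulr_ge0 ?expR_ge0// ltW.
Qed.

Lemma is_derive_exp_inv n x :
  is_derive x 1 (exp_inv n) (exp_inv n.+2 x - n%:R * exp_inv n.+1 x).
Proof.
have [x0|x0|<-] := ltgtP 0 x.
- apply: (@near_eq_is_derive _ _ _ (fun y : R => y^-1 ^+ n * expR (- y^-1)) (exp_inv n)).
  + by near=> y; rewrite /exp_inv ifT//; near: y; exact: lt_nbhsr.
  + rewrite /exp_inv x0; have xn := lt0r_neq0 x0.
    derivation => //; case: n => [|n]; first by field.
    rewrite /= -mulr_natl !(exprS x^-1); move: (x^-1 ^+ n) (n.+1%:R) => w N.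
    by rewrite !mul1r; field.
- rewrite !exp_inv_le0 ?(ltW x0)// mulr0 subr0.
  apply: (@near_eq_is_derive _ _ _ (fun=> 0 : R) (exp_inv n)).
  by near=> y; rewrite exp_inv_le0//; apply: ltW; near: y; exact: lt_nbhsl.
- rewrite !exp_inv_le0// mulr0 subr0.
  have H : h^-1 *: ((exp_inv n \o shift 0) (h *: (1 : R)) - exp_inv n 0) @[h --> 0^'] --> (0 : R).
    (* The difference quotient at [h > 0] is [h] times [exp_inv n.+2 h], and [C] bounds the latter
       by [expRN_le]. *)
    apply/cvgr0Pnorm_le => e e0; pose C : R := n.+2%:R ^+ n.+2.
    have C0 : 0 < C by rewrite exprn_gt0// ltr0n.
    near=> h; rewrite /= addr0 (exp_inv_le0 _ (lexx 0)) subr0.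
    rewrite (_ : h *: 1 = h); last by rewrite /GRing.scale/= mulr1.
    rewrite /exp_inv; case: ifP => [h0|_]; last by rewrite scaler0 normr0 ltW.
    have hn := lt0r_neq0 h0.
    have hi : 0 < h^-1 by rewrite invr_gt0.
    rewrite /GRing.scale/= ger0_norm; last first.
      by rewrite mulr_ge0 ?(ltW hi)// mulr_ge0 ?expR_ge0// exprn_ge0// ltW.
    have := expRN_le n.+2 hi; rewrite -/C => hC.
    have -> : h^-1 * (h^-1 ^+ n * expR (- h^-1)) = h * (h^-1 ^+ n.+2 * expR (- h^-1)).
      by rewrite !exprS !mulrA divff// mul1r.
    apply: (@le_trans _ _ (h * C)); first by rewrite ler_wpM2l// ltW.
    rewrite -ler_pdivlMr//; apply: (le_trans (ler_norm _)).
    near: h; apply: dnbhs0_le; exact: divr_gt0.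
  constructor; first by apply/cvg_ex; exists 0.
  exact: cvg_lim.
Unshelve. all: by end_near. Qed.

Lemma smooth_exp_inv : smooth (exp_inv 0).
Proof.
move=> k; move: 0%N; elim: k => // k ih n.
apply: (derivable_n_is_derive (is_derive_exp_inv n)).
apply: derivable_nD => //.
rewrite (_ : (fun x => _) = (fun x => (- n%:R) * exp_inv n.+1 x)).
  by apply: derivable_nM => //; exact: derivable_n_cst.
by apply/funext => x; rewrite mulNr.
Qed.

(** The test functions constructed below are all such products, possibly with a constant factor. *)
Lemma classC_tensor k f g : smooth f -> smooth g ->
  classC k setT (fun x : R * R => f x.1 * g x.2).
Proof.
elim: k f g => [|k ih] f g hf hg; (split; [move=> x _|]) => //.
- apply: continuous_atM; [apply: (@continuous_comp _ _ _ fst f)|apply: (@continuous_comp _ _ _ snd g)].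
  + exact: cvg_fst.
  + exact: smooth_continuous.
  + exact: cvg_snd.
  + exact: smooth_continuous.
- apply: continuous_atM; [apply: (@continuous_comp _ _ _ fst f)|apply: (@continuous_comp _ _ _ snd g)].
  + exact: cvg_fst.
  + exact: smooth_continuous.
  + exact: cvg_snd.
  + exact: smooth_continuous.
have d1 (x : R * R) : is_derive x.1 1 (fun s => f s * g x.2) ((derive1 f) x.1 * g x.2).
  have ? := smooth_is_derive x.1 hf.
  by derivation; rewrite mulr0 addr0.
have d2 (x : R * R) : is_derive x.2 1 (fun s => f x.1 * g s) (f x.1 * (derive1 g) x.2).
  have ? := smooth_is_derive x.2 hg.
  by derivation; rewrite mul0r add0r.
split.
- move=> x _; split.
  + by have [] := (is_derive_dt (fun x : R * R => f x.1 * g x.2) x _).1 (d1 x).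
  + by have [] := (is_derive_dtheta (fun x : R * R => f x.1 * g x.2) x _).1 (d2 x).
- rewrite (_ : dt _ = (fun x : R * R => (derive1 f) x.1 * g x.2)).
    by apply: ih => //; exact: smooth_derive1.
  by apply/funext => x; apply: dtE; exact: d1.
- rewrite (_ : dtheta _ = (fun x : R * R => f x.1 * (derive1 g) x.2)).
    by apply: ih => //; exact: smooth_derive1.
  by apply/funext => x; apply: dthetaE; exact: d2.
Qed.

End Smooth.

(** * Angles modulo [2 pi] and the lifts of a point *)

Section Angles.
Context {R : realType}.
Implicit Types (z r : R) (x y p : R * R).

Lemma cos_int_period (k : int) z : cos (z + k%:~R * (2 * pi)) = cos z.
Proof.
have nat_period (n : nat) w : cos (w + n%:R * (2 * pi)) = cos w :> R.
  rewrite (_ : _ * _ = (pi *+ 2) *+ n); last first.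
    by rewrite -[in RHS]mulr_natl -(mulr_natl (pi : R)).
  exact: (periodicn (@cosD2pi R)).
case: k => n; first exact: nat_period.
rewrite NegzE mulrNz mulNr -[LHS](nat_period n.+1) -addrA.
by rewrite [X in cos (z + X)]addrC subrr addr0.
Qed.

Lemma angle_reduction z : exists k : int,
  [/\ - pi <= z - k%:~R * (2 * pi), z - k%:~R * (2 * pi) < pi &
      cos (z - k%:~R * (2 * pi)) = cos z].
Proof.
have p0 : 0 < 2 * pi :> R by rewrite mulr_gt0// pi_gt0.
(* The shift by [pi] makes the reduced angle fall in [[- pi, pi[], where the absolute value
   determines the cosine injectively. *)
pose w := (z + pi) / (2 * pi).
have wE : w * (2 * pi) = z + pi by rewrite /w divfK// lt0r_neq0.
exists (Num.floor w); split.
- have : (Num.floor w)%:~R * (2 * pi) <= w * (2 * pi).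
    by rewrite ler_wpM2r ?(ltW p0)// floor_le_tmp.
  by rewrite wE; move: ((Num.floor w)%:~R * (2 * pi)) => u; clear; lra.
- have : w * (2 * pi) < ((Num.floor w)%:~R + 1) * (2 * pi).
    by rewrite ltr_pM2r// -[X in _ + X]/(1%:~R) -intrD floorD1_gt.
  rewrite wE mulrDl mul1r; move: ((Num.floor w)%:~R * (2 * pi)) => u.
  by clear; lra.
- by rewrite -mulNr -mulrNz cos_int_period.
Qed.

(** A periodic way to say that [z] is near a period: it allows bumps that are smooth and
    [2 pi]-periodic by construction. *)
Lemma cos_gt_near z r : 0 < r -> r < pi -> cos r < cos z ->
  exists k : int, `|z - k%:~R * (2 * pi)| < r.
Proof.
move=> r0 rpi rz; have [k [h1 h2 h3]] := angle_reduction z; exists k.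
rewrite ltNge; apply/negP => h.
have : cos `|z - k%:~R * (2 * pi)| <= cos r.
  rewrite leNgt ltr_cos ?in_itv/= -?leNgt//.
    by rewrite normr_ge0/= ler_norml h1 (ltW h2).
  by rewrite (ltW r0) (ltW rpi).
by rewrite cos_norm h3 leNgt rz.
Qed.

Lemma cos_eq1 z : cos z = 1 -> exists k : int, z = k%:~R * (2 * pi).
Proof.
move=> z1; have [k [h1 h2 h3]] := angle_reduction z; exists k.
have : cos `|z - k%:~R * (2 * pi)| = cos 0 by rewrite cos_norm h3 z1 cos0.
move/cos_inj; rewrite !in_itv/= normr_ge0 lexx ler_norml h1 (ltW h2) pi_ge0.
by move=> /(_ isT isT)/normr0_eq0/eqP; rewrite subr_eq0 => /eqP.
Qed.

(* Near the lifts of [p] this is half the square of the distance to them. *)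
Definition sing_fun p x : R := 1 - cos (x.2 - p.2) + (x.1 - p.1) ^+ 2 / 2.

Lemma sing_fun_ge0 p x : 0 <= sing_fun p x.
Proof.
by rewrite /sing_fun addr_ge0// ?divr_ge0 ?sqr_ge0// subr_ge0 cos_le1.
Qed.

Lemma sing_fun_eq0 p x : (sing_fun p x == 0) <-> same_point x p.
Proof.
split.
- rewrite /sing_fun paddr_eq0; last 2 first.
  + by rewrite subr_ge0 cos_le1.
  + by rewrite divr_ge0 ?sqr_ge0.
  rewrite subr_eq0 mulf_eq0 invr_eq0 pnatr_eq0 orbF sqrf_eq0 subr_eq0.
  move=> /andP[/eqP/esym/cos_eq1[k kE] /eqP x1]; split => //; exists k.
  by rewrite -kE addrC subrK.
- move=> [x1 [k x2]]; rewrite /sing_fun x1 x2 subrr expr0n/= mul0r addr0.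
  by rewrite addrAC subrr cos_int_period cos0 subrr.
Qed.

Lemma sing_fun_gt0 p x : ~ same_point x p -> 0 < sing_fun p x.
Proof.
move=> h; rewrite lt_neqAle sing_fun_ge0 andbT eq_sym.
by apply/negP => /sing_fun_eq0.
Qed.

Lemma continuous_fst_at (f : R -> R) x : {for x.1, continuous f} ->
  {for x, continuous (fun x : R * R => f x.1)}.
Proof.
by move=> cf; apply: (@continuous_comp _ _ _ fst f); [exact: cvg_fst|exact: cf].
Qed.

Lemma continuous_snd_at (f : R -> R) x : {for x.2, continuous f} ->
  {for x, continuous (fun x : R * R => f x.2)}.
Proof.
by move=> cf; apply: (@continuous_comp _ _ _ snd f); [exact: cvg_snd|exact: cf].
Qed.

Lemma continuous_sing_fun p x : {for x, continuous (sing_fun p)}.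
Proof.
apply: continuous_atD.
  apply: (@continuous_snd_at (fun s => 1 - cos (s - p.2))).
  have : is_derive x.2 1 (fun s => 1 - cos (s - p.2)) (sin (x.2 - p.2)).
    by derivation; ring.
  exact: is_derive_continuous.
apply: (@continuous_fst_at (fun s => (s - p.1) ^+ 2 / 2)).
have : is_derive x.1 1 (fun s => (s - p.1) ^+ 2 / 2) (x.1 - p.1).
  by derivation; field.
exact: is_derive_continuous.
Qed.

(** The lifts of a point are infinitely many, but they are the zeros of a single continuous function
    [sing_fun]. *)
Lemma near_not_same_point (m : nat) (q : 'I_m -> R * R) x :
  (forall j, ~ same_point x (q j)) ->
  \forall y \near x, forall j, ~ same_point y (q j).
Proof.
move=> hx.
apply: (@filter_forall _ _ (fun j y => ~ same_point y (q j)) (nbhs x)) => j.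
have : \forall y \near x, 0 < sing_fun (q j) y.
  exact: (cvgr_gt _ (@continuous_sing_fun (q j) x) _ (sing_fun_gt0 (hx j))).
apply: filterS => y h /sing_fun_eq0/eqP h0; by rewrite h0 ltxx in h.
Qed.

Lemma near_strip l x : strip l x -> \forall y \near x, strip l y.
Proof.
move=> /andP[h1 h2].
have c1 : {for x, continuous (fun x : R * R => x.1)} by exact: cvg_fst.
have n1 := cvgr_gt _ c1 _ h1; have n2 := cvgr_lt _ c1 _ h2.
near=> y; rewrite /strip/=; apply/andP; split; near: y.
- exact: n1.
- exact: n2.
Unshelve. all: by end_near. Qed.

Lemma near_box x (P : R * R -> Prop) : (\forall y \near x, P y) ->
  exists2 e, 0 < e & forall y, `|y.1 - x.1| < e -> `|y.2 - x.2| < e -> P y.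
Proof.
move=> /nbhs_ballP[e /= e0 he]; exists e => // y h1 h2; apply: he.
by split; rewrite /ball/= distrC.
Qed.

End Angles.

Section Positivity.
Context {R : realType}.
Implicit Types (f g u v : R -> R) (a b c : R).

(** Otherwise the monotone primitive of [f] would be constant around [c], and its derivative [f c]
    would vanish. *)
Lemma int1_gt0 a b c f : a < c < b -> (forall x, {for x, continuous f}) ->
  (forall x, a <= x <= b -> 0 <= f x) -> 0 < f c -> 0 < int1 a b f.
Proof.
move=> /andP[ac cb] cf f0 fc.
have ab : a <= b by rewrite ltW// (lt_trans ac cb).
have [P Pd] := @primitive _ a b (a - 1) (b + 1) f ltac:(by rewrite ltrBlDr ltrDl)
  ltac:(by rewrite ltrDl) (fun x _ => cf x).
have PE : int1 a b f = P b - P a by apply: int1_FTC => // x _; exact: cf.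
have Pm x y : a <= x -> x <= y -> y <= b -> P x <= P y.
  move=> ax xy yb; apply: (@derive_ge0_le _ P f) => // z /andP[xz zy].
    by apply: Pd; rewrite (le_trans ax xz) (le_trans zy yb).
  by apply: f0; rewrite (le_trans ax xz) (le_trans zy yb).
rewrite PE subr_gt0 ltNge; apply/negP => Pba.
have Pc : \forall x \near c, P a = P x.
  near=> x; apply/eqP; rewrite eq_le.
  have ax : a <= x by apply: ltW; near: x; exact: lt_nbhsr.
  have xb : x <= b by apply: ltW; near: x; exact: lt_nbhsl.
  by rewrite Pm//= (le_trans _ Pba)// Pm.
have [_ h] : is_derive c 1 P 0.
  apply: (@near_eq_is_derive _ _ _ (fun=> P a) P c 1 0 Pc).
have [_ h'] := Pd c ltac:(by rewrite !ltW).
by rewrite h' in h; rewrite h ltxx in fc.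
Unshelve. all: by end_near. Qed.

Lemma Green_segment a b u du d2u v dv d2v : a <= b ->
  (forall x, a <= x <= b -> [/\ is_derive x 1 u (du x), is_derive x 1 du (d2u x),
     is_derive x 1 v (dv x) & is_derive x 1 dv (d2v x)]) ->
  (forall x, a <= x <= b -> {for x, continuous d2u}) ->
  (forall x, a <= x <= b -> {for x, continuous d2v}) ->
  u a * dv a - du a * v a = u b * dv b - du b * v b ->
  int1 a b (fun x => u x * d2v x) = int1 a b (fun x => d2u x * v x).
Proof.
move=> ab H cd2u cd2v bdry.
have cu x : a <= x <= b -> {for x, continuous u}.
  by move/H => -[h _ _ _]; exact: is_derive_continuous h.
have cv x : a <= x <= b -> {for x, continuous v}.
  by move/H => -[_ _ h _]; exact: is_derive_continuous h.
have c1 x : a <= x <= b -> {for x, continuous (fun x => u x * d2v x)}.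
  by move=> xab; apply: continuous_atM; [exact: cu|exact: cd2v].
have c2 x : a <= x <= b -> {for x, continuous (fun x => d2u x * v x)}.
  by move=> xab; apply: continuous_atM; [exact: cd2u|exact: cv].
have d12 x : a <= x <= b ->
    is_derive x 1 (fun x => u x * dv x - du x * v x) (u x * d2v x - d2u x * v x).
  by move=> /H[? ? ? ?]; derivation; ring.
have := int1_FTC ab (fun x xab => continuous_atB (c1 x xab) (c2 x xab)) d12.
rewrite int1B// bdry subrr => /eqP.
by rewrite subr_eq0 => /eqP.
Qed.

End Positivity.

Section ClosedBox.
Context {R : realType}.
Local Notation mu := (@lebesgue_measure R).
Local Notation area := (@lebesgue_measure R \x @lebesgue_measure R)%E.
Local Notation plane := (measurableTypeR R * measurableTypeR R)%type.
Implicit Types (F G : R * R -> R) (a b c d : R).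

Lemma Fubini_box a b c d F :
  (forall x, a <= x.1 <= b -> c <= x.2 <= d -> {for x, continuous F}) ->
  [/\ area.-integrable (`[a, b] `*` `[c, d]) (EFin \o F),
    \int[area]_(z in `[a, b] `*` `[c, d]) F z =
      int1 a b (fun x => int1 c d (fun y => F (x, y))) &
    \int[area]_(z in `[a, b] `*` `[c, d]) F z =
      int1 c d (fun y => int1 a b (fun x => F (x, y)))].
Proof.
move=> cF.
have iF : area.-integrable (`[a, b] `*` `[c, d]) (EFin \o F).
  apply: (@integrable_rectangle _ _ a b c d) => // x [/=].
  by rewrite !in_itv/=; exact: cF.
have [|||x|y|h1 h2] := @Fubini_rectangle _ F `[a, b] `[c, d].
- exact: measurable_itv.
- exact: measurable_itv.
- exact: iF.
- rewrite /= in_itv/= => xab; apply: int1_integrable => y ycd.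
  by apply: continuous_section2; exact: cF.
- rewrite /= in_itv/= => ycd; apply: int1_integrable => x xab.
  by apply: continuous_section1; exact: cF.
by split; [exact: iF|exact: h1|exact: h2].
Qed.

End ClosedBox.

Section ExpInvComp.
Context {R : realType}.
Implicit Types (z : R -> R) (t : R).

Lemma smooth_exp_inv_comp z : smooth z -> smooth (fun t => exp_inv 0 (z t)).
Proof. by move=> hz; exact: (smooth_comp smooth_exp_inv hz). Qed.

(** The composite vanishes to second order also at the zeros of [z]: the bump and its Laplacian can
    be restricted to a closed box, and integration by parts there leaves no boundary terms. *)
Lemma exp_inv_comp_flat z t : smooth z -> z t <= 0 ->
  [/\ exp_inv 0 (z t) = 0, derive1 (fun t => exp_inv 0 (z t)) t = 0 &
      derive1 (derive1 (fun t => exp_inv 0 (z t))) t = 0].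
Proof.
move=> hz zt.
have dz s := smooth_is_derive s hz.
have ddz s := smooth_is_derive s (smooth_derive1 hz).
have d1 (s : R) : is_derive s 1 (fun t => exp_inv 0 (z t)) (exp_inv 2 (z s) * derive1 z s).
  apply: (is_derive_eq (is_derive1_comp2 (dz s) (is_derive_exp_inv 0 (z s)))).
  by rewrite mul0r subr0.
have d1E : derive1 (fun t => exp_inv 0 (z t)) = (fun s => exp_inv 2 (z s) * derive1 z s).
  by apply/funext => s; rewrite derive1E; have [_] := d1 s.
split; first exact: exp_inv_le0.
  by rewrite d1E exp_inv_le0// mul0r.
rewrite d1E derive1E.
have [_ ->] := is_derive1M (is_derive1_comp2 (dz t) (is_derive_exp_inv 2 (z t))) (ddz t).
by rewrite !exp_inv_le0// mulr0 subrr !mul0r addr0.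
Qed.

End ExpInvComp.

(** * From the distributional equation to a pointwise inequality *)

Section Pointwise.
Context {R : realType}.
Local Notation mu := (@lebesgue_measure R).
Local Notation area := (@lebesgue_measure R \x @lebesgue_measure R)%E.
Local Notation plane := (measurableTypeR R * measurableTypeR R)%type.
Implicit Types (f g : R -> R) (x : R * R) (l t r : R).

Lemma laplacian_tensor f g x : smooth f -> smooth g ->
  [/\ dt (fun x => f x.1 * g x.2) x = derive1 f x.1 * g x.2,
    dtheta (fun x => f x.1 * g x.2) x = f x.1 * derive1 g x.2 &
    laplacian (fun x => f x.1 * g x.2) x =
      derive1 (derive1 f) x.1 * g x.2 + f x.1 * derive1 (derive1 g) x.2].
Proof.
have H1 (f' g' : R -> R) : smooth f' -> dt (fun x => f' x.1 * g' x.2) = (fun x => derive1 f' x.1 * g' x.2).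
  move=> hf; apply/funext => y; apply: dtE => /=.
  have ? := smooth_is_derive y.1 hf.
  by derivation; rewrite mulr0 addr0.
have H2 (f' g' : R -> R) : smooth g' -> dtheta (fun x => f' x.1 * g' x.2) = (fun x => f' x.1 * derive1 g' x.2).
  move=> hf; apply/funext => y; apply: dthetaE => /=.
  have ? := smooth_is_derive y.2 hf.
  by derivation; rewrite mul0r add0r.
move=> hf hg; rewrite /laplacian H1// H2// H1 ?H2//; exact: smooth_derive1.
Qed.

(** If the continuous function [laplacian U + e^U] were below [- c < 0] near [x], a nonnegative bump
    [phi] supported there would give a negative integral after moving the Laplacian back to [U]; the
    equation gives zero, as [phi] vanishes at every [q j]. *)
Lemma liouville_laplacian_ge0 l (m : nat) (q : 'I_m -> R * R) (beta : 'I_m -> R) U x :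
  liouville l q beta U -> strip l x -> 0 < x.2 < 2 * pi ->
  (forall j, ~ same_point x (q j)) -> 0 <= laplacian U x + expR (U x).
Proof.
move=> [_ _ /classC2 CU _ HU] xl /andP[x20 x22] xq.
rewrite leNgt; apply/negP => gneg.
pose g y := laplacian U y + expR (U y).
pose c := - g x / 2.
have c0 : 0 < c by rewrite /c; rewrite -/(g x) in gneg; clear -gneg; lra.
have cg y : strip l y -> (forall j, ~ same_point y (q j)) -> {for y, continuous g}.
  move=> yl yq; have [[_ c11 _ c22] [c00 _ _ _ _]] := CU y (conj yl yq).
  apply: (@continuous_atD _ _ (laplacian U) (fun y => expR (U y))).
    exact: continuous_atD c11 c22.
  exact: continuous_at_expR c00.
have [e e0 He] : exists2 e, 0 < e & forall y, `|y.1 - x.1| < e -> `|y.2 - x.2| < e ->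
    [/\ strip l y, forall j, ~ same_point y (q j) & g y < - c].
  apply: near_box; near=> y; split.
  - near: y; exact: near_strip.
  - near: y; exact: near_not_same_point.
  - near: y; apply: (cvgr_lt _ (cg x xl xq)).
    by rewrite /c; rewrite -/(g x) in gneg; clear -gneg; lra.
(* The box of half-side [r] must stay inside one period, so that no other lift of it meets the
   fundamental domain; [r <= 1 < pi] lets the cosine detect distances up to [r]. *)
have [r [r0 re r2 r3 r1]] : exists r, [/\ 0 < r, r < e, r < x.2, r < 2 * pi - x.2 & r <= 1].
  exists (Num.min (e / 2) (Num.min (x.2 / 2) (Num.min ((2 * pi - x.2) / 2) 1))).
  have h1 : 0 < 2 * pi - x.2 by rewrite subr_gt0.
  have half (u : R) : 0 < u -> u / 2 < u by clear; lra.
  split.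
  - by rewrite !lt_min !divr_gt0 ?ltr01.
  - by rewrite gt_min (half _ e0).
  - by rewrite !gt_min (half _ x20) orbT.
  - by rewrite !gt_min (half _ h1) !orbT.
  - by rewrite !ge_min lexx !orbT.
have rpi : r < pi by apply: (le_lt_trans r1); apply: lt_le_trans (pi_ge2 R); rewrite ltr1n.
have inbox y : x.1 - r <= y.1 <= x.1 + r -> x.2 - r <= y.2 <= x.2 + r ->
    [/\ strip l y, forall j, ~ same_point y (q j) & g y < - c].
  by move=> y1 y2; apply: He; apply: le_lt_trans re; rewrite ler_distl.
(* Both functions are positive exactly near the centre; [zb] uses the cosine because the bump has to
   be periodic in the angle. *)
pose za s := r ^+ 2 - (s - x.1) * (s - x.1).
pose zb s := cos (s - x.2) - cos r.
have sza : smooth za.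
  apply: smoothB; first exact: smooth_cst.
  by apply: smoothM; apply: smoothB; [exact: smooth_id|exact: smooth_cst|exact: smooth_id|exact: smooth_cst].
have szb : smooth zb.
  apply: smoothB; last exact: smooth_cst.
  apply: (smooth_comp (proj1 smooth_cos_sin)).
  by apply: smoothB; [exact: smooth_id|exact: smooth_cst].
pose a s := exp_inv 0 (za s); pose b s := exp_inv 0 (zb s).
have sa : smooth a by exact: smooth_exp_inv_comp.
have sb : smooth b by exact: smooth_exp_inv_comp.
have za_out s : ~~ (x.1 - r <= s <= x.1 + r) -> za s <= 0.
  rewrite -ler_distl -ltNge => h.
  rewrite /za subr_le0 -expr2 -[leRHS]real_normK ?num_real//.
  by rewrite lerXn2r ?nnegrE ?(ltW r0)// ltW.
have za_end s : s = x.1 - r \/ s = x.1 + r -> za s <= 0.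
  by rewrite /za; case=> ->; rewrite le_eqVlt; apply/orP; left; apply/eqP; ring.
have zb_end s : s = x.2 - r \/ s = x.2 + r -> zb s <= 0.
  rewrite /zb; case=> ->; rewrite subr_le0.
    by rewrite addrAC subrr sub0r cosN.
  by rewrite addrAC subrr add0r.
have zb_in s : 0 < zb s -> exists k : int, `|s - x.2 - k%:~R * (2 * pi)| < r.
  by rewrite subr_gt0; exact: cos_gt_near.
have p2 : 0 < 2 * pi :> R by rewrite mulr_gt0// pi_gt0.
have zb_out s : 0 <= s < 2 * pi -> ~~ (x.2 - r <= s <= x.2 + r) -> zb s <= 0.
  move=> /andP[s0 s2] h; rewrite leNgt; apply/negP => /zb_in[k].
  rewrite ltr_distl => /andP[k1 k2]; move/negP: h; apply.
  suff k0 : k = 0 by move: k1 k2; rewrite k0 !mul0r; clear; lra.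
  apply/eqP; rewrite eq_le; apply/andP; split; rewrite leNgt; apply/negP => hk.
  - have : 1 * (2 * pi) <= k%:~R * (2 * pi) :> R.
      by rewrite ler_wpM2r ?(ltW p2)// -[1]/(1%:~R) ler_int -gtz0_ge1.
    by move: k1 k2; move: (k%:~R * (2 * pi)) => w; clear -r2 s2; lra.
  - have : k%:~R * (2 * pi) <= (-1) * (2 * pi) :> R.
      rewrite ler_wpM2r ?(ltW p2)// -[-1]/((-1)%:~R) ler_int.
      by rewrite -ltzD1 addNr.
    by move: k1 k2; move: (k%:~R * (2 * pi)) => w; clear -r3 s0; lra.
pose phi (x : R * R) := a x.1 * b x.2.
have Tphi : test_function l phi.
  split.
  - move=> y; rewrite /phi /b /zb /=; congr (_ * exp_inv 0 (_ - _)).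
    by rewrite addrAC mulr_natl cosD2pi.
  - by move=> k; exact: classC_tensor.
  - exists (x.1 - r), (x.1 + r).
    have [/andP[h1 _] _ _] := inbox (x.1 - r, x.2) ltac:(by rewrite /=; clear -r0; lra) ltac:(by rewrite /=; clear -r0; lra).
    have [/andP[_ h2] _ _] := inbox (x.1 + r, x.2) ltac:(by rewrite /=; clear -r0; lra) ltac:(by rewrite /=; clear -r0; lra).
    split => // y; apply: contraNT => /za_out h.
    by rewrite /phi /a exp_inv_le0// mul0r.
have := HU phi Tphi.
(* The prescribed [q j] may lie in another period: if the bump were nonzero at [q j], a translate of
   [q j] would lie in the box, which [inbox] excludes. *)
rewrite big1; last first.
  move=> j _; apply/eqP; rewrite mulf_eq0; apply/orP; right; rewrite /phi mulf_eq0.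
  apply/orP; have [za0|za0] := leP (za (q j).1) 0.
    by left; rewrite /a exp_inv_le0.
  right; rewrite /b; have [zb0|zb0] := leP (zb (q j).2) 0.
    by rewrite exp_inv_le0.
  exfalso; have [k hk] := zb_in _ zb0.
  have h1 : x.1 - r <= (q j).1 <= x.1 + r.
    by apply: contraTT za0 => /za_out; rewrite leNgt.
  have [_ /(_ j) + _] := inbox ((q j).1, (q j).2 - k%:~R * (2 * pi)) h1
    ltac:(by rewrite /= -ler_distl addrAC ltW).
  apply; split => //=; exists (- k).
  by rewrite mulrNz mulNr.
set A0 := x.1 - r in inbox za_out za_end *; set A1 := x.1 + r in inbox za_out za_end *.
set B0 := x.2 - r in inbox zb_out zb_end *; set B1 := x.2 + r in inbox zb_out zb_end *.
have ab0 : A0 <= A1 by rewrite /A0 /A1; clear -r0; lra.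
have bb0 : B0 <= B1 by rewrite /B0 /B1; clear -r0; lra.
pose a2 := derive1 (derive1 a); pose b2 := derive1 (derive1 b).
have ca2 s : {for s, continuous a2} by apply: smooth_continuous; do 2 apply: smooth_derive1.
have cb2 s : {for s, continuous b2} by apply: smooth_continuous; do 2 apply: smooth_derive1.
have ca s : {for s, continuous a} by exact: smooth_continuous.
have cb s : {for s, continuous b} by exact: smooth_continuous.
pose F1 (y : R * R) := U y * a2 y.1 * b y.2.
pose F2 (y : R * R) := U y * b2 y.2 * a y.1.
pose F3 (y : R * R) := expR (U y) * phi y.
have CU' y : A0 <= y.1 <= A1 -> B0 <= y.2 <= B1 -> _ := fun h1 h2 =>
  let: And3 p1 p2 _ := inbox y h1 h2 in CU y (conj p1 p2).
have cphi y : {for y, continuous phi}.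
  rewrite /phi; continuity.
  - exact: continuous_fst_at (ca _).
  - exact: continuous_snd_at (cb _).
have cF1 y : A0 <= y.1 <= A1 -> B0 <= y.2 <= B1 -> {for y, continuous F1}.
  move=> h1 h2; have [_ [c00 _ _ _ _]] := CU' y h1 h2.
  rewrite /F1; continuity.
  - exact: c00.
  - exact: continuous_fst_at (ca2 _).
  - exact: continuous_snd_at (cb _).
have cF2 y : A0 <= y.1 <= A1 -> B0 <= y.2 <= B1 -> {for y, continuous F2}.
  move=> h1 h2; have [_ [c00 _ _ _ _]] := CU' y h1 h2.
  rewrite /F2; continuity.
  - exact: c00.
  - exact: continuous_snd_at (cb2 _).
  - exact: continuous_fst_at (ca _).
have cF3 y : A0 <= y.1 <= A1 -> B0 <= y.2 <= B1 -> {for y, continuous F3}.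
  move=> h1 h2; have [_ [c00 _ _ _ _]] := CU' y h1 h2.
  by rewrite /F3; continuity; [exact: c00|exact: cphi].
have HE y : U y * laplacian phi y + expR (U y) * phi y = F1 y + F2 y + F3 y.
  have -> : laplacian phi y = a2 y.1 * b y.2 + a y.1 * b2 y.2.
    by have [_ _ ->] := @laplacian_tensor a b y sa sb.
  rewrite /F1 /F2 /F3.
  move: (expR (U y) * phi y) (U y) (a2 y.1) (b y.2) (a y.1) (b2 y.2).
  by clear => *; ring.
pose Box : set plane := `[A0, A1] `*` `[B0, B1].
have mBox : measurable Box by apply: measurableX; exact: measurable_itv.
have -> : \int[area]_(y in fdom l) (U y * laplacian phi y + expR (U y) * phi y) =
    \int[area]_(y in Box) (F1 y + F2 y + F3 y).
  rewrite [LHS]Rintegral_mkcond [RHS]Rintegral_mkcond.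
  congr (fine (integral _ _ _)); apply/funext => y; congr EFin; rewrite !patchE HE.
  case: ifPn; case: ifPn => //.
  - move=> nx; rewrite inE => -[/= h1 h2]; move: h2; rewrite in_itv/= => h2.
    have [ya|ya] := boolP (A0 <= y.1 <= A1); last first.
      have [e1 _ e3] := exp_inv_comp_flat sza (za_out _ ya).
      by rewrite /F1 /F2 /F3 /phi /a2 -/a e3 /a e1 !(mulr0, mul0r) !addr0.
    have [yb|yb] := boolP (B0 <= y.2 <= B1); last first.
      have [e1 _ e3] := exp_inv_comp_flat szb (zb_out _ h2 yb).
      by rewrite /F1 /F2 /F3 /phi /b2 -/b e3 /b e1 !(mulr0, mul0r) !addr0.
    by move/negP: nx => []; rewrite inE; split; rewrite /= in_itv/=.
  - rewrite inE => -[/=]; rewrite !in_itv/= => h1 h2; rewrite notin_setE => -[].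
    have [/andP[s1 s2] _ _] := inbox y h1 h2.
    split; rewrite /= in_itv/= ?s1 ?s2//.
    by move: h2; rewrite /B0 /B1 => /andP[]; clear -r2 r3; lra.
have [iF1 _ E1] := Fubini_box cF1.
have [iF2 E2 _] := Fubini_box cF2.
have [iF3 _ _] := Fubini_box cF3.
pose G1 (y : R * R) := dt (dt U) y * a y.1 * b y.2.
pose G2 (y : R * R) := dtheta (dtheta U) y * b y.2 * a y.1.
have cG1 y : A0 <= y.1 <= A1 -> B0 <= y.2 <= B1 -> {for y, continuous G1}.
  move=> h1 h2; have [[_ c11 _ _] _] := CU' y h1 h2.
  rewrite /G1; continuity.
  - exact: c11.
  - exact: continuous_fst_at (ca _).
  - exact: continuous_snd_at (cb _).
have cG2 y : A0 <= y.1 <= A1 -> B0 <= y.2 <= B1 -> {for y, continuous G2}.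
  move=> h1 h2; have [[_ _ _ c22] _] := CU' y h1 h2.
  rewrite /G2; continuity.
  - exact: c22.
  - exact: continuous_snd_at (cb _).
  - exact: continuous_fst_at (ca _).
have [iG1 _ EG1] := Fubini_box cG1.
have [iG2 EG2 _] := Fubini_box cG2.
have EQ1 : \int[area]_(y in Box) F1 y = \int[area]_(y in Box) G1 y.
  apply: (etrans E1); apply: esym; apply: (etrans EG1).
  apply: int1_eq => s sb0; rewrite /F1 /G1 /=.
  under [in LHS]eq_fun do rewrite mulrC; under [in RHS]eq_fun do rewrite mulrC.
  have cs (f : R * R -> R) y : {for (y, s), continuous f} -> {for y, continuous (fun y => f (y, s))}.
    exact: continuous_section1.
  rewrite [LHS]int1Z; last first.
    move=> y ya; have [[_ c11 _ _] _] := CU' (y, s) ya sb0.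
    by continuity; [exact: cs|exact: ca].
  rewrite [RHS]int1Z; last first.
    move=> y ya; have [_ [c00 _ _ _ _]] := CU' (y, s) ya sb0.
    by continuity; [exact: cs|exact: ca2].
  congr (_ * _); apply: esym.
  apply: (@Green_segment _ A0 A1 (fun y => U (y, s)) (fun y => dt U (y, s)) (fun y => dt (dt U) (y, s)) a (derive1 a) a2).
  - exact: ab0.
  - move=> y ya; have [_ [_ d1 d2 _ _]] := CU' (y, s) ya sb0.
    split; [exact: d1|exact: d2| |]; apply: smooth_is_derive => //.
    exact: smooth_derive1.
  - by move=> y ya; have [[_ c11 _ _] _] := CU' (y, s) ya sb0; exact: cs.
  - by move=> y _; exact: ca2.
  - have [e1 e2 _] := exp_inv_comp_flat sza (za_end _ (or_introl (erefl A0))).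
    have [e3 e4 _] := exp_inv_comp_flat sza (za_end _ (or_intror (erefl A1))).
    by rewrite -/a in e2 e4; rewrite e2 e4 /a e1 e3 !mulr0.
have EQ2 : \int[area]_(y in Box) F2 y = \int[area]_(y in Box) G2 y.
  apply: (etrans E2); apply: esym; apply: (etrans EG2).
  apply: int1_eq => s sb0; rewrite /F2 /G2 /=.
  under [in LHS]eq_fun do rewrite mulrC; under [in RHS]eq_fun do rewrite mulrC.
  have cs (f : R * R -> R) y : {for (s, y), continuous f} -> {for y, continuous (fun y => f (s, y))}.
    exact: continuous_section2.
  rewrite [LHS]int1Z; last first.
    move=> y ya; have [[_ _ _ c22] _] := CU' (s, y) sb0 ya.
    by continuity; [exact: cs|exact: cb].
  rewrite [RHS]int1Z; last first.
    move=> y ya; have [_ [c00 _ _ _ _]] := CU' (s, y) sb0 ya.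
    by continuity; [exact: cs|exact: cb2].
  congr (_ * _); apply: esym.
  apply: (@Green_segment _ B0 B1 (fun y => U (s, y)) (fun y => dtheta U (s, y)) (fun y => dtheta (dtheta U) (s, y)) b (derive1 b) b2).
  - exact: bb0.
  - move=> y ya; have [_ [_ _ _ d1 d2]] := CU' (s, y) sb0 ya.
    split; [exact: d1|exact: d2| |]; apply: smooth_is_derive => //.
    exact: smooth_derive1.
  - by move=> y ya; have [[_ _ _ c22] _] := CU' (s, y) sb0 ya; exact: cs.
  - by move=> y _; exact: cb2.
  - have [e1 e2 _] := exp_inv_comp_flat szb (zb_end _ (or_introl (erefl B0))).
    have [e3 e4 _] := exp_inv_comp_flat szb (zb_end _ (or_intror (erefl B1))).
    by rewrite -/b in e2 e4; rewrite e2 e4 /b e1 e3 !mulr0.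
have iF12 : area.-integrable Box (EFin \o (fun y => F1 y + F2 y)).
  by have [] := @Fubini_box _ A0 A1 B0 B1 (fun y => F1 y + F2 y) (fun y h1 h2 => continuous_atD (cF1 y h1 h2) (cF2 y h1 h2)).
have iG12 : area.-integrable Box (EFin \o (fun y => G1 y + G2 y)).
  by have [] := @Fubini_box _ A0 A1 B0 B1 (fun y => G1 y + G2 y) (fun y h1 h2 => continuous_atD (cG1 y h1 h2) (cG2 y h1 h2)).
have S1 : \int[area]_(y in Box) (F1 y + F2 y + F3 y) =
    \int[area]_(y in Box) F1 y + \int[area]_(y in Box) F2 y + \int[area]_(y in Box) F3 y.
  apply: (etrans (@RintegralD _ _ _ area Box (fun y => F1 y + F2 y) F3 mBox iF12 iF3)).
  by congr (_ + _); exact: (@RintegralD _ _ _ area Box F1 F2 mBox iF1 iF2).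
have S2 : \int[area]_(y in Box) (G1 y + G2 y + F3 y) =
    \int[area]_(y in Box) G1 y + \int[area]_(y in Box) G2 y + \int[area]_(y in Box) F3 y.
  apply: (etrans (@RintegralD _ _ _ area Box (fun y => G1 y + G2 y) F3 mBox iG12 iF3)).
  by congr (_ + _); exact: (@RintegralD _ _ _ area Box G1 G2 mBox iG1 iG2).
have cG y : A0 <= y.1 <= A1 -> B0 <= y.2 <= B1 -> {for y, continuous (fun y => G1 y + G2 y + F3 y)}.
  by move=> h1 h2; continuity; [exact: cG1|exact: cG2|exact: cF3].
have [iG _ _] := Fubini_box cG.
have cP y : A0 <= y.1 <= A1 -> B0 <= y.2 <= B1 -> {for y, continuous (fun y => (- c) * phi y)}.
  by move=> h1 h2; continuity; exact: cphi.
have [iP EP _] := Fubini_box cP.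
have le0 : \int[area]_(y in Box) (G1 y + G2 y + F3 y) <= \int[area]_(y in Box) ((- c) * phi y).
  apply: (@le_Rintegral _ _ _ area Box (fun y => G1 y + G2 y + F3 y) (fun y => (- c) * phi y) mBox iG iP).
  move=> y [/=]; rewrite !in_itv/= => h1 h2.
  have [_ _ gy] := inbox y h1 h2.
  have -> : G1 y + G2 y + F3 y = g y * phi y.
    rewrite /G1 /G2 /F3 /phi /g /laplacian.
    move: (a y.1) (b y.2) (dt (dt U) y) (dtheta (dtheta U) y) (expR (U y)).
    by clear => *; ring.
  by rewrite ler_wpM2r ?(ltW gy)// mulr_ge0// exp_inv_ge0.
rewrite S1 EQ1 EQ2 -S2 => h0; rewrite h0 in le0.
have PE : int1 A0 A1 (fun s => int1 B0 B1 (fun y => - c * phi (s, y))) =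
    - c * int1 B0 B1 b * int1 A0 A1 a.
  rewrite -int1Z; last by move=> s _; exact: ca.
  apply: int1_eq => s _; rewrite -mulrA [int1 B0 B1 b * _]mulrC.
  rewrite -int1Z; last by move=> y _; exact: cb.
  rewrite -int1Z; first by [].
  by move=> y _; continuity; exact: cb.
have {}le0 : 0 <= - c * int1 B0 B1 b * int1 A0 A1 a.
  by apply: (le_trans le0); rewrite -PE; rewrite le_eqVlt; apply/orP; left; apply/eqP.
move: le0; apply/negP; rewrite -ltNge.
have ga : 0 < int1 A0 A1 a.
  apply: (@int1_gt0 _ A0 A1 x.1) => //.
  - by rewrite /A0 /A1; clear -r0; lra.
  - by move=> s _; exact: exp_inv_ge0.
  - by apply: exp_inv_gt0; rewrite /za subrr mul0r subr0 exprn_gt0.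
have gb : 0 < int1 B0 B1 b.
  apply: (@int1_gt0 _ B0 B1 x.2) => //.
  - by rewrite /B0 /B1; clear -r0; lra.
  - by move=> s _; exact: exp_inv_ge0.
  - apply: exp_inv_gt0; rewrite /zb subrr subr_gt0 ltr_cos ?in_itv/= ?lexx ?pi_ge0 ?(ltW r0) ?(ltW rpi)//.
rewrite !mulNr oppr_lt0; apply: mulr_gt0; last exact: ga.
by apply: mulr_gt0; [exact: c0|exact: gb].
Unshelve. all: by end_near. Qed.

End Pointwise.

(** * Cutting the density off at the singular points *)

Section Spline.
Context {R : realType}.
Implicit Types (x : R).

Definition pos_pow (n : nat) x : R := if 0 < x then x ^+ n else 0.

Lemma is_derive_pos_pow n x :
  is_derive x 1 (pos_pow n.+2) (n.+2%:R * pos_pow n.+1 x).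
Proof.
have [x0|x0|<-] := ltgtP 0 x.
- apply: (@near_eq_is_derive _ _ _ (fun y : R => y ^+ n.+2) (pos_pow n.+2)).
    by near=> y; rewrite /pos_pow ifT//; near: y; exact: lt_nbhsr.
  have ? := is_derive1_id x; rewrite /pos_pow x0.
  by derivation; rewrite /= mulr1 mulr_natl.
- rewrite /pos_pow ltNge (ltW x0) mulr0.
  apply: (@near_eq_is_derive _ _ _ (fun=> 0 : R) (pos_pow n.+2)).
  by near=> y; rewrite /pos_pow ltNge ltW//; near: y; exact: lt_nbhsl.
- have pp0 k : pos_pow k 0 = 0 by rewrite /pos_pow ltxx.
  rewrite pp0 mulr0.
  have H : h^-1 *: ((pos_pow n.+2 \o shift 0) (h *: (1 : R)) - pos_pow n.+2 0) @[h --> 0^'] --> (0 : R).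
    apply/cvgr0Pnorm_le => e e0.
    near=> h; rewrite /= addr0 pp0 subr0.
    rewrite (_ : h *: 1 = h); last by rewrite /GRing.scale/= mulr1.
    rewrite /pos_pow; case: ifP => [h0|_]; last by rewrite scaler0 normr0 ltW.
    have hn := lt0r_neq0 h0.
    rewrite /GRing.scale/= exprS mulKf// ger0_norm ?exprn_ge0 ?(ltW h0)//.
    have h1 : h <= 1.
      apply: (le_trans (ler_norm _)); near: h; apply: dnbhs0_le; exact: ltr01.
    apply: (@le_trans _ _ h).
      by rewrite exprS ler_piMr ?(ltW h0)// exprn_ile1 ?(ltW h0).
    apply: (le_trans (ler_norm _)); near: h; exact: dnbhs0_le.
  constructor; first by apply/cvg_ex; exists 0.
  exact: cvg_lim.
Unshelve. all: by end_near. Qed.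

Lemma continuous_pos_pow n x : {for x, continuous (pos_pow n.+1)}.
Proof.
case: n => [|n]; last exact: is_derive_continuous (is_derive_pos_pow n x).
rewrite (_ : pos_pow 1 = fun x => (x + `|x|) / 2).
  by continuity; exact: cvg_id.
apply/funext => y; rewrite /pos_pow; case: ltP => y0.
  by rewrite gtr0_norm//; field.
by rewrite ler0_norm// subrr mul0r.
Qed.

(* Being convex with slope at most one, the spline cuts the logarithm of the
   density off at the singularities without destroying the inequality
   [Delta v + e^v >= 0]. *)
Definition spline x : R := 1 / 2 + pos_pow 3 x - pos_pow 4 x / 2
  + pos_pow 3 (x - 1) + pos_pow 4 (x - 1) / 2.

Definition spline1 x : R := 3 * pos_pow 2 x - 2 * pos_pow 3 x
  + 3 * pos_pow 2 (x - 1) + 2 * pos_pow 3 (x - 1).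

(** This is [6 x (1 - x)] on [[0, 1]] and zero outside, of integral one: the slope rises from 0 to
    1. The increment of the spline over [[0, 1]] is [1 / 2], so starting from the value [1 / 2] it
    joins the identity at 1. *)
Definition spline2 x : R := 6 * pos_pow 1 x - 6 * pos_pow 2 x
  + 6 * pos_pow 1 (x - 1) + 6 * pos_pow 2 (x - 1).

Lemma is_derive_pos_pow_shift n x :
  is_derive x 1 (fun x => pos_pow n.+2 (x - 1)) (n.+2%:R * pos_pow n.+1 (x - 1)).
Proof.
have h : is_derive x 1 (fun x : R => x - 1) 1 by derivation; rewrite subr0.
by apply: (is_derive_eq (is_derive1_comp2 h (is_derive_pos_pow n (x - 1)))); rewrite mulr1.
Qed.

Lemma is_derive_spline x : is_derive x 1 spline (spline1 x).
Proof.
have h1 := is_derive_pos_pow 1 x; have h2 := is_derive_pos_pow 2 x.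
have h3 := is_derive_pos_pow_shift 1 x; have h4 := is_derive_pos_pow_shift 2 x.
apply: (is_derive_eq (is_derive1D (is_derive1D (is_derive1B (is_derive1D (is_derive1_cst x (1 / 2)) h1) (is_derive1M h2 (is_derive1_cst x 2^-1))) h3) (is_derive1M h4 (is_derive1_cst x 2^-1)))).
by rewrite /spline1; field.
Qed.

Lemma is_derive_spline1 x : is_derive x 1 spline1 (spline2 x).
Proof.
have h1 := is_derive_pos_pow 0 x; have h2 := is_derive_pos_pow 1 x.
have h3 := is_derive_pos_pow_shift 0 x; have h4 := is_derive_pos_pow_shift 1 x.
apply: (is_derive_eq (is_derive1D (is_derive1D (is_derive1B (is_derive1M (is_derive1_cst x 3) h1) (is_derive1M (is_derive1_cst x 2) h2)) (is_derive1M (is_derive1_cst x 3) h3)) (is_derive1M (is_derive1_cst x 2) h4))).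
by rewrite /spline2; ring.
Qed.

Lemma continuous_spline2 x : {for x, continuous spline2}.
Proof.
have s (k : nat) : {for x, continuous (fun x => pos_pow k.+1 (x - 1))}.
  apply: (@continuous_at_comp _ _ (fun x : R => x - 1) (pos_pow k.+1)).
    by continuity; exact: cvg_id.
  exact: continuous_pos_pow.
by rewrite /spline2; continuity; first [exact: s|exact: continuous_pos_pow].
Qed.

Lemma spline_le0 x : x <= 0 -> [/\ spline x = 1 / 2, spline1 x = 0 & spline2 x = 0].
Proof.
move=> x0; rewrite /spline /spline1 /spline2 /pos_pow !ltNge x0 subr_le0.
by rewrite (le_trans x0 ler01)/= !mulr0 mul0r !(addr0, subr0).
Qed.

Lemma spline_ge1 x : 1 <= x -> spline x = x.
Proof.
move=> x1; rewrite /spline /pos_pow (lt_le_trans ltr01 x1) subr_gt0.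
have [h|h|<-] := ltgtP 1 x; last by field.
  by field.
by rewrite leNgt h in x1.
Qed.

Lemma spline_mid x : 0 < x -> x <= 1 ->
  [/\ spline x = 1 / 2 + x ^+ 3 - x ^+ 4 / 2, spline1 x = 3 * x ^+ 2 - 2 * x ^+ 3 &
     spline2 x = 6 * x - 6 * x ^+ 2].
Proof.
move=> x0 x1; rewrite /spline /spline1 /spline2 /pos_pow x0 subr_gt0 ltNge x1/=.
by rewrite !mulr0 mul0r !addr0 expr1.
Qed.

Lemma spline_gt1 x : 1 < x -> spline1 x = 1 /\ spline2 x = 0.
Proof.
move=> x1; rewrite /spline1 /spline2 /pos_pow (lt_trans ltr01 x1) subr_gt0 x1.
by split; ring.
Qed.

Lemma spline_bounds x : [/\ x <= spline x, 1 / 2 <= spline x, 0 <= spline1 x,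
  spline1 x <= 1 & 0 <= spline2 x].
Proof.
have [x0|x0] := leP x 0.
  by have [-> -> ->] := spline_le0 x0; split => //; clear -x0; lra.
have [x1|x1] := leP x 1.
  have [-> -> ->] := spline_mid x0 x1; split.
  - have -> : 1 / 2 + x ^+ 3 - x ^+ 4 / 2 = x + (1 - x) ^+ 3 * (1 + x) / 2 by field.
    rewrite lerDl divr_ge0// mulr_ge0 ?exprn_ge0 ?subr_ge0//.
    by rewrite addr_ge0// ltW.
  - have -> : 1 / 2 + x ^+ 3 - x ^+ 4 / 2 = 1 / 2 + x ^+ 3 * (2 - x) / 2 by field.
    rewrite lerDl divr_ge0// mulr_ge0 ?exprn_ge0 ?(ltW x0)//.
    by clear -x1; lra.
  - have -> : 3 * x ^+ 2 - 2 * x ^+ 3 = x ^+ 2 * (3 - 2 * x) by ring.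
    by rewrite mulr_ge0 ?sqr_ge0//; clear -x1; lra.
  - rewrite -subr_ge0.
    have -> : 1 - (3 * x ^+ 2 - 2 * x ^+ 3) = (1 - x) ^+ 2 * (1 + 2 * x) by ring.
    by rewrite mulr_ge0 ?sqr_ge0//; clear -x0; lra.
  - have -> : 6 * x - 6 * x ^+ 2 = 6 * (x * (1 - x)) by ring.
    by rewrite mulr_ge0// mulr_ge0 ?subr_ge0// ltW.
have [-> ->] := spline_gt1 x1; rewrite spline_ge1; last exact: ltW.
by split; clear -x1; lra.
Qed.

Lemma spline_le1 x : x <= 1 -> spline x <= 1.
Proof.
move=> x1; have [x0|x0] := leP x 0.
  by have [-> _ _] := spline_le0 x0; clear; lra.
have [-> _ _] := spline_mid x0 x1.
rewrite -subr_ge0.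
have -> : 1 - (1 / 2 + x ^+ 3 - x ^+ 4 / 2) = (1 - x) * (1 - x ^+ 3 + x + x ^+ 2) / 2 by field.
rewrite divr_ge0// mulr_ge0 ?subr_ge0//.
have : x ^+ 3 <= 1 by rewrite exprn_ile1// ltW.
have := sqr_ge0 x; clear -x0; lra.
Qed.

End Spline.

(** * A logarithmic barrier at the singular points *)

Section LogSingFun.
Context {R : realType}.
Implicit Types (p x : R * R) (C : R).

Definition log_sing C p x : R := ln (sing_fun p x / C).
Definition log_sing_t p x : R := (x.1 - p.1) / sing_fun p x.
Definition log_sing_tt p x : R :=
  (sing_fun p x)^-1 - (x.1 - p.1) ^+ 2 / sing_fun p x ^+ 2.
Definition log_sing_y p x : R := sin (x.2 - p.2) / sing_fun p x.
Definition log_sing_yy p x : R :=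
  cos (x.2 - p.2) / sing_fun p x - sin (x.2 - p.2) ^+ 2 / sing_fun p x ^+ 2.

Lemma is_derive_sing_fun p x :
  is_derive x.1 1 (fun s => sing_fun p (s, x.2)) (x.1 - p.1) /\
  is_derive x.2 1 (fun s => sing_fun p (x.1, s)) (sin (x.2 - p.2)).
Proof. by rewrite /sing_fun /=; split; derivation; field. Qed.

Lemma is_derive_log_sing C p x : 0 < C -> 0 < sing_fun p x ->
  [/\ is_derive x.1 1 (fun s => log_sing C p (s, x.2)) (log_sing_t p x),
      is_derive x.1 1 (fun s => log_sing_t p (s, x.2)) (log_sing_tt p x),
      is_derive x.2 1 (fun s => log_sing C p (x.1, s)) (log_sing_y p x) &
      is_derive x.2 1 (fun s => log_sing_y p (x.1, s)) (log_sing_yy p x)].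
Proof.
move=> C0 N0; have [d1 d2] := is_derive_sing_fun p x.
have N0' : sing_fun p (x.1, x.2) != 0 by case: x N0 {d1 d2} => ? ? /= /lt0r_neq0.
have NE : sing_fun p x = sing_fun p (x.1, x.2) by case: x {N0 d1 d2 N0'}.
have NC : 0 < sing_fun p (x.1, x.2) * C^-1 by rewrite -NE divr_gt0.
have Cn := lt0r_neq0 C0.
rewrite /log_sing /log_sing_t /log_sing_tt /log_sing_y /log_sing_yy /= NE; split.
- by derivation => //; field; rewrite N0' Cn.
- by derivation => //; field.
- by derivation => //; field; rewrite N0' Cn.
- by derivation => //; field.
Qed.

Lemma continuous_log_sing C p x : 0 < C -> 0 < sing_fun p x ->
  [/\ {for x, continuous (log_sing C p)}, {for x, continuous (log_sing_t p)},
    {for x, continuous (log_sing_tt p)}, {for x, continuous (log_sing_y p)} &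
    {for x, continuous (log_sing_yy p)}].
Proof.
move=> C0 N0; have cN := @continuous_sing_fun _ p x; have Nn := lt0r_neq0 N0.
have c1 : {for x, continuous (fun x : R * R => x.1)} by exact: cvg_fst.
have cs : {for x, continuous (fun x : R * R => sin (x.2 - p.2))}.
  apply: (@continuous_snd_at _ (fun s => sin (s - p.2))).
  have : is_derive x.2 1 (fun s => sin (s - p.2)) (cos (x.2 - p.2)).
    by derivation; ring.
  exact: is_derive_continuous.
have cc : {for x, continuous (fun x : R * R => cos (x.2 - p.2))}.
  apply: (@continuous_snd_at _ (fun s => cos (s - p.2))).
  have : is_derive x.2 1 (fun s => cos (s - p.2)) (- sin (x.2 - p.2)).
    by derivation; ring.
  exact: is_derive_continuous.
have N2 : sing_fun p x ^+ 2 != 0 by rewrite expf_neq0.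
split; rewrite /log_sing /log_sing_t /log_sing_tt /log_sing_y /log_sing_yy.
- have h1 : {for x, continuous (fun x => sing_fun p x / C)} by continuity.
  have h2 : {for sing_fun p x / C, continuous (@ln R)}.
    by apply: continuous_ln; rewrite divr_gt0.
  exact: continuous_at_comp h1 h2.
- by continuity.
- by continuity.
- by continuity.
- by continuity.
Qed.

(** The logarithm of [cosh w - cos y] would be harmonic away from its poles; the quadratic
    [w ^ 2 / 2] in place of [cosh w - 1] costs at most one. The difference is a sum of nonnegative
    terms over [sing_fun p x ^+ 2]. *)
Lemma log_sing_laplacian_ge p x : 0 < sing_fun p x ->
  -1 <= log_sing_tt p x + log_sing_yy p x.
Proof.
move=> N0; have Nn := lt0r_neq0 N0; rewrite -subr_ge0.
set c := cos (x.2 - p.2); set s := sin (x.2 - p.2); set w := x.1 - p.1.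
have NE : sing_fun p x = 1 - c + w ^+ 2 / 2 by [].
have cs : s ^+ 2 = 1 - c ^+ 2 by rewrite sin2cos2.
have -> : log_sing_tt p x + log_sing_yy p x - -1 =
    (sing_fun p x ^+ 2 + (1 + c) * sing_fun p x - w ^+ 2 - s ^+ 2) / sing_fun p x ^+ 2.
  by rewrite /log_sing_tt /log_sing_yy -/c -/s -/w; field.
rewrite divr_ge0 ?sqr_ge0// cs NE.
have -> : (1 - c + w ^+ 2 / 2) ^+ 2 + (1 + c) * (1 - c + w ^+ 2 / 2) - w ^+ 2 - (1 - c ^+ 2) =
  (1 - c - w ^+ 2 / 2) ^+ 2 + 3 * (1 - c) * (w ^+ 2 / 2) by field.
rewrite addr_ge0 ?sqr_ge0// mulr_ge0 ?divr_ge0 ?sqr_ge0//.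
by rewrite mulr_ge0// subr_ge0 cos_le1.
Qed.

End LogSingFun.

Section Near.
Context {R : realType}.
Implicit Types (x : R * R).

Lemma near_section1 x (P : R * R -> Prop) : (\forall y \near x, P y) ->
  \forall s \near x.1, P (s, x.2).
Proof.
move=> /near_box[e e0 he]; apply/nbhs_ballP; exists e => //= s.
by rewrite /ball/= distrC => h; apply: he => //=; rewrite subrr normr0.
Qed.

Lemma near_section2 x (P : R * R -> Prop) : (\forall y \near x, P y) ->
  \forall s \near x.2, P (x.1, s).
Proof.
move=> /near_box[e e0 he]; apply/nbhs_ballP; exists e => //= s.
by rewrite /ball/= distrC => h; apply: he => //=; rewrite subrr normr0.
Qed.

Lemma continuous_near_eq (F G : R * R -> R) x : (\forall y \near x, F y = G y) ->
  {for x, continuous G} -> {for x, continuous F}.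
Proof.
move=> GF cG; have FG : \forall y \near x, G y = F y by apply: filterS GF.
 rewrite /prop_for /continuous_at -(nbhs_singleton FG).
exact: cvg_trans (near_eq_cvg FG) cG.
Qed.

Lemma continuous_at_sum (m : nat) (F : 'I_m -> R * R -> R) x :
  (forall j, {for x, continuous (F j)}) ->
  {for x, continuous (fun y => \sum_(j < m) F j y)}.
Proof.
elim: m F => [|m ih] F cF.
  rewrite (_ : (fun y => _) = fun=> 0); first exact: continuous_at_cst.
  by apply/funext => y; rewrite big_ord0.
rewrite (_ : (fun y => _) = fun y => F ord0 y + \sum_(j < m) F (lift ord0 j) y).
  by apply: continuous_atD => //; apply: ih.
by apply/funext => y; rewrite big_ord_recl.
Qed.

Lemma is_derive1_sum (m : nat) (f : 'I_m -> R -> R) (d : 'I_m -> R) (t : R) :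
  (forall j, is_derive t 1 (f j) (d j)) ->
  is_derive t 1 (fun s => \sum_(j < m) f j s) (\sum_(j < m) d j).
Proof.
elim: m f d => [|m ih] f d fd.
  rewrite (_ : (fun y => _) = fun=> 0); last first.
    by apply/funext => y; rewrite big_ord0.
  by rewrite big_ord0; exact: is_derive1_cst.
rewrite (_ : (fun y => _) = fun y => f ord0 y + \sum_(j < m) f (lift ord0 j) y).
  rewrite big_ord_recl.
  exact: (is_derive1D (fd ord0) (ih _ _ (fun j => fd (lift ord0 j)))).
by apply/funext => y; rewrite big_ord_recl.
Qed.

End Near.

(** * Truncation of the logarithm of the density *)

Section Cutoff.
Context {R : realType}.
Variables (ns : R * R -> Prop) (v vt vtt vy vyy : R * R -> R) (K l : R).
Implicit Types (x : R * R).

(** At a singular point any value [<= 0] would do, since the spline is constant on the negative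
    half-line. *)
Definition cut_arg x : R := if `[< ns x >] then v x + K else 0.
Definition cut x : R := expR (spline (cut_arg x) - K).
Definition cut_t x : R := cut x * (spline1 (cut_arg x) * vt x).
Definition cut_tt x : R := cut x * ((spline1 (cut_arg x) * vt x) ^+ 2
  + (spline2 (cut_arg x) * vt x ^+ 2 + spline1 (cut_arg x) * vtt x)).
Definition cut_y x : R := cut x * (spline1 (cut_arg x) * vy x).
Definition cut_yy x : R := cut x * ((spline1 (cut_arg x) * vy x) ^+ 2
  + (spline2 (cut_arg x) * vy x ^+ 2 + spline1 (cut_arg x) * vyy x)).

Hypothesis ns_near : forall x, 0 < x.1 < l -> ns x -> \forall y \near x, ns y.
Hypothesis v_C2 : forall x, 0 < x.1 < l -> ns x ->
  [/\ {for x, continuous vt}, {for x, continuous vtt},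
      {for x, continuous vy} & {for x, continuous vyy}] /\
  [/\ {for x, continuous v},
      is_derive x.1 1 (fun s => v (s, x.2)) (vt x),
      is_derive x.1 1 (fun s => vt (s, x.2)) (vtt x),
      is_derive x.2 1 (fun s => v (x.1, s)) (vy x) &
      is_derive x.2 1 (fun s => vy (x.1, s)) (vyy x)].
Hypothesis v_sing : forall x, 0 < x.1 < l -> ~ ns x ->
  \forall y \near x, ns y -> v y + K <= 0.

Lemma cut_arg_ns x : ns x -> cut_arg x = v x + K.
Proof. by move=> h; rewrite /cut_arg asboolT. Qed.

Lemma cut_arg_sing x : 0 < x.1 < l -> ~ ns x ->
  \forall y \near x, cut_arg y <= 0.
Proof.
move=> xl nx; apply: filterS (v_sing xl nx) => y h.
by rewrite /cut_arg; case: asboolP.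
Qed.

Lemma near_cut_sing x : 0 < x.1 < l -> ~ ns x ->
  \forall y \near x, [/\ cut y = expR (1 / 2 - K), cut_t y = 0, cut_tt y = 0,
    cut_y y = 0 & cut_yy y = 0].
Proof.
move=> xl nx; apply: filterS (cut_arg_sing xl nx) => y h.
rewrite /cut_t /cut_tt /cut_y /cut_yy /cut.
have [-> -> ->] := spline_le0 h.
by rewrite !mul0r expr0n/= !addr0 !mulr0.
Qed.

Lemma continuous_cut_arg x : 0 < x.1 < l -> ns x ->
  {for x, continuous cut_arg}.
Proof.
move=> xl nx; have [_ [cv _ _ _ _]] := v_C2 xl nx.
apply: (@continuous_near_eq _ _ (fun y => v y + K)).
  by apply: filterS (ns_near xl nx) => y /cut_arg_ns.
by continuity; exact: cv.
Qed.

(** Near a nonsingular point this is the chain rule; near a singular one [cut_arg <= 0], so that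
    [cut] is locally constant. *)
Lemma cutoff_C2 : C2_data 0 l cut cut_t cut_tt cut_y cut_yy.
Proof.
have csp (f : R -> R) x : (forall z, {for z, continuous f}) -> 0 < x.1 < l -> ns x ->
    {for x, continuous (fun x => f (cut_arg x))}.
  by move=> cf xl nx; exact: continuous_at_comp (continuous_cut_arg xl nx) (cf _).
have cs0 (z : R) : {for z, continuous spline} by exact: is_derive_continuous (is_derive_spline z).
have cs1 (z : R) : {for z, continuous spline1} by exact: is_derive_continuous (is_derive_spline1 z).
have ccut x : 0 < x.1 < l -> ns x -> {for x, continuous cut}.
  by move=> xl nx; rewrite /cut; continuity; exact: (csp spline).
have sing (F : R * R -> R) (c : R) x : (\forall y \near x, F y = c) -> {for x, continuous F}.
  move=> h; apply: (@continuous_near_eq _ _ (fun=> c)); last exact: continuous_at_cst.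
  exact: h.
split; split.
- move=> x xl; have [nx|nx] := pselect (ns x).
    have [[c1 _ _ _] _] := v_C2 xl nx.
    by rewrite /cut_t; continuity; [exact: ccut|exact: (csp spline1)|exact: c1].
  by apply: (sing _ 0); apply: filterS (near_cut_sing xl nx) => y [].
- move=> x xl; have [nx|nx] := pselect (ns x).
    have [[c1 c2 _ _] _] := v_C2 xl nx.
    rewrite /cut_tt; continuity; [exact: ccut|exact: (csp spline1)|exact: c1| |exact: c1|exact: (csp spline1)|exact: c2].
    exact: (csp spline2 _ (@continuous_spline2 R)).
  by apply: (sing _ 0); apply: filterS (near_cut_sing xl nx) => y [].
- move=> x xl; have [nx|nx] := pselect (ns x).
    have [[_ _ c1 _] _] := v_C2 xl nx.
    by rewrite /cut_y; continuity; [exact: ccut|exact: (csp spline1)|exact: c1].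
  by apply: (sing _ 0); apply: filterS (near_cut_sing xl nx) => y [].
- move=> x xl; have [nx|nx] := pselect (ns x).
    have [[_ _ c1 c2] _] := v_C2 xl nx.
    rewrite /cut_yy; continuity; [exact: ccut|exact: (csp spline1)|exact: c1| |exact: c1|exact: (csp spline1)|exact: c2].
    exact: (csp spline2 _ (@continuous_spline2 R)).
  by apply: (sing _ 0); apply: filterS (near_cut_sing xl nx) => y [].
- move=> x xl; have [nx|nx] := pselect (ns x); first exact: ccut.
  by apply: (sing _ (expR (1 / 2 - K))); apply: filterS (near_cut_sing xl nx) => y [].
- move=> x xl; have [nx|nx] := pselect (ns x).
    have [_ [_ d1 _ _ _]] := v_C2 xl nx.
    have nE := near_section1 (ns_near xl nx).
    apply: (@near_eq_is_derive _ _ _ (fun s => expR (spline (v (s, x.2) + K) - K))).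
      by apply: filterS nE => s h; rewrite /cut cut_arg_ns.
    rewrite /cut_t /cut (cut_arg_ns nx).
    have xE : v x = v (x.1, x.2) by case: x {xl nx d1 nE}.
    rewrite xE.
    have d2 : is_derive x.1 1 (fun s => v (s, x.2) + K) (vt x) by derivation; rewrite addr0.
    have d3 := is_derive1_comp2 d2 (is_derive_spline (v (x.1, x.2) + K)).
    by derivation; rewrite subr0.
  have h := near_section1 (near_cut_sing xl nx).
  have [_ -> _ _ _] := nbhs_singleton (near_cut_sing xl nx).
  apply: (@near_eq_is_derive _ _ _ (fun=> expR (1 / 2 - K) : R)).
  by apply: filterS h => s [->].
- move=> x xl; have [nx|nx] := pselect (ns x).
    have [_ [_ d1 d1' _ _]] := v_C2 xl nx.
    have nE := near_section1 (ns_near xl nx).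
    apply: (@near_eq_is_derive _ _ _ (fun s => expR (spline (v (s, x.2) + K) - K) * (spline1 (v (s, x.2) + K) * vt (s, x.2)))).
      by apply: filterS nE => s h; rewrite /cut_t /cut cut_arg_ns.
    rewrite /cut_tt /cut (cut_arg_ns nx).
    have xE : v x = v (x.1, x.2) by case: x {xl nx d1 d1' nE}.
    have xE' : vt x = vt (x.1, x.2) by case: x {xl nx d1 d1' nE xE}.
    rewrite xE.
    have d2 : is_derive x.1 1 (fun s => v (s, x.2) + K) (vt x) by derivation; rewrite addr0.
    have d3 := is_derive1_comp2 d2 (is_derive_spline (v (x.1, x.2) + K)).
    have d4 := is_derive1_comp2 d2 (is_derive_spline1 (v (x.1, x.2) + K)).
    by derivation; rewrite subr0 xE'; ring.
  have h := near_section1 (near_cut_sing xl nx).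
  have [_ _ -> _ _] := nbhs_singleton (near_cut_sing xl nx).
  apply: (@near_eq_is_derive _ _ _ (fun=> 0 : R)).
  by apply: filterS h => s [_ ->].
- move=> x xl; have [nx|nx] := pselect (ns x).
    have [_ [_ _ _ d1 _]] := v_C2 xl nx.
    have nE := near_section2 (ns_near xl nx).
    apply: (@near_eq_is_derive _ _ _ (fun s => expR (spline (v (x.1, s) + K) - K))).
      by apply: filterS nE => s h; rewrite /cut cut_arg_ns.
    rewrite /cut_y /cut (cut_arg_ns nx).
    have xE : v x = v (x.1, x.2) by case: x {xl nx d1 nE}.
    rewrite xE.
    have d2 : is_derive x.2 1 (fun s => v (x.1, s) + K) (vy x) by derivation; rewrite addr0.
    have d3 := is_derive1_comp2 d2 (is_derive_spline (v (x.1, x.2) + K)).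
    by derivation; rewrite subr0.
  have h := near_section2 (near_cut_sing xl nx).
  have [_ _ _ -> _] := nbhs_singleton (near_cut_sing xl nx).
  apply: (@near_eq_is_derive _ _ _ (fun=> expR (1 / 2 - K) : R)).
  by apply: filterS h => s [->].
- move=> x xl; have [nx|nx] := pselect (ns x).
    have [_ [_ _ _ d1 d1']] := v_C2 xl nx.
    have nE := near_section2 (ns_near xl nx).
    apply: (@near_eq_is_derive _ _ _ (fun s => expR (spline (v (x.1, s) + K) - K) * (spline1 (v (x.1, s) + K) * vy (x.1, s)))).
      by apply: filterS nE => s h; rewrite /cut_y /cut cut_arg_ns.
    rewrite /cut_yy /cut (cut_arg_ns nx).
    have xE : v x = v (x.1, x.2) by case: x {xl nx d1 d1' nE}.
    have xE' : vy x = vy (x.1, x.2) by case: x {xl nx d1 d1' nE xE}.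
    rewrite xE.
    have d2 : is_derive x.2 1 (fun s => v (x.1, s) + K) (vy x) by derivation; rewrite addr0.
    have d3 := is_derive1_comp2 d2 (is_derive_spline (v (x.1, x.2) + K)).
    have d4 := is_derive1_comp2 d2 (is_derive_spline1 (v (x.1, x.2) + K)).
    by derivation; rewrite subr0 xE'; ring.
  have h := near_section2 (near_cut_sing xl nx).
  have [_ _ _ _ ->] := nbhs_singleton (near_cut_sing xl nx).
  apply: (@near_eq_is_derive _ _ _ (fun=> 0 : R)).
  by apply: filterS h => s [_ _ _ ->].
Qed.

Lemma cut_gt0 x : 0 < cut x.
Proof. exact: expR_gt0. Qed.

Lemma cut_log_laplacian x :
  cut x * (cut_tt x + cut_yy x) - cut_t x ^+ 2 - cut_y x ^+ 2 =
  cut x ^+ 2 * (spline2 (cut_arg x) * (vt x ^+ 2 + vy x ^+ 2)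
    + spline1 (cut_arg x) * (vtt x + vyy x)).
Proof. by rewrite /cut_tt /cut_yy /cut_t /cut_y; ring. Qed.

End Cutoff.

Section LogBarrier.
Context {R : realType}.
Variables (l : R) (m : nat) (q : 'I_m -> R * R) (beta : 'I_m -> R).
Variable (U : R * R -> R).
Hypothesis l0 : 0 < l.
Hypothesis qP : forall j, closed_strip l (q j).
Hypothesis beta0 : forall j, 0 <= beta j.
Hypothesis HU : liouville l q beta U.
Implicit Types (x y : R * R) (d K : R).

Definition nonsing x := forall j, ~ same_point x (q j).

Lemma periodic_int (f : R * R -> R) x (k : int) : periodic2pi f ->
  f (x.1, x.2 + k%:~R * (2 * pi)) = f x.
Proof.
move=> pf; have nat_period (n : nat) y : f (y.1, y.2 + n%:R * (2 * pi)) = f y.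
  elim: n => [|n ih]; first by rewrite mul0r addr0; case: y.
  rewrite -[RHS]ih -[RHS]pf /=; congr (f (_, _)).
  by rewrite -natr1; ring.
case: k => n; first exact: nat_period.
rewrite NegzE mulrNz mulNr -[LHS](nat_period n.+1)/=.
by rewrite subrK; case: x.
Qed.

Lemma nonsing_periodic x : nonsing (x.1, x.2 + 2 * pi) <-> nonsing x.
Proof.
split => h j.
- move=> [x1 [k xk]]; apply: (h j); split => //; exists (k + 1).
  by rewrite /= xk intrD; ring.
- move=> [x1 [k xk]]; apply: (h j); split => //; exists (k - 1).
  have xk' : x.2 + 2 * pi = (q j).2 + k%:~R * (2 * pi) := xk.
  by rewrite -[LHS](addrK (2 * pi)) xk' intrB; ring.
Qed.

Lemma nonsing_near x : nonsing x -> \forall y \near x, nonsing y.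
Proof. exact: near_not_same_point. Qed.

Lemma sing_funP j x : nonsing x -> 0 < sing_fun (q j) x.
Proof. by move=> /(_ j)/sing_fun_gt0. Qed.

(** At the two angles 0 and [2 pi] bounding the fundamental domain, negativity would persist at
    nearby interior angles by continuity. *)
Lemma liouville_laplacian_closed_ge0 x : strip l x -> 0 <= x.2 <= 2 * pi ->
  nonsing x -> 0 <= laplacian U x + expR (U x).
Proof.
have p2 : 0 < 2 * pi :> R by rewrite mulr_gt0// pi_gt0.
move=> xl /andP[x0 x2] nx.
have [xE|xE] := boolP (0 < x.2 < 2 * pi); first exact: (liouville_laplacian_ge0 HU).
rewrite leNgt; apply/negP => gneg.
have CU : forall z, _ -> _ := classC2 (let: And5 _ _ p3 _ _ := HU in p3).
have cg : {for x, continuous (fun y => laplacian U y + expR (U y))}.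
  have [[_ c11 _ c22] [c00 _ _ _ _]] := CU x (conj xl nx).
  by apply: continuous_atD; [exact: continuous_atD c11 c22|exact: continuous_at_expR].
have [e e0 He] : exists2 e, 0 < e & forall y, `|y.1 - x.1| < e -> `|y.2 - x.2| < e ->
    [/\ strip l y, nonsing y & laplacian U y + expR (U y) < 0].
  apply: near_box; near=> y; split.
  - near: y; exact: near_strip.
  - near: y; exact: near_not_same_point.
  - by near: y; exact: (cvgr_lt _ cg).
have [s [s0 s2 se]] : exists s, [/\ 0 < s, s < 2 * pi & `|s - x.2| < e].
  have [h0|h0] := eqVneq x.2 0.
    exists (Num.min (e / 2) pi); rewrite h0 subr0; split.
    - by rewrite lt_min divr_gt0// pi_gt0.
    - by rewrite gt_min [X in _ || X](_ : _ = true) ?orbT//; have := pi_gt0 R; lra.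
    - rewrite gtr0_norm; last by rewrite lt_min divr_gt0// pi_gt0.
      by rewrite gt_min [X in X || _](_ : _ = true)//; lra.
  have x2E : x.2 = 2 * pi.
    move: xE; rewrite lt_neqAle eq_sym h0 x0/= -leNgt => h.
    by apply/eqP; rewrite eq_le x2.
  exists (2 * pi - Num.min (e / 2) pi); rewrite x2E.
  have h1 : 0 < Num.min (e / 2) pi by rewrite lt_min divr_gt0// pi_gt0.
  have h2 : Num.min (e / 2) pi <= pi by rewrite ge_min lexx orbT.
  have h3 : Num.min (e / 2) pi <= e / 2 by rewrite ge_min lexx.
  have := pi_gt0 R => h4.
  split; [by lra|by lra|].
  rewrite addrAC subrr add0r normrN gtr0_norm//; by lra.
have [yl yns yneg] := He (x.1, s) ltac:(by rewrite subrr normr0) se.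
have := liouville_laplacian_ge0 HU yl ltac:(by rewrite /= s0 s2) yns.
by rewrite leNgt yneg.
Unshelve. all: by end_near. Qed.

(** An upper bound for [sing_fun] on the cylinder, valid for poles on the boundary as well; dividing
    by it makes the logarithms nonpositive. *)
Definition barrier_const : R := 2 + l ^+ 2 / 2.
Local Notation C := barrier_const.

Lemma barrier_const_gt0 : 0 < C.
Proof. by rewrite /barrier_const ltr_wpDr// divr_ge0// sqr_ge0. Qed.

Lemma sing_fun_le j x : strip l x -> sing_fun (q j) x <= C.
Proof.
move=> /andP[x0 x1]; have /andP[q0 q1] := qP j.
rewrite /sing_fun /barrier_const lerD//.
  have := cos_geN1 (x.2 - (q j).2); lra.
rewrite ler_pM2r ?invr_gt0// -[leLHS]real_normK ?num_real//.
rewrite lerXn2r ?nnegrE ?(ltW l0)//.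
by rewrite ler_norml; apply/andP; split; lra.
Qed.

Lemma log_sing_le0 j x : strip l x -> nonsing x -> log_sing C (q j) x <= 0.
Proof.
move=> xl nx; rewrite /log_sing ln_le0// ler_pdivrMr ?barrier_const_gt0// mul1r.
exact: sing_fun_le.
Qed.

Definition barrier x : R := \sum_(j < m) log_sing C (q j) x.

Lemma barrier_le0 x : strip l x -> nonsing x -> barrier x <= 0.
Proof.
by move=> xl nx; apply: sumr_le0 => j _; exact: log_sing_le0.
Qed.

(** When [beta j = 0] the function [U] need not tend to minus infinity at [q j]. The barrier forces
    this for every [d > 0], lowers the density only, and costs at most [d * m] in the Laplacian. *)
Definition bar d x : R := U x + d * barrier x.
Definition bar_t d x : R := dt U x + d * \sum_(j < m) log_sing_t (q j) x.
Definition bar_tt d x : R := dt (dt U) x + d * \sum_(j < m) log_sing_tt (q j) x.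
Definition bar_y d x : R := dtheta U x + d * \sum_(j < m) log_sing_y (q j) x.
Definition bar_yy d x : R :=
  dtheta (dtheta U) x + d * \sum_(j < m) log_sing_yy (q j) x.

Lemma bar_C2 d x : 0 < x.1 < l -> nonsing x ->
  [/\ {for x, continuous (bar_t d)}, {for x, continuous (bar_tt d)},
      {for x, continuous (bar_y d)} & {for x, continuous (bar_yy d)}] /\
  [/\ {for x, continuous (bar d)},
      is_derive x.1 1 (fun s => bar d (s, x.2)) (bar_t d x),
      is_derive x.1 1 (fun s => bar_t d (s, x.2)) (bar_tt d x),
      is_derive x.2 1 (fun s => bar d (x.1, s)) (bar_y d x) &
      is_derive x.2 1 (fun s => bar_y d (x.1, s)) (bar_yy d x)].
Proof.
move=> xl nx.
have CU : forall z, _ -> _ := classC2 (let: And5 _ _ p3 _ _ := HU in p3).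
have [[c1 c2 c3 c4] [c0 d1 d2 d3 d4]] := CU x (conj xl nx).
have cl j := continuous_log_sing barrier_const_gt0 (sing_funP j nx).
have dl j := is_derive_log_sing barrier_const_gt0 (sing_funP j nx).
have cs (f : 'I_m -> R * R -> R) (g : R * R -> R) : {for x, continuous g} -> (forall j, {for x, continuous (f j)}) ->
    {for x, continuous (fun y => g y + d * \sum_(j < m) f j y)}.
  move=> cg cf; apply: continuous_atD => //; apply: continuous_atM.
    exact: continuous_at_cst.
  exact: continuous_at_sum.
have ds (t : R) (f : 'I_m -> R -> R) (f' : 'I_m -> R) (g : R -> R) (g' : R) :
    is_derive t 1 g g' -> (forall j, is_derive t 1 (f j) (f' j)) ->
    is_derive t 1 (fun s => g s + d * \sum_(j < m) f j s) (g' + d * \sum_(j < m) f' j).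
  move=> dg df; have h := is_derive1_sum df.
  by derivation; rewrite mul0r add0r.
split; split.
- by apply: cs => // j; have [] := cl j.
- by apply: cs => // j; have [] := cl j.
- by apply: cs => // j; have [] := cl j.
- by apply: cs => // j; have [] := cl j.
- by apply: cs => // j; have [] := cl j.
- by apply: (ds _ _ _ _ _ d1) => j; have [] := dl j.
- by apply: (ds _ _ _ _ _ d2) => j; have [] := dl j.
- by apply: (ds _ _ _ _ _ d3) => j; have [] := dl j.
- by apply: (ds _ _ _ _ _ d4) => j; have [] := dl j.
Qed.

Lemma bar_laplacian_ge d x : 0 <= d -> strip l x -> nonsing x ->
  0 <= x.2 <= 2 * pi ->
  - expR (U x) - d * m%:R <= bar_tt d x + bar_yy d x.
Proof.
move=> d0 xl nx x2.
have h1 := liouville_laplacian_closed_ge0 xl x2 nx.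
have h2 : - m%:R <= \sum_(j < m) log_sing_tt (q j) x + \sum_(j < m) log_sing_yy (q j) x.
  rewrite -big_split/= (_ : - m%:R = \sum_(j < m) (- 1)); last first.
    by rewrite sumr_const card_ord mulNrn.
  by apply: ler_sum => j _; exact: log_sing_laplacian_ge (sing_funP j nx).
have h3 := ler_wpM2l d0 h2.
rewrite /bar_tt /bar_yy; move: h1 h3; rewrite /laplacian.
move: (\sum_(j < m) log_sing_tt _ _) (\sum_(j < m) log_sing_yy _ _) => s1 s2.
by lra.
Qed.

(** This is where nonnegative weights matter: [beta j] times the logarithm of a distance at most one
    is nonpositive, so [U] exceeds the bounded remainder nowhere near [q j]. *)
Lemma U_upper_near_sing : exists M, forall x, strip l x -> ~ nonsing x ->
  \forall y \near x, nonsing y -> U y <= M.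
Proof.
have [U1 _ _ U4 _] := HU.
have [M HM] := choice U4.
exists (\sum_(j < m) `|M j|) => x xl nx.
have [j [x1 [k xk]]] : exists j, same_point x (q j).
  by apply: contrapT => h; apply: nx => j hj; apply: h; exists j.
have /nbhs_ballP[e /= e0 he] := HM j.
(* Coordinate differences below [1 / 2] keep the Euclidean distance below one, hence its logarithm
   nonpositive. *)
have : \forall y \near x, [/\ strip l y, `|y.1 - x.1| < Num.min e (1 / 2) & `|y.2 - x.2| < Num.min e (1 / 2)].
  have r0 : 0 < Num.min e (1 / 2) by rewrite lt_min e0/= divr_gt0.
  near=> y; split; near: y.
  - exact: near_strip.
  - apply/nbhs_ballP; exists (Num.min e (1 / 2)) => //= y [h _].
    by rewrite distrC.
  - apply/nbhs_ballP; exists (Num.min e (1 / 2)) => //= y [_ h].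
    by rewrite distrC.
apply: filterS => y [yl y1 y2] ny.
(* The logarithmic behaviour is prescribed at [q j] itself and not at its other lifts, so [y] is
   moved there by periods. *)
pose z : R * R := (y.1, y.2 + (- k)%:~R * (2 * pi)).
have zU : U z = U y by exact: periodic_int.
have zq2 : z.2 - (q j).2 = y.2 - x.2.
  by rewrite /z/= xk mulrNz mulNr; ring.
have zq1 : z.1 - (q j).1 = y.1 - x.1 by rewrite /z x1.
move: y1 y2; rewrite !lt_min => /andP[y1 y1'] /andP[y2 y2'].
have zn : z != q j.
  apply/eqP => zE; apply: (ny j); split; first by rewrite -zE.
  by exists k; rewrite -zE /z /= mulrNz mulNr subrK.
have : `|U z - beta j / (2 * pi) * ln (Defs.edist z (q j))| <= M j.
  by apply: (he z) => //; split; rewrite /ball/= distrC ?zq1 ?zq2.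
rewrite zU => /(le_trans (ler_norm _)) h.
have : beta j / (2 * pi) * ln (Defs.edist z (q j)) <= 0.
  rewrite mulr_ge0_le0// ?divr_ge0// ?mulr_ge0 ?pi_ge0//.
  apply: ln_le0; rewrite /Defs.edist zq1 zq2 -[leRHS]sqrtr1 ler_wsqrtr//.
  have a1 : (y.1 - x.1) ^+ 2 <= (1 / 2) ^+ 2.
    by rewrite -[leLHS]real_normK ?num_real// lerXn2r ?nnegrE ?divr_ge0// ltW.
  have a2 : (y.2 - x.2) ^+ 2 <= (1 / 2) ^+ 2.
    by rewrite -[leLHS]real_normK ?num_real// lerXn2r ?nnegrE ?divr_ge0// ltW.
  by lra.
have : M j <= \sum_(j < m) `|M j|.
  rewrite (bigD1 j)//= (le_trans (ler_norm _))// lerDl.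
  by apply: sumr_ge0.
by lra.
Unshelve. all: by end_near. Qed.

Lemma bar_sing d K x : 0 < d -> 0 < x.1 < l -> ~ nonsing x ->
  \forall y \near x, nonsing y -> bar d y + K <= 0.
Proof.
move=> d0 xl nx; have [M HM] := U_upper_near_sing.
have [j xj] : exists j, same_point x (q j).
  by apply: contrapT => h; apply: nx => j hj; apply: h; exists j.
have C0 := barrier_const_gt0.
(* Where [sing_fun < C * t], the barrier is at most [- (M + K) / d], and [d] times it outweighs
   [M + K]. *)
pose t := expR (- (M + K) / d).
have N0 : sing_fun (q j) x = 0 by apply/eqP/sing_fun_eq0.
have cN := @continuous_sing_fun _ (q j) x.
have Ct : sing_fun (q j) x < C * t by rewrite N0 mulr_gt0// expR_gt0.
have near1 := cvgr_lt _ cN _ Ct.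
have near2 := HM x xl nx; have near3 := near_strip xl.
near=> y => ny.
have yl : strip l y by near: y; exact: near3.
have h1 : U y <= M.
  suff : nonsing y -> U y <= M by exact.
  by near: y; exact: near2.
have h2 : sing_fun (q j) y < C * t by near: y; exact: near1.
have h3 : barrier y <= - (M + K) / d.
  rewrite /barrier (bigD1 j)//=.
  have : \sum_(i < m | i != j) log_sing C (q i) y <= 0.
    by apply: sumr_le0 => i _; exact: log_sing_le0.
  have : log_sing C (q j) y <= ln t.
    rewrite /log_sing ler_ln ?posrE ?expR_gt0 ?divr_gt0 ?(sing_funP j ny)//.
    by rewrite ler_pdivrMr// mulrC ltW.
  by rewrite /t expRK; lra.
have : d * barrier y <= - (M + K).
  by rewrite -(mulfVK (lt0r_neq0 d0) (- (M + K))) mulrC ler_wpM2r// ltW.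
by rewrite /bar; lra.
Unshelve. all: by end_near. Qed.

Lemma bar_periodic d x : bar d (x.1, x.2 + 2 * pi) = bar d x.
Proof.
have [U1 _ _ _ _] := HU; rewrite /bar U1; congr (_ + _ * _).
apply: eq_bigr => j _; rewrite /log_sing /sing_fun /=.
congr (ln ((1 - _ + _) / _)).
by rewrite addrAC mulr_natl cosD2pi.
Qed.

End LogBarrier.

(** * The mass lost in the truncation *)

Section Defect.
Context {R : realType}.
Local Notation mu := (@lebesgue_measure R).
Implicit Types (p : R * R) (C d y e : R).

(** An upper bound for the relative loss caused by one pole, obtained by dropping the square in
    [sing_fun]. It depends on the angle only, so its integral over a circle is small uniformly in
    [t]. *)
Definition defect C p d y : R := 1 - ((1 - cos (y - p.2)) / C) `^ d.

Lemma one_sub_cos_bounds C y : 2 <= C ->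
  0 <= (1 - cos y) / C /\ (1 - cos y) / C <= 1.
Proof.
move=> C2; have C0 : 0 < C by rewrite (lt_le_trans _ C2).
split; first by rewrite divr_ge0 ?(ltW C0)// subr_ge0 cos_le1.
rewrite ler_pdivrMr// mul1r; apply: le_trans C2.
by have := cos_geN1 y; lra.
Qed.

Lemma defect_bounds C p d y : 2 <= C -> 0 <= d -> 0 <= defect C p d y <= 1.
Proof.
move=> C2 d0; have [h1 h2] := one_sub_cos_bounds (y - p.2) C2.
rewrite /defect subr_ge0 lerBlDr lerDl powR_ge0 andbT.
rewrite -[leRHS](_ : 1 `^ d = 1); last by rewrite powR1.
by apply: ge0_ler_powR => //; rewrite nnegrE.
Qed.

Lemma measurable_defect C p d (A : set (measurableTypeR R)) : measurable A ->
  measurable_fun A (defect C p d).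
Proof.
move=> mA; apply: measurable_funTS.
apply: measurable_funB => //.
apply: (measurableT_comp (measurable_powR d)).
apply: continuous_measurable_fun => x.
have : is_derive x 1 (fun y => (1 - cos (y - p.2)) / C) (sin (x - p.2) / C).
  by derivation; ring.
exact: is_derive_continuous.
Qed.

Lemma integrable_defect C p d a b : 2 <= C -> 0 <= d ->
  mu.-integrable `[a, b] (EFin \o defect C p d).
Proof.
move=> C2 d0; apply: measurable_bounded_integrable => //.
- suff h : (mu `[a, b] < +oo)%E by exact: h.
  rewrite lebesgue_measure_itv/=; case: ifP => _; last exact: ltry.
  by rewrite -EFinB ltry.
- exact: measurable_defect.
- exists 1; split; first exact: num_real.
  move=> M M1 y _ /=; have /andP[h1 h2] := defect_bounds p y C2 d0.
  by rewrite ger0_norm// (le_trans h2)// ltW.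
Qed.

(* Dominated convergence: the defect is bounded and tends to [0] except at the
   lifts of [p.2]. *)
Lemma defect_small C p a b e : 2 <= C -> 0 < e ->
  \forall n \near \oo, int1 a b (defect C p n.+1%:R^-1) < e.
Proof.
move=> C2 e0; have C0 : 0 < C by rewrite (lt_le_trans _ C2).
have d0 (n : nat) : 0 <= n.+1%:R^-1 :> R by rewrite invr_ge0.
pose N : set (measurableTypeR R) := range (fun k : int => p.2 + k%:~R * (2 * pi)).
have cN : countable N.
  by apply: (@sub_countable _ _ _ [set: int]); [exact: card_image_le|exact: countableP].
have ae_cvg : {ae mu, forall y, `[a, b]%classic y ->
    (fun n => (defect C p n.+1%:R^-1 y)%:E) @ \oo --> (cst 0 y)%E}.
  exists N; split.
  - by apply: countable_measurable => //= x _; exact: measurable_set1.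
  - exact: countable_lebesgue_measure0.
  move=> y /= hy; apply: contrapT => yN; apply: hy => _.
  have x0 : 0 < (1 - cos (y - p.2)) / C.
    rewrite divr_gt0// subr_gt0 lt_neqAle cos_le1 andbT; apply/eqP => /cos_eq1[k kE].
    by apply: yN; exists k => //; rewrite -kE addrC subrK.
  apply: cvg_EFin; first exact: nearW.
  rewrite /comp/= (_ : (fun n : nat => _) =
    (fun n : nat => 1 - expR (n.+1%:R^-1 * ln ((1 - cos (y - p.2)) / C)))); last first.
    by apply/funext => n; rewrite /defect /powR gt_eqF.
  rewrite [X in _ --> X](_ : _ = 1 - expR (0 * ln ((1 - cos (y - p.2)) / C))); last first.
    by rewrite mul0r expR0 subrr.
  apply: cvgB; first exact: cvg_cst.
  apply: continuous_cvg; first exact: continuous_expR.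
  by apply: cvgMl; exact: cvg_harmonic.
have mf n : measurable_fun `[a, b] (EFin \o defect C p n.+1%:R^-1).
  by apply/measurable_EFinP; exact: measurable_defect.
have bnd : {ae mu, forall y (n : nat), `[a, b]%classic y ->
    (`|(defect C p n.+1%:R^-1 y)%:E| <= (cst 1 y)%:E)%E}.
  apply: aeW => y n _; rewrite lee_fin; have /andP[h1 h2] := defect_bounds p y C2 (d0 n).
  by rewrite ger0_norm.
have i1 : mu.-integrable `[a, b] (EFin \o cst (1 : R)).
  by apply: (@int1_integrable _ _ _ (cst 1)) => x _; exact: cvg_cst.
have [_ _ H] := @dominated_convergence _ _ _ mu `[a, b] (measurable_itv _)
  (fun n y => (defect C p n.+1%:R^-1 y)%:E) (cst 0%E) (EFin \o cst (1 : R)) mf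
  (measurable_cst _) ae_cvg i1 bnd.
rewrite integral_cst//= mul0e in H.
have H' : (fun n : nat => int1 a b (defect C p n.+1%:R^-1)) @ \oo --> (0 : R).
  exact: fine_cvg H.
exact: (cvgr_lt _ H' _ e0).
Qed.

Lemma one_sub_prod_le (m : nat) (y : 'I_m -> R) : (forall j, 0 <= y j <= 1) ->
  1 - \prod_(j < m) y j <= \sum_(j < m) (1 - y j).
Proof.
elim: m y => [|m ih] y hy; first by rewrite !big_ord0 subrr.
rewrite !big_ord_recl.
set P := \prod_(_ < m) _; set S := \sum_(_ < m) _.
have hS : 1 - P <= S by exact: (ih (fun j => y (lift ord0 j))).
have /andP[P0 P1] : 0 <= P <= 1.
  by apply/andP; split; [apply: prodr_ge0|apply: prodr_ile1] => j _; case/andP: (hy (lift ord0 j)) => // -> ->.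
have /andP[y0 y1] := hy ord0.
have : 0 <= (1 - y ord0) * (1 - P) by rewrite mulr_ge0// subr_ge0.
by move: (y ord0) y0 y1 => z; lra.
Qed.

End Defect.

Section BoundedIntegrable.
Context {R : realType}.
Local Notation mu := (@lebesgue_measure R).
Implicit Types (a b : R) (G : R -> R).

Lemma integrable_bounded1 a b G M (A : set (measurableTypeR R)) :
  measurable A -> A `<=` `[a, b] ->
  measurable_fun [set: measurableTypeR R] G -> (forall y, 0 <= G y <= M) ->
  mu.-integrable A (EFin \o G).
Proof.
move=> mA Aab mG GM.
apply: (@integrableS _ (measurableTypeR R) R mu `[a, b]%classic A) => //.
apply: measurable_bounded_integrable => //.
- suff h : (mu `[a, b] < +oo)%E by exact: h.
  rewrite lebesgue_measure_itv/=; case: ifP => _; last exact: ltry.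
  by rewrite -EFinB ltry.
- exact: measurable_funTS.
- exists M; split; first exact: num_real.
  move=> N MN y _ /=; have /andP[h1 h2] := GM y.
  by rewrite ger0_norm// (le_trans h2)// ltW.
Qed.

Lemma int1_sum (m : nat) (f : 'I_m -> R -> R) a b :
  (forall j, mu.-integrable `[a, b] (EFin \o f j)) ->
  mu.-integrable `[a, b] (EFin \o (fun y => \sum_(j < m) f j y)) /\
  int1 a b (fun y => \sum_(j < m) f j y) = \sum_(j < m) int1 a b (f j).
Proof.
elim: m f => [|m ih] f fi.
  have -> : (fun y => \sum_(j < 0) f j y) = cst 0 by apply/funext => y; rewrite big_ord0.
  split; first by apply: int1_integrable => x _; exact: cvg_cst.
  rewrite big_ord0; apply/eqP; rewrite eq_le; apply/andP; split; last exact: int1_ge0.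
  rewrite -oppr_ge0 -mulN1r -int1Z; last by move=> x _; exact: cvg_cst.
  by apply: int1_ge0 => x _; rewrite mulr0.
have -> : (fun y => \sum_(j < m.+1) f j y) = (fun y => f ord0 y + \sum_(j < m) f (lift ord0 j) y).
  by apply/funext => y; rewrite big_ord_recl.
have [ih1 ih2] := ih (fun j => f (lift ord0 j)) (fun j => fi (lift ord0 j)).
split.
  exact: (@integrableD _ (measurableTypeR R) R mu `[a, b]%classic (measurable_itv _) _ _ (fi ord0) ih1).
rewrite big_ord_recl -ih2.
by rewrite /int1 RintegralD//; exact: fi.
Qed.

End BoundedIntegrable.

Section ApproxDensity.
Context {R : realType}.
Local Notation mu := (@lebesgue_measure R).
Variables (l : R) (m : nat) (q : 'I_m -> R * R) (beta : 'I_m -> R).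
Variable (U : R * R -> R).
Hypothesis l0 : 0 < l.
Hypothesis qP : forall j, closed_strip l (q j).
Hypothesis beta0 : forall j, 0 <= beta j.
Hypothesis HU : liouville l q beta U.
Implicit Types (x y : R * R) (d K a b : R).

Local Notation ns := (nonsing q).
Local Notation C := (barrier_const l).

Lemma barrier_const_ge2 : 2 <= C.
Proof. by rewrite /barrier_const lerDl divr_ge0// sqr_ge0. Qed.

(** The exponential of the barrier is a product of factors in [[0, 1]], and the losses of the
    factors add up at most; each factor is bounded below through [sing_fun >= 1 - cos]. *)
Lemma one_sub_expR_barrier_le d x : 0 < d -> strip l x -> ns x ->
  1 - expR (d * barrier l q x) <= \sum_(j < m) defect C (q j) d x.2.
Proof.
move=> d0 xl nx; have C0 := barrier_const_gt0 l.
have -> : expR (d * barrier l q x) = \prod_(j < m) expR (d * log_sing C (q j) x).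
  by rewrite /barrier mulr_sumr expR_sum.
apply: (le_trans (one_sub_prod_le _)).
  move=> j; rewrite expR_ge0 expR_le1 mulr_ge0_le0 ?(ltW d0)//.
  exact: log_sing_le0.
apply: ler_sum => j _; rewrite /defect lerD2l lerN2.
have N0 := sing_funP j nx.
have [c1|c1] := eqVneq ((1 - cos (x.2 - (q j).2)) / C) 0.
  by rewrite c1 powR0 ?expR_ge0// lt0r_neq0.
have [h1 h2] := one_sub_cos_bounds (x.2 - (q j).2) barrier_const_ge2.
rewrite /powR (negbTE c1) ler_expR ler_wpM2l ?(ltW d0)// /log_sing ler_ln ?posrE.
- by rewrite ler_wpM2r ?invr_ge0 ?(ltW C0)// /sing_fun lerDl divr_ge0// sqr_ge0.
- by rewrite lt_neqAle eq_sym c1 h1.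
- by rewrite divr_gt0.
Qed.

(** The cutoff with [d = 0] and [K = - M] is continuous across the singular points, because [U <= M]
    around them, and it dominates [e^U], because the spline lies above the identity. Compactness
    bounds it. *)
Lemma expR_U_bounded a b : 0 < a -> b < l -> exists2 S, 0 < S &
  forall x, a <= x.1 <= b -> 0 <= x.2 <= 2 * pi -> ns x -> expR (U x) <= S.
Proof.
move=> a0 bl; have [M HM] := U_upper_near_sing beta0 HU.
have H := @cutoff_C2 R ns (bar l q U 0) (bar_t q U 0) (bar_tt q U 0) (bar_y q U 0)
  (bar_yy q U 0) (- M) l (fun x _ => @nonsing_near R m q x)
  (fun x xl nx => bar_C2 HU 0 xl nx).
have [|_ [cW _ _ _ _]] := H.
  move=> x xl nx; apply: filterS (HM x xl nx) => y h ny.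
  by rewrite /bar mul0r addr0 subr_le0; exact: h.
have [|S [S0 HS]] := @bounded_rectangle R (cut ns (bar l q U 0) (- M)) a b 0 (2 * pi).
  by move=> x /andP[xa xb] _; apply: cW; rewrite (lt_le_trans a0 xa) (le_lt_trans xb bl).
exists S => // x xa x2 nx; have := HS x.1 x.2 xa x2.
rewrite -surjective_pairing /cut ger0_norm ?expR_ge0//; apply: le_trans.
rewrite ler_expR cut_arg_ns// /bar mul0r addr0.
by have [h _ _ _ _] := spline_bounds (U x - M); lra.
Qed.

Lemma cut_le K d x : 0 <= d -> strip l x -> ns x ->
  cut ns (bar l q U d) K x <= expR (U x) + expR (1 - K).
Proof.
move=> d0 xl nx; rewrite /cut cut_arg_ns//.
have [h|h] := leP (bar l q U d x + K) 1.
  by rewrite ler_wpDl ?expR_ge0// ler_expR lerB// spline_le1.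
rewrite spline_ge1 ?(ltW h)// addrK ler_wpDr ?expR_ge0// ler_expR /bar gerDl.
by rewrite mulr_ge0_le0// barrier_le0.
Qed.

Lemma cut_ge K d x : 0 < d -> strip l x -> ns x ->
  expR (U x) - cut ns (bar l q U d) K x <=
  expR (U x) * (\sum_(j < m) defect C (q j) d x.2).
Proof.
move=> d0 xl nx; apply: (@le_trans _ _ (expR (U x) * (1 - expR (d * barrier l q x)))).
  rewrite mulrBr mulr1 lerB// -expRD -/(bar l q U d x) /cut cut_arg_ns// ler_expR.
  by have [h _ _ _ _] := spline_bounds (bar l q U d x + K); lra.
by rewrite ler_wpM2l ?expR_ge0// one_sub_expR_barrier_le.
Qed.

(** [W] is the cut off density, and [X] the price in its Liouville inequality. The price is small
    only after integration over circles against [W], as [e^U - W] is not small pointwise near the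
    singular points; [G], a function of the angle, bounds what [W] misses of [e^U]. *)
Lemma approx_density a b (e k : R) : 0 < a -> a <= b -> b < l -> 0 < e -> 0 < k ->
  exists W Wt Wtt Wy Wyy X G,
  [/\ C2_data 0 l W Wt Wtt Wy Wyy, forall x, 0 < W x,
      forall x, W (x.1, x.2 + 2 * pi) = W x, cont2 0 l X &
      forall x, a <= x.1 <= b -> 0 <= x.2 <= 2 * pi ->
        - W x ^+ 2 * (W x + X x) <=
        W x * (Wtt x + Wyy x) - Wt x ^+ 2 - Wy x ^+ 2] /\
  [/\ forall t, a <= t <= b ->
        circle (2 * pi) (fun x => W x * X x) t <= e * circle (2 * pi) W t,
      forall x, strip l x -> ns x -> W x <= expR (U x) + k,
      forall x, a <= x.1 <= b -> 0 <= x.2 <= 2 * pi -> ns x ->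
        expR (U x) <= W x + G x.2,
      measurable_fun [set: measurableTypeR R] G /\
      (exists M, forall y : R, 0 <= G y <= M) &
      int1 0 (2 * pi) G <= k].
Proof.
move=> a0 ab bl e0 k0; have [S S0 HS] := expR_U_bounded a0 bl.
have p2 : 0 < 2 * pi :> R by rewrite mulr_gt0// pi_gt0.
(* [expR (1 - K)] is the most that the cutoff can add to [e^U]; [c] is the least value of [W], since
   the spline is at least [1 / 2]. *)
pose K := 1 - ln k; have KE : expR (1 - K) = k by rewrite /K subKr lnK.
pose c := expR (1 / 2 - K); have c0 : 0 < c by exact: expR_gt0.
(* The integral of each defect is made smaller than both thresholds: [t1] yields the integral of [G]
   at most [k], and [t2] makes [(S + k)] times that integral at most [e / 2] times a lower bound for
   the mass of [W] on a circle. Using [m.+1] avoids a zero denominator when there are no points. *)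
pose t1 := k / (S * m.+1%:R).
pose t2 := e / 2 * (2 * pi * c) / ((S + k) * (S * m.+1%:R)).
have m0 : 0 < m.+1%:R :> R by rewrite ltr0n.
have Sm : 0 < S * m.+1%:R by exact: mulr_gt0.
have Sk : 0 < S + k by exact: addr_gt0.
have tau0 : 0 < Num.min t1 t2.
  rewrite lt_min divr_gt0//= divr_gt0//; last exact: mulr_gt0.
  by apply: mulr_gt0; [exact: divr_gt0|exact: mulr_gt0].
have [n [Hn1 Hn2]] : exists n : nat,
    (forall j, int1 0 (2 * pi) (defect C (q j) n.+1%:R^-1) < Num.min t1 t2) /\
    n.+1%:R^-1 * m%:R <= e / 2.
  near \oo => n; exists n; split.
    near: n; apply: (@filter_forall _ _ (fun j (n : nat) => int1 0 (2 * pi) (defect C (q j) n.+1%:R^-1) < Num.min t1 t2) \oo) => j.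
    exact: (defect_small (q j) 0 (2 * pi) barrier_const_ge2 tau0).
  have h : n.+1%:R^-1 < e / 2 / m.+1%:R.
    near: n; apply: (cvgr_lt _ (@cvg_harmonic R)); apply: divr_gt0 => //; exact: divr_gt0.
  apply: (@le_trans _ _ (n.+1%:R^-1 * m.+1%:R)).
    by rewrite ler_wpM2l ?invr_ge0// ler_nat.
  by rewrite -ler_pdivlMr// ltW.
set d := n.+1%:R^-1 in Hn1 Hn2; have d0 : 0 < d by rewrite invr_gt0.
pose v := bar l q U d; pose W := cut ns v K.
pose Wt := cut_t ns v (bar_t q U d) K; pose Wy := cut_y ns v (bar_y q U d) K.
pose Wtt := cut_tt ns v (bar_t q U d) (bar_tt q U d) K.
pose Wyy := cut_yy ns v (bar_y q U d) (bar_yy q U d) K.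
have vs : forall x, 0 < x.1 < l -> ~ ns x -> \forall y \near x, ns y -> v y + K <= 0.
  by move=> x xl nx; exact: (bar_sing l0 qP beta0 HU K d0 xl nx).
have DW : C2_data 0 l W Wt Wtt Wy Wyy.
  exact: (cutoff_C2 (fun x _ => @nonsing_near R m q x) (fun x xl nx => bar_C2 HU d xl nx) vs).
pose z x := cut_arg ns v K x.
pose Z x := spline1 (z x) * expR (U x).
(* [W + X] is the lower order term that remains: slope of the spline times [e^U], plus the loss
   [d m] of the barrier. *)
pose X x := Z x - W x + d * m%:R.
pose G (y : R) := S * \sum_(j < m) defect C (q j) d y.
have W0 x : 0 < W x by exact: cut_gt0.
have Wc x : c <= W x.
  rewrite /W /cut ler_expR lerB//; by have [_ h _ _ _] := spline_bounds (cut_arg ns v K x).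
have [_ [cW _ _ _ _]] := DW.
have D0 (y : R) j : 0 <= defect C (q j) d y <= 1.
  by apply: defect_bounds; [exact: barrier_const_ge2|exact: ltW].
have G0 (y : R) : 0 <= G y.
  apply: mulr_ge0; first exact: ltW.
  by apply: sumr_ge0 => j _; case/andP: (D0 y j).
have GM (y : R) : G y <= S * m%:R.
  rewrite ler_wpM2l ?(ltW S0)// -[X in _ <= X%:R]card_ord -sumr_const.
  by apply: ler_sum => j _; case/andP: (D0 y j).
have mG : measurable_fun [set: measurableTypeR R] G.
  apply: measurable_funM => //; apply: measurable_sum => j.
  exact: measurable_defect.
have iD j : mu.-integrable `[0, 2 * pi] (EFin \o defect C (q j) d).
  by apply: integrable_defect; [exact: barrier_const_ge2|exact: ltW].
have iG : mu.-integrable `[0, 2 * pi] (EFin \o G).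
  by apply: (@integrable_bounded1 _ 0 (2 * pi) G (S * m%:R)) => // y; rewrite G0 GM.
have intG : int1 0 (2 * pi) G <= S * m.+1%:R * Num.min t1 t2.
  have [iS ES] := int1_sum iD.
  rewrite /G /int1 RintegralZl// -/(int1 _ _ _) ES -mulrA ler_wpM2l ?(ltW S0)//.
  apply: (@le_trans _ _ (\sum_(j < m) Num.min t1 t2)).
    by apply: ler_sum => j _; exact: ltW.
  by rewrite sumr_const card_ord -[leLHS]mulr_natl ler_wpM2r ?(ltW tau0)// ler_nat.
have cX : cont2 0 l X.
  move=> x xl; rewrite /X; continuity; last exact: cW.
  have [nx|nx] := pselect (ns x).
    have [_ [c0' _ _ _ _]] := bar_C2 HU 0 xl nx.
    have cU : {for x, continuous U}.
      apply: (@continuous_near_eq _ _ (bar l q U 0)) => //.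
      by near=> y; rewrite /bar mul0r addr0.
    have cz : {for x, continuous (cut_arg ns v K)}.
      exact: (continuous_cut_arg (fun x _ => @nonsing_near R m q x) (fun x xl nx => bar_C2 HU d xl nx) xl nx).
    have cs1 : {for x, continuous (fun x => spline1 (z x))}.
      exact: continuous_at_comp cz (is_derive_continuous (is_derive_spline1 _)).
    by rewrite /Z; continuity; [exact: cs1|exact: cU].
  apply: (@continuous_near_eq _ _ (fun=> 0)); last exact: continuous_at_cst.
  apply: filterS (cut_arg_sing vs xl nx) => y h.
  by rewrite /Z; have [_ -> _] := spline_le0 h; rewrite mul0r.
have str t : a <= t <= b -> 0 < t < l.
  by move=> /andP[at1 tb]; rewrite (lt_le_trans a0 at1) (le_lt_trans tb bl).
have zsing x : ~ ns x -> z x = 0.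
  by move=> nx; rewrite /z /cut_arg asboolF.
have s10 : spline1 0 = 0 :> R by have [] := @spline_le0 R 0 (lexx _).
have s20 : spline2 0 = 0 :> R by have [] := @spline_le0 R 0 (lexx _).
have zper x : cut_arg ns v K (x.1, x.2 + 2 * pi) = cut_arg ns v K x.
  have E : `[< ns (x.1, x.2 + 2 * pi) >] = `[< ns x >].
    by apply: asbool_equiv_eq; exact: nonsing_periodic.
  by rewrite /cut_arg E /v (bar_periodic HU).
exists W, Wt, Wtt, Wy, Wyy, X, G; split; split.
- exact: DW.
- exact: W0.
- by move=> x; rewrite /W /cut zper.
- exact: cX.
- move=> x xa x2.
  rewrite cut_log_laplacian mulNr -mulrN ler_wpM2l ?sqr_ge0//.
  rewrite -/(z x) /X (_ : - (W x + _) = - Z x - d * m%:R); last by ring.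
  have [h1 h2 h3 h4 h5] := spline_bounds (z x).
  have dm0 : 0 <= d * m%:R by rewrite mulr_ge0// ltW.
  have [nx|nx] := pselect (ns x); last first.
    by rewrite /Z (zsing _ nx) s10 s20 !mul0r addr0; lra.
  have hL := bar_laplacian_ge HU (ltW d0) (str _ xa) nx x2.
  have q1 : 0 <= spline2 (z x) * (bar_t q U d x ^+ 2 + bar_y q U d x ^+ 2).
    by rewrite mulr_ge0// addr_ge0 ?sqr_ge0.
  have q2 := ler_wpM2l h3 hL.
  have q3 : spline1 (z x) * (d * m%:R) <= 1 * (d * m%:R) by rewrite ler_wpM2r.
  apply: le_trans (_ : _ <= spline1 (z x) * (bar_tt q U d x + bar_yy q U d x)) _; last by rewrite lerDr.
  apply: le_trans q2; rewrite /Z mulrBr mulrN lerD2l lerN2.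
  by rewrite -[leRHS]mul1r.
- move=> t tab; have tl := str _ tab.
  have cWt := cont2_section cW tl; have cXt := cont2_section cX tl.
  have iW : mu.-integrable `[0, 2 * pi] (EFin \o (fun y : R => d * m%:R * W (t, y))).
    by apply: int1_integrable => y _; continuity; exact: cWt.
  have iSG : mu.-integrable `[0, 2 * pi] (EFin \o (fun y : R => (S + k) * G y)).
    apply: (@integrable_bounded1 _ 0 (2 * pi) _ ((S + k) * (S * m%:R))) => //.
      by apply: measurable_funM => //; exact: measurable_cst.
    by move=> y; rewrite mulr_ge0 ?(ltW Sk)//= ler_wpM2l ?(ltW Sk).
  apply: (@le_trans _ _ (int1 0 (2 * pi) (fun y : R => (S + k) * G y + d * m%:R * W (t, y)))).
    apply: le_Rintegral => //.
    + by apply: int1_integrable => y _; continuity; [exact: cWt|exact: cXt].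
    + exact: (@integrableD _ (measurableTypeR R) R mu `[0, 2 * pi]%classic (measurable_itv _) _ _ iSG iW).
    move=> y; rewrite /= in_itv/= => y2; rewrite /X.
    rewrite mulrDr [W (t, y) * (d * _)]mulrC lerD2r.
    have [h1 h2 h3 h4 h5] := spline_bounds (z (t, y)).
    have [nx|nx] := pselect (ns (t, y)); last first.
      apply: (@le_trans _ _ 0); last by rewrite mulr_ge0 ?(ltW Sk).
      rewrite pmulr_rle0// /Z (zsing _ nx) s10 mul0r sub0r oppr_le0 ltW//.
    have US : expR (U (t, y)) <= S by apply: HS.
    have WS : W (t, y) <= S + k.
      apply: (le_trans (@cut_le K d (t, y) (ltW d0) tl nx)).
      by rewrite KE lerD2r.
    have ZG : Z (t, y) - W (t, y) <= G y.
      apply: (@le_trans _ _ (expR (U (t, y)) - W (t, y))).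
        by rewrite lerD2r /Z ler_piMl// expR_ge0.
      apply: (le_trans (@cut_ge K d (t, y) d0 tl nx)).
      by rewrite ler_wpM2r//; apply: sumr_ge0 => j _; case/andP: (D0 y j).
    apply: (@le_trans _ _ (W (t, y) * G y)); first by rewrite ler_wpM2l// ltW.
    by rewrite ler_wpM2r.
  have -> : int1 0 (2 * pi) (fun y : R => (S + k) * G y + d * m%:R * W (t, y)) =
      (S + k) * int1 0 (2 * pi) G + d * m%:R * circle (2 * pi) W t.
    rewrite /int1 RintegralD// RintegralZl//; congr (_ + _).
    by apply: int1Z => y _; exact: cWt.
  have Wt1 : 2 * pi * c <= circle (2 * pi) W t.
    have := int1_cst c (ltW p2); rewrite subr0 [_ * c]mulrC => <-.
    rewrite /circle; apply: (@int1_le _ 0 (2 * pi) (fun=> c) (fun y : R => W (t, y))).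
    - by move=> y _; exact: continuous_at_cst.
    - by move=> y _; exact: cWt.
    - by move=> y _; exact: Wc.
  have G1 : (S + k) * int1 0 (2 * pi) G <= e / 2 * (2 * pi * c).
    apply: (@le_trans _ _ ((S + k) * (S * m.+1%:R * t2))).
      rewrite ler_wpM2l ?(ltW Sk)//; apply: (le_trans intG).
      by rewrite ler_wpM2l ?(ltW Sm)// ge_min lexx orbT.
    rewrite /t2 le_eqVlt; apply/orP; left; apply/eqP; field.
    by rewrite !lt0r_neq0.
  have e2 : e / 2 * (2 * pi * c) <= e / 2 * circle (2 * pi) W t.
    by rewrite ler_wpM2l// divr_ge0// ltW.
  have e3 : d * m%:R * circle (2 * pi) W t <= e / 2 * circle (2 * pi) W t.
    rewrite ler_wpM2r//; apply: le_trans Wt1; apply: mulr_ge0; exact: ltW.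
  apply: (le_trans (lerD (le_trans G1 e2) e3)).
  by rewrite -mulrDl -splitr.
- by move=> x xl nx; rewrite -KE; exact: (@cut_le K d x (ltW d0) xl nx).
- move=> x xa x2 nx; rewrite -lerBlDl.
  apply: (le_trans (@cut_ge K d x d0 (str _ xa) nx)).
  rewrite ler_wpM2r//; last exact: HS.
  by apply: sumr_ge0 => j _; case/andP: (D0 x.2 j).
- by split => //; exists (S * m%:R) => y; rewrite G0 GM.
- apply: (le_trans intG); apply: (@le_trans _ _ (S * m.+1%:R * t1)).
    by rewrite ler_wpM2l ?(ltW Sm)// ge_min lexx.
  by rewrite /t1 mulrC divfK// lt0r_neq0.
Unshelve. all: by end_near. Qed.

End ApproxDensity.

(** * The lower bound *)

Section NullSets.
Context d (T : measurableType d) {R : realType} (mu : {measure set T -> \bar R}).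
Implicit Types (D N : set T) (f g : T -> R).

Lemma Rintegral_setD_null D N f : measurable D -> measurable N -> mu N = 0 ->
  mu.-integrable D (EFin \o f) ->
  \int[mu]_(x in D) f x = \int[mu]_(x in D `\` N) f x.
Proof.
by move=> mD mN N0 fi; rewrite /Rintegral; congr fine; exact: negligible_integral.
Qed.

Lemma le_Rintegral_null D N f g : measurable D -> measurable N -> mu N = 0 ->
  mu.-integrable D (EFin \o f) -> mu.-integrable D (EFin \o g) ->
  (forall x, D x -> ~ N x -> f x <= g x) ->
  \int[mu]_(x in D) f x <= \int[mu]_(x in D) g x.
Proof.
move=> mD mN N0 fi gi fg.
have mDN : measurable (D `\` N) by exact: measurableD.
rewrite (Rintegral_setD_null mD mN N0 fi) (Rintegral_setD_null mD mN N0 gi).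
apply: le_Rintegral => //; last by move=> x [Dx Nx]; exact: fg.
- by apply: (integrableS mD mDN _ fi) => x [].
- by apply: (integrableS mD mDN _ gi) => x [].
Qed.

Lemma Rintegral_subset D E f : measurable D -> measurable E -> D `<=` E ->
  mu.-integrable E (EFin \o f) -> (forall x, E x -> 0 <= f x) ->
  \int[mu]_(x in D) f x <= \int[mu]_(x in E) f x.
Proof.
move=> mD mE DE fi f0; rewrite /Rintegral; apply: fine_le.
- by apply: integrable_fin_num => //; exact: (integrableS mE mD DE fi).
- exact: integrable_fin_num.
- apply: ge0_subset_integral => //; by case/integrableP: fi.
Qed.

Lemma integrable_mul_bounded D f g M : measurable D ->
  mu.-integrable D (EFin \o f) -> measurable_fun D g ->
  (forall x, D x -> `|g x| <= M) ->
  mu.-integrable D (EFin \o (fun x => f x * g x)).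
Proof.
move=> mD fi mg gM.
have : mu.-integrable D ((EFin \o f) \* (EFin \o g))%E.
  apply: integrableMl => //; exists M; split; first exact: num_real.
  by move=> N MN x Dx /=; rewrite (le_trans (gM _ Dx))// ltW.
by apply: eq_integrable.
Qed.

End NullSets.

Section PlaneBoxes.
Context {R : realType}.
Local Notation mu := (@lebesgue_measure R).
Local Notation area := (@lebesgue_measure R \x @lebesgue_measure R)%E.
Local Notation plane := (measurableTypeR R * measurableTypeR R)%type.
Implicit Types (a b l k : R) (G : R -> R).

(** These finitely many lines contain all the lifts of the singular points, so pointwise comparisons
    away from the singularities suffice for integrals. *)
Lemma null_vertical_lines (m : nat) (q : 'I_m -> R * R) :
  let N := [set x : R * R | exists j, x.1 = (q j).1] in
  measurable (N : set plane) /\ area (N : set plane) = 0.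
Proof.
set N := [set x | _]; pose F := range (fun j => (q j).1) : set R.
have cF : countable F by apply: finite_set_countable; exact: finite_image.
have mF : measurable (F : set (measurableTypeR R)).
  by apply: countable_measurable => //; exact: measurable_set1.
have -> : N = F `*` setT.
  by apply/seteqP; split => [x [j xj]|x [[j _ jx] _]]; [split => //; exists j|exists j].
split; first exact: measurableX.
transitivity ((mu F * mu [set: measurableTypeR R])%E).
  exact: product_measure1E.
by rewrite (countable_lebesgue_measure0 cF) mul0e.
Qed.

Lemma integral_box_snd a b G M : a <= b ->
  measurable_fun [set: measurableTypeR R] G -> (forall y, 0 <= G y <= M) ->
  area.-integrable (`[a, b] `*` `[0, 2 * pi[) (EFin \o (fun x => G x.2)) /\
  \int[area]_(x in `[a, b] `*` `[0, 2 * pi[) G x.2 <= (b - a) * int1 0 (2 * pi) G.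
Proof.
move=> ab mG GM.
have mD : measurable (`[a, b] `*` `[0, 2 * pi[ : set plane).
  by apply: measurableX; exact: measurable_itv.
have i1 : area.-integrable (`[a, b] `*` `[0, 2 * pi[ : set plane) (EFin \o cst 1).
  by apply: integrable_box => x _; exact: continuous_at_cst.
have iG : area.-integrable (`[a, b] `*` `[0, 2 * pi[) (EFin \o (fun x => G x.2)).
  have h : area.-integrable (`[a, b] `*` `[0, 2 * pi[) (EFin \o (fun x : plane => cst 1 x * G x.2)).
    apply: (integrable_mul_bounded mD i1 (M := M)).
      apply: (@measurableT_comp _ _ _ _ _ _ G) => //.
      by apply: (@measurable_funTS _ _ plane (measurableTypeR R)); exact: measurable_snd.
    by move=> x _; have /andP[g1 g2] := GM x.2; rewrite ger0_norm.
  by apply: eq_integrable h => // x _ /=; rewrite mul1r.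
have iG0 (A : set (measurableTypeR R)) : measurable A -> A `<=` `[0, 2 * pi] ->
    mu.-integrable A (EFin \o G).
  by move=> mA sA; exact: (integrable_bounded1 mA sA mG GM).
have sub : `[0, 2 * pi[ `<=` `[0 : R, 2 * pi].
  by apply: subset_itvl; rewrite bnd_simp.
split => //.
have [|||x|y|h1 _] := @Fubini_rectangle _ (fun x => G x.2) `[a, b] `[0, 2 * pi[.
- exact: measurable_itv.
- exact: measurable_itv.
- exact: iG.
- by move=> _; apply: iG0 => //; exact: measurable_itv.
- by move=> _; apply: int1_integrable => x _; exact: continuous_at_cst.
apply: (@le_trans _ _ ((b - a) * \int[mu]_(y in `[0, 2 * pi[) G y)).
  rewrite le_eqVlt; apply/orP; left; apply/eqP; apply: (etrans h1); rewrite [RHS]mulrC.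
  exact: (int1_cst (\int[mu]_(y in `[0, 2 * pi[) G y) ab).
rewrite ler_wpM2l ?subr_ge0//.
rewrite /int1; apply: Rintegral_subset.
- exact: measurable_itv.
- exact: measurable_itv.
- exact: sub.
- by apply: iG0; [exact: measurable_itv|].
- by move=> y _; case/andP: (GM y).
Qed.
End PlaneBoxes.

(** * Test functions and their supports *)

Section TestFunctions.
Context {R : realType}.
Local Notation mu := (@lebesgue_measure R).
Local Notation area := (@lebesgue_measure R \x @lebesgue_measure R)%E.
Local Notation plane := (measurableTypeR R * measurableTypeR R)%type.
Implicit Types (a b l k : R) (phi f : R * R -> R) (x y : R * R).

Lemma is_derive_unique (g : R -> R) (z d1 d2 : R) :
  is_derive z 1 g d1 -> is_derive z 1 g d2 -> d1 = d2.
Proof. by move=> [_ <-] [_ <-]. Qed.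

Lemma is_derive_shift (g : R -> R) (z c d : R) :
  is_derive z 1 g d -> is_derive (z + c) 1 (fun s => g (s - c)) d.
Proof.
move=> gz; have g' : is_derive (z + c - c) 1 g d by rewrite addrK.
have h : is_derive (z + c) 1 (fun s : R => s - c) 1 by derivation; rewrite subr0.
by have := is_derive1_comp2 h g'; rewrite mulr1.
Qed.

Lemma periodic2pi_derive_y f fy x : periodic2pi f ->
  is_derive (x.2 + 2 * pi) 1 (fun s => f (x.1, s)) fy <->
  is_derive x.2 1 (fun s => f (x.1, s)) fy.
Proof.
move=> pf; split => /is_derive_shift.
- move=> /(_ (- (2 * pi))); rewrite addrK.
  rewrite (_ : (fun s => _) = (fun s => f (x.1, s)))//.
  by apply/funext => s; rewrite opprK; exact: (pf (x.1, s)).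
- move=> /(_ (2 * pi)).
  rewrite (_ : (fun s => _) = (fun s => f (x.1, s)))//.
  by apply/funext => s; rewrite -[LHS]pf /= subrK.
Qed.

Lemma near_vertical a b x : ~ (a <= x.1 <= b) ->
  \forall y \near x, ~ (a <= y.1 <= b).
Proof.
have c1 : {for x, continuous (fun x : R * R => x.1)} by exact: cvg_fst.
move=> /negP; rewrite negb_and -!ltNge => /orP[h|h].
- by apply: filterS (cvgr_lt _ c1 _ h) => y h' /andP[]; rewrite leNgt h'.
- by apply: filterS (cvgr_gt _ c1 _ h) => y h' /andP[_]; rewrite leNgt h'.
Qed.

Lemma flat_derivatives a b f x : (forall y, f y != 0 -> a <= y.1 <= b) ->
  ~ (a <= x.1 <= b) ->
  is_derive x.1 1 (fun s => f (s, x.2)) 0 /\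
  is_derive x.2 1 (fun s => f (x.1, s)) 0.
Proof.
move=> f0 /near_vertical nx.
have nf : \forall y \near x, f y = 0.
  by apply: filterS nx => y; apply: contra_notP => /eqP; exact: f0.
split; apply: (@near_eq_is_derive _ _ _ (fun=> 0 : R)).
- by apply: filterS (near_section1 nf) => s ->.
- by apply: filterS (near_section2 nf) => s ->.
Qed.

Lemma test_C1 l phi : test_function l phi -> forall x,
  [/\ {for x, continuous phi}, {for x, continuous (dt phi)},
      {for x, continuous (dtheta phi)},
      is_derive x.1 1 (fun s => phi (s, x.2)) (dt phi x) &
      is_derive x.2 1 (fun s => phi (x.1, s)) (dtheta phi x)].
Proof. by move=> [_ C _] x; have [[h1 _ h2 _] [h3 h4 _ h5 _]] := classC2 (C 2%N) (x := x) I. Qed.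

Lemma test_derivatives l phi : test_function l phi ->
  test_function l (dt phi) /\ test_function l (dtheta phi).
Proof.
move=> tphi; have C1 := test_C1 tphi.
have [pphi C [a [b [a0 bl phi0]]]] := tphi.
have flat x : ~ (a <= x.1 <= b) -> dt phi x = 0 /\ dtheta phi x = 0.
  move=> nx; have [_ _ _ d1 d2] := C1 x; have [z1 z2] := flat_derivatives phi0 nx.
  by split; [exact: is_derive_unique d1 z1|exact: is_derive_unique d2 z2].
split; split.
- move=> x; apply: dtE => /=; have [_ _ _ d1 _] := C1 x.
  rewrite (_ : (fun s => _) = (fun s => phi (s, x.2)))//.
  by apply/funext => s; exact: (pphi (s, x.2)).
- by move=> k; have [_ [_ h _]] := C k.+1.
- exists a, b; split => // x; apply: contraNP => /flat[-> _].
  by rewrite eqxx.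
- move=> x; apply: dthetaE => /=; have [_ _ _ _ d2] := C1 x.
  exact/periodic2pi_derive_y.
- by move=> k; have [_ [_ _ h]] := C k.+1.
- exists a, b; split => // x; apply: contraNP => /flat[_ ->].
  by rewrite eqxx.
Qed.

(* The three functions vanish on the boundary of the box as well, since the
   support of phi lies in its interior. *)
Lemma test_box l phi : 0 < l -> test_function l phi -> exists a b,
  [/\ 0 < a, b < l, l / 2 <= b - a &
      forall x, [\/ phi x != 0, dt phi x != 0 | dtheta phi x != 0] ->
        a < x.1 < b].
Proof.
move=> l0 tphi.
have [td1 td2] := test_derivatives tphi.
have C1 := test_C1 tphi; have [_ _ [a [b [a0 bl phi0]]]] := tphi.
(* The midpoints leave room around the support; the quarters ensure the length [l / 2], which the
   one-dimensional inequality needs to be at least 2. *)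
exists (Num.min (a / 2) (l / 4)), (Num.max ((b + l) / 2) (3 * l / 4)).
split.
- by rewrite lt_min !divr_gt0.
- by rewrite gt_max; apply/andP; split; lra.
- have h1 : l * 3 / 4 <= Num.max ((b + l) / 2) (3 * l / 4) by rewrite le_max; apply/orP; right; lra.
  have h2 : Num.min (a / 2) (l / 4) <= l / 4 by rewrite ge_min lexx orbT.
  lra.
move=> x hx; have : a <= x.1 <= b.
  have [//|nx] := pselect (a <= x.1 <= b).
  have [_ _ _ d1 d2] := C1 x; have [z1 z2] := flat_derivatives phi0 nx.
  case: hx => [/phi0//||].
  - by rewrite (is_derive_unique d1 z1) eqxx.
  - by rewrite (is_derive_unique d2 z2) eqxx.
move=> /andP[ax xb]; rewrite gt_min lt_max; apply/andP; split; apply/orP; left; lra.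
Qed.

End TestFunctions.

(** * The energy inequality for the singular density *)

Section EnergyInequality.
Context {R : realType}.
Local Notation mu := (@lebesgue_measure R).
Local Notation area := (@lebesgue_measure R \x @lebesgue_measure R)%E.
Local Notation plane := (measurableTypeR R * measurableTypeR R)%type.

Lemma C2_data_scale (a b c : R) W Wt Wtt Wy Wyy : C2_data a b W Wt Wtt Wy Wyy ->
  C2_data a b (fun x => c * W x) (fun x => c * Wt x) (fun x => c * Wtt x)
    (fun x => c * Wy x) (fun x => c * Wyy x).
Proof.
have Z (f : R -> R) (z df : R) : is_derive z 1 f df -> is_derive z 1 (fun s => c * f s) (c * df).
  by move=> h; derivation; rewrite mul0r add0r mulrC.
have Cc (f : R * R -> R) : cont2 a b f -> cont2 a b (fun x => c * f x).
  by move=> h x xl; continuity; exact: h.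
move=> [[c1 c2 c3 c4] [c0 d1 d2 d3 d4]].
by split; split; try (exact: Cc); move=> x xl; apply: Z; [exact: d1|exact: d2|exact: d3|exact: d4].
Qed.

Variables (l : R) (m : nat) (q : 'I_m -> R * R) (beta : 'I_m -> R).
Variable (U : R * R -> R).
Hypothesis l4 : 4 <= l.
Hypothesis qP : forall j, closed_strip l (q j).
Hypothesis beta0 : forall j, 0 <= beta j.
Hypothesis HU : liouville l q beta U.

Local Notation V := (fun x => expR (U x)).
Local Notation lines := [set x : R * R | exists j, x.1 = (q j).1].
Local Notation box a b := (`[a, b] `*` `[0, 2 * pi[).

Lemma nonsing_off_lines x : ~ lines x -> nonsing q x.
Proof. by move=> nx j [xq _]; apply: nx; exists j. Qed.

Lemma density_integrable (D : set plane) : measurable D -> D `<=` fdom l ->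
  area.-integrable D (EFin \o V).
Proof.
move=> mD Dl; have [_ iV _ _ _] := HU.
exact: (@integrableS _ plane R area (fdom l) D _ (measurable_fdom l) mD Dl iV).
Qed.

(** The coefficient of the mass in [cylinder_energy], for circles of length [2 pi]. *)
Definition energy_const (d : R) :=
  (36 * 64 * ((2 * pi) ^+ 2 / 4) + 1) / d + 18 * (2 * pi) ^+ 2.

Lemma energy_const_ge0 (d : R) : 0 < d -> 0 <= energy_const d.
Proof.
move=> d0; apply: addr_ge0; last by apply: mulr_ge0; [exact: ler0n|exact: sqr_ge0].
apply: divr_ge0; last exact: ltW.
apply: addr_ge0; last exact: ler01.
apply: mulr_ge0; first by rewrite mulr_ge0 ?ler0n.
by apply: divr_ge0; [exact: sqr_ge0|exact: ler0n].
Qed.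

(** The regular inequality is applied to [lam] times an approximate density on a box containing the
    support of [phi]. A factor [lam] larger than [1 + energy_const d * mm] will give a constant
    below one for [e^U]; strictness of the mass bound leaves room for the approximation. *)
Lemma weighted_energy (lam mm d : R) phi :
  0 < mm -> (2 * pi) ^+ 2 / 4 * mm ^+ 2 <= 1 -> mm <= 1 ->
  0 < d -> d <= 1 -> mm * l <= 8 - 4 * d -> 1 <= lam ->
  lam * \int[area]_(x in fdom l) V x < 2 * pi * mm ->
  test_function l phi ->
  lam * \int[area]_(x in fdom l) (V x * phi x ^+ 2) <=
  (1 + energy_const d * mm) *
    \int[area]_(x in fdom l) (dt phi x ^+ 2 + dtheta phi x ^+ 2).
Proof.
move=> mm0 mm2 mm1 d0 d1 mml lam1 massV tphi.
have l0 : 0 < l by exact: lt_le_trans l4.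
have lam0 : 0 < lam by lra.
have p2 : 0 < 2 * pi :> R by rewrite mulr_gt0// pi_gt0.
have C1 := test_C1 tphi.
have [a [b [a0 bl ba supp]]] := test_box l0 tphi.
have ab : a <= b by lra.
have bal : b - a <= l by lra.
have ba2 : 2 <= b - a by move: l4 => ?; lra.
have ba0 : 0 <= b - a by lra.
have str t : a <= t <= b -> 0 < t < l.
  by move=> /andP[at1 tb]; rewrite (lt_le_trans a0 at1) (le_lt_trans tb bl).
have cphi x : {for x, continuous phi} by have [h _ _ _ _] := C1 x; exact: h.
have cphit x : {for x, continuous (dt phi)} by have [_ h _ _ _] := C1 x; exact: h.
have cphiy x : {for x, continuous (dtheta phi)} by have [_ _ h _ _] := C1 x; exact: h.
have [S [S0 phiS]] := @bounded_rectangle _ phi a b 0 (2 * pi) (fun x _ _ => cphi x).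
pose D : set plane := box a b.
have mD : measurable (D : set plane) by apply: measurableX; exact: measurable_itv.
have Dl : D `<=` fdom l by exact: subset_box_fdom.
have iV := density_integrable mD Dl.
have [mN N0] := null_vertical_lines q.
have V0 x : 0 <= V x by exact: expR_ge0.
set M := \int[area]_(x in fdom l) V x in massV *.
have iphi2 : area.-integrable D (EFin \o (fun x => V x * phi x ^+ 2)).
  apply: (@integrable_mul_bounded _ plane _ area _ V (fun x => phi x ^+ 2) (S ^+ 2)) => //.
    by apply: continuous_at_measurable2 => // x _; continuity; exact: cphi.
  move=> x [/= x1 x2]; rewrite normrX ler_sqr ?nnegrE// ?(ltW S0)//.
  move: x1 x2; rewrite !in_itv/= => x1 /andP[x2 x3].
  by have := phiS x.1 x.2 x1; rewrite x2 (ltW x3) -surjective_pairing => /(_ isT).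
have E1 : \int[area]_(x in fdom l) (V x * phi x ^+ 2) = \int[area]_(x in D) (V x * phi x ^+ 2).
  apply: integral_fdom_box => // x _ h; have /andP[h1 h2] : a < x.1 < b.
    by apply: supp; apply: Or31; apply: contraNneq h => ->; rewrite expr0n mulr0.
  by rewrite !ltW.
have E2 : \int[area]_(x in fdom l) (dt phi x ^+ 2 + dtheta phi x ^+ 2) =
    \int[area]_(x in D) (dt phi x ^+ 2 + dtheta phi x ^+ 2).
  apply: integral_fdom_box => // x _ h; have /andP[h1 h2] : a < x.1 < b.
    have [t0|t0] := eqVneq (dt phi x) 0; last by apply: supp; exact: Or32.
    apply: supp; apply: Or33; apply: contraNneq h => ->.
    by rewrite t0 expr0n addr0.
  by rewrite !ltW.
have it : area.-integrable D (EFin \o (fun x => dt phi x ^+ 2)).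
  by apply: integrable_box => x _; continuity; exact: cphit.
have iy : area.-integrable D (EFin \o (fun x => dtheta phi x ^+ 2)).
  by apply: integrable_box => x _; continuity; exact: cphiy.
rewrite E1 E2 (@RintegralD _ plane R area D _ _ mD it iy).
set At := \int[area]_(x in D) (dt phi x ^+ 2).
set Ay := \int[area]_(x in D) (dtheta phi x ^+ 2).
have At0 : 0 <= At by apply: Rintegral_ge0 => x _; exact: sqr_ge0.
have Ay0 : 0 <= Ay by apply: Rintegral_ge0 => x _; exact: sqr_ge0.
apply/ler_addgt0Pr => kap kap0.
(* [k1] keeps the mass of the approximation below [2 pi mm], and [k2] keeps the part of the weighted
   integral missed by the approximation below [kap]. *)
pose k1 := (2 * pi * mm - lam * M) / (lam * (2 * pi * l)).
pose k2 := kap / (lam * S ^+ 2 * l).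
have k10 : 0 < k1.
  by rewrite divr_gt0 ?subr_gt0//; apply: mulr_gt0 => //; exact: mulr_gt0.
have lS : 0 < lam * S ^+ 2 * l.
  by apply: mulr_gt0 => //; apply: mulr_gt0 => //; exact: exprn_gt0.
have k20 : 0 < k2 by exact: divr_gt0.
have k0 : 0 < Num.min k1 k2 by rewrite lt_min k10.
have [kk1 kk2] : Num.min k1 k2 <= k1 /\ Num.min k1 k2 <= k2.
  by rewrite !ge_min !lexx orbT.
set k := Num.min k1 k2 in k0 kk1 kk2.
(* These are the two smallness conditions [e (b - a) <= mm / 2] and [e (b - a) ^ 3 <= 1], with
   [b - a <= l]. *)
pose e1 := mm / (2 * l); pose e2 := (l ^+ 3)^-1.
have l30 : 0 < l ^+ 3 by exact: exprn_gt0.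
have e10 : 0 < e1 by apply: divr_gt0 => //; exact: mulr_gt0.
have e20 : 0 < e2 by rewrite invr_gt0.
have e0 : 0 < Num.min e1 e2 by rewrite lt_min e10.
have [ee1 ee2] : Num.min e1 e2 <= e1 /\ Num.min e1 e2 <= e2.
  by rewrite !ge_min !lexx orbT.
set e := Num.min e1 e2 in e0 ee1 ee2.
have [W [Wt [Wtt [Wy [Wyy [X [G [[DW W0 Wper cX HW] [HX WV VW [mG [MG GM]] iG]]]]]]]]] :=
  approx_density l0 qP beta0 HU a0 ab bl e0 k0.
have [_ [cW _ _ dWy _]] := DW.
have cW' x : a <= x.1 <= b -> {for x, continuous W} by move=> /str; exact: cW.
have iW : area.-integrable D (EFin \o W) by exact: integrable_box.
have strD x : D x -> a <= x.1 <= b /\ 0 <= x.2 <= 2 * pi.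
  by move=> [/=]; rewrite !in_itv/= => x1 /andP[x2 x3]; rewrite x1 x2 ltW.
have ik : area.-integrable D (EFin \o (fun=> k)).
  by apply: integrable_box => x _; exact: continuous_at_cst.
have massW : lam * \int[area]_(x in D) W x <= 2 * pi * mm.
  have h1 : \int[area]_(x in D) W x <= \int[area]_(x in D) (V x + k).
    apply: (@le_Rintegral_null _ plane R area D _ _ _ mD mN N0 iW).
      exact: (@integrableD _ plane R area D mD _ _ iV ik).
    by move=> x /strD[/str xl _] /nonsing_off_lines; exact: WV.
  have h2 : \int[area]_(x in D) (V x + k) <= M + k * (2 * pi * l).
    rewrite RintegralD//; apply: lerD.
      apply: Rintegral_subset => //; first exact: measurable_fdom.
      exact: (density_integrable (measurable_fdom l)).
    rewrite (integral_box (F := fun=> k)); last by move=> x _; exact: continuous_at_cst.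
    have -> := int1_cst (int1 0 (2 * pi) (fun=> k)) ab; have -> := int1_cst k (ltW p2).
    rewrite subr0 -mulrA ler_wpM2l ?(ltW k0)//.
    by rewrite ler_wpM2l// ltW.
  have h3 : lam * (k * (2 * pi * l)) <= 2 * pi * mm - lam * M.
    apply: (@le_trans _ _ (lam * (k1 * (2 * pi * l)))).
      by rewrite ler_wpM2l ?(ltW lam0)// ler_wpM2r// ltW// mulr_gt0.
    rewrite mulrCA /k1 divfK ?lexx// lt0r_neq0//.
    by apply: mulr_gt0 => //; exact: mulr_gt0.
  have h4 : lam * \int[area]_(x in D) W x <= lam * (M + k * (2 * pi * l)).
    by rewrite ler_wpM2l ?(ltW lam0)// (le_trans h1).
  by apply: (le_trans h4); rewrite mulrDr -lerBrDl.
(* Scaling does not change the Laplacian of the logarithm, and [W' + X' = W + X]. As [lam >= 1], the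
   added part of [X'] is nonpositive, so the integral condition on it persists. *)
pose W' x := lam * W x; pose X' x := X x + (1 - lam) * W x.
have DW' := C2_data_scale lam DW.
have core : int1 a b (circle (2 * pi) (fun x => W' x * phi x ^+ 2)) <=
    (1 + energy_const d * mm) * int1 a b (circle (2 * pi) (fun x => dt phi x ^+ 2)) +
    mm * int1 a b (circle (2 * pi) (fun x => dtheta phi x ^+ 2)).
  apply: (cylinder_energy (e := e) (X := X') p2 a0 bl DW') => //.
  - by move=> x _; exact: mulr_gt0.
  - move=> t tab; congr (lam * _).
    have h1 := dWy (t, 0) (str _ tab); have h2 := dWy (t, 2 * pi) (str _ tab).
    apply: (is_derive_unique h2); rewrite /= -[2 * pi]add0r.
    by apply/(@periodic2pi_derive_y _ W _ (t, 0) Wper).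
  - by move=> x xl; rewrite /X'; continuity; [exact: cX|exact: cW].
  - move=> x x1 x2; rewrite /X'.
    have h := HW x x1 x2.
    have -> : - (lam * W x) ^+ 2 * (lam * W x + (X x + (1 - lam) * W x)) =
      lam ^+ 2 * (- W x ^+ 2 * (W x + X x)) by ring.
    have -> : lam * W x * (lam * Wtt x + lam * Wyy x) - (lam * Wt x) ^+ 2 - (lam * Wy x) ^+ 2 =
      lam ^+ 2 * (W x * (Wtt x + Wyy x) - Wt x ^+ 2 - Wy x ^+ 2) by ring.
    by rewrite ler_wpM2l// sqr_ge0.
  - move=> t tab; have tl := str _ tab.
    have cWt := cont2_section cW tl; have cXt := cont2_section cX tl.
    have hz : circle (2 * pi) W' t = lam * circle (2 * pi) W t.
      by apply: int1Z => y _; exact: cWt.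
    apply: (@le_trans _ _ (lam * circle (2 * pi) (fun x => W x * X x) t)).
      rewrite /circle -int1Z; last by move=> y _; continuity; [exact: cWt|exact: cXt].
      apply: int1_le.
      + by move=> y _; rewrite /W' /X'; continuity; [exact: cWt|exact: cXt|exact: cWt].
      + by move=> y _; continuity; [exact: cWt|exact: cXt].
      move=> y _; rewrite /W' /X'.
      have : 0 <= (lam - 1) * (lam * W (t, y) ^+ 2).
        by rewrite mulr_ge0 ?subr_ge0// mulr_ge0 ?sqr_ge0// ltW.
      have -> : lam * W (t, y) * (X (t, y) + (1 - lam) * W (t, y)) =
        lam * (W (t, y) * X (t, y)) - (lam - 1) * (lam * W (t, y) ^+ 2) by ring.
      by move=> Q0; rewrite gerBl.
    by rewrite hz mulrCA ler_wpM2l ?(ltW lam0)//; exact: HX.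
  - exact: ltW.
  - apply: (@le_trans _ _ (e1 * l)).
      by apply: ler_pM => //; exact: ltW.
    rewrite /e1 le_eqVlt; apply/orP; left; apply/eqP; field.
    by rewrite lt0r_neq0.
  - have b3 : (b - a) ^+ 3 <= l ^+ 3 by apply: lerXn2r; rewrite ?nnegrE// ltW.
    apply: (@le_trans _ _ (e2 * l ^+ 3)).
      by apply: ler_pM => //; [exact: ltW|exact: exprn_ge0].
    by rewrite /e2 mulVf// lt0r_neq0.
  - by apply: le_trans mml; rewrite ler_wpM2l// ltW.
  - rewrite (_ : int1 _ _ _ = lam * \int[area]_(x in D) W x)//.
    rewrite -RintegralZl//; apply/esym; apply: integral_box => x x1.
    by continuity; exact: cW'.
  - split; [by move=> x _; exact: cphi|by move=> x _; exact: cphit|by move=> x _; exact: cphiy|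
      by move=> x _; have [_ _ _ h _] := C1 x; exact: h|by move=> x _; have [_ _ _ _ h] := C1 x; exact: h].
  - move=> y; apply: contrapT => /eqP h; have := supp (a, y) (Or31 _ _ h).
    by rewrite /= ltxx.
  - move=> y; apply: contrapT => /eqP h; have := supp (b, y) (Or31 _ _ h).
    by rewrite /= ltxx andbF.
have iWphi : area.-integrable D (EFin \o (fun x => W x * phi x ^+ 2)).
  by apply: integrable_box => x x1; continuity; [exact: cW'|exact: cphi].
have core1 : int1 a b (circle (2 * pi) (fun x => W' x * phi x ^+ 2)) =
    lam * \int[area]_(x in D) (W x * phi x ^+ 2).
  rewrite -RintegralZl//; rewrite (integral_box (F := fun x => lam * (W x * phi x ^+ 2))).
    by apply: int1_eq => t _; apply: int1_eq => y _; rewrite /W' mulrA.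
  by move=> x x1; continuity; [exact: cW'|exact: cphi].
have core2 : int1 a b (circle (2 * pi) (fun x => dt phi x ^+ 2)) = At.
  by apply/esym; apply: integral_box => x _; continuity; exact: cphit.
have core3 : int1 a b (circle (2 * pi) (fun x => dtheta phi x ^+ 2)) = Ay.
  by apply/esym; apply: integral_box => x _; continuity; exact: cphiy.
have core4 : lam * \int[area]_(x in D) (W x * phi x ^+ 2) <=
    (1 + energy_const d * mm) * At + mm * Ay.
  by rewrite -core1 -core2 -core3; exact: core.
have [iGD hG] := integral_box_snd ab mG GM.
have iSG : area.-integrable D (EFin \o (fun x => G x.2 * S ^+ 2)).
  apply: (@integrable_mul_bounded _ plane _ area D (fun x => G x.2) (fun=> S ^+ 2) (S ^+ 2) mD iGD).
    exact: measurable_cst.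
  by move=> x _; rewrite ger0_norm// sqr_ge0.
have compare : \int[area]_(x in D) (V x * phi x ^+ 2) <=
    \int[area]_(x in D) (W x * phi x ^+ 2) + \int[area]_(x in D) G x.2 * S ^+ 2.
  rewrite -(@RintegralZr _ plane R area D _ _ mD iGD) -(@RintegralD _ plane R area D _ _ mD iWphi iSG).
  apply: (@le_Rintegral_null _ plane R area D _ _ _ mD mN N0 iphi2).
    exact: (@integrableD _ plane R area D mD _ _ iWphi iSG).
  move=> x /strD[x1 x2] /nonsing_off_lines nx.
  have h1 := VW x x1 x2 nx; have /andP[g0 _] := GM x.2.
  have h2 : phi x ^+ 2 <= S ^+ 2.
    rewrite -[phi x ^+ 2]real_normK ?num_real// ler_sqr ?nnegrE// ?(ltW S0)//.
    by have := phiS x.1 x.2 x1 x2; rewrite -surjective_pairing.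
  apply: (@le_trans _ _ ((W x + G x.2) * phi x ^+ 2)).
    by rewrite ler_wpM2r// sqr_ge0.
  by rewrite mulrDl lerD2l ler_wpM2l.
have h5 : lam * (\int[area]_(x in D) G x.2 * S ^+ 2) <= kap.
  have g1 : \int[area]_(x in D) G x.2 <= l * k2.
    apply: (le_trans hG); apply: ler_pM => //.
      by apply: int1_ge0 => y _; case/andP: (GM y).
    exact: (le_trans iG).
  apply: (@le_trans _ _ (lam * (l * k2 * S ^+ 2))).
    by rewrite ler_wpM2l ?(ltW lam0)// ler_wpM2r// sqr_ge0.
  have -> : lam * (l * k2 * S ^+ 2) = k2 * (lam * S ^+ 2 * l) by ring.
  by rewrite /k2 divfK ?lexx// lt0r_neq0.
have C0 := energy_const_ge0 d0.
have h6 : mm * Ay <= (1 + energy_const d * mm) * Ay.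
  apply: ler_wpM2r => //; apply: (le_trans mm1).
  by rewrite lerDl mulr_ge0// ltW.
have h7 : lam * \int[area]_(x in D) (V x * phi x ^+ 2) <=
    lam * \int[area]_(x in D) (W x * phi x ^+ 2) + lam * (\int[area]_(x in D) G x.2 * S ^+ 2).
  by rewrite -mulrDr ler_wpM2l// ltW.
apply: (le_trans h7); apply: lerD h5; apply: (le_trans core4).
by rewrite [leRHS]mulrDr lerD2l.
Qed.

End EnergyInequality.

Section SquareIntegrable.
Context {R : realType}.
Local Notation area := (@lebesgue_measure R \x @lebesgue_measure R)%E.
Local Notation plane := (measurableTypeR R * measurableTypeR R)%type.
Variable l : R.
Implicit Types (f g phi : R * R -> R) (t : R).
Local Notation "'int' f" := (\int[area]_(x in fdom l) f x) (at level 10, f at level 9).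
Local Notation integrable_l f := (area.-integrable (fdom l : set plane) (EFin \o f)).

Lemma L2_mul f g : L2 l f -> L2 l g -> integrable_l (fun x => f x * g x).
Proof.
move=> [mf f2] [mg g2].
have fg2 := @integrableD _ plane R area (fdom l) (measurable_fdom l) _ _ f2 g2.
apply: (@le_integrable _ plane R area (fdom l) (measurable_fdom l) _ _ _ _ fg2).
  by apply/measurable_EFinP; exact: measurable_funM.
move=> x _ /=; rewrite lee_fin normrM.
rewrite [leRHS]ger0_norm ?addr_ge0 ?sqr_ge0//.
rewrite -[f x ^+ 2]real_normK ?num_real// -[g x ^+ 2]real_normK ?num_real//.
have : 0 <= (`|f x| - `|g x|) ^+ 2 by exact: sqr_ge0.
have : 0 <= `|f x| ^+ 2 by exact: sqr_ge0.
have : 0 <= `|g x| ^+ 2 by exact: sqr_ge0.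
by move: (`|f x|) (`|g x|) => u v; clear; nra.
Qed.

Lemma L2_sqr_integrable f : L2 l f -> integrable_l (fun x => f x ^+ 2).
Proof. by case. Qed.

Lemma L2_B f g : L2 l f -> L2 l g -> L2 l (fun x => f x - g x).
Proof.
move=> Hf Hg; have [mf f2] := Hf; have [mg g2] := Hg; split.
  exact: measurable_funB.
have fg := L2_mul Hf Hg.
have mD := @measurable_fdom R l.
have h1 := @integrableZl _ plane R area (fdom l) mD (- 2) _ fg.
have h2 := @integrableD _ plane R area (fdom l) mD _ _ f2 g2.
have h := @integrableD _ plane R area (fdom l) mD _ _ h1 h2.
apply: eq_integrable h => // x _ /=.
by rewrite -EFinM -!EFinD; congr EFin; ring.
Qed.

Lemma L2_sqrB f g : L2 l f -> L2 l g ->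
  int (fun x => (f x - g x) ^+ 2) =
  int (fun x => f x ^+ 2) - 2 * int (fun x => f x * g x) + int (fun x => g x ^+ 2).
Proof.
move=> Hf Hg; have [mf f2] := Hf; have [mg g2] := Hg.
have fg := L2_mul Hf Hg.
have mD := @measurable_fdom R l.
have h1 : integrable_l (fun x => (-2) * (f x * g x)).
  exact: (@integrableZl _ plane R area (fdom l) mD (- 2) _ fg).
have h2 := @integrableD _ plane R area (fdom l) mD _ _ f2 h1.
have -> : (fun x => (f x - g x) ^+ 2) =
    (fun x => f x ^+ 2 + (-2) * (f x * g x) + g x ^+ 2).
  by apply/funext => x; ring.
rewrite (@RintegralD _ plane R area _ _ _ mD h2 g2).
rewrite (@RintegralD _ plane R area _ _ _ mD f2 h1).
by rewrite (@RintegralZl _ plane R area _ _ _ mD fg) mulNr.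
Qed.

Lemma test_L2 phi : test_function l phi -> L2 l phi.
Proof.
move=> tphi; have C1 := test_C1 tphi.
have cphi x : {for x, continuous phi} by have [h _ _ _ _] := C1 x; exact: h.
have [_ _ [a [b [a0 bl phi0]]]] := tphi.
split; first by apply: continuous_at_measurable2 => //; exact: measurable_fdom.
apply: (integrable_fdom_box a0 bl).
  by move=> x _ h; apply: phi0; apply: contraNneq h => ->; rewrite expr0n.
by apply: integrable_box => x _; continuity; exact: cphi.
Qed.

End SquareIntegrable.

(** A parameter for the inequalities [u ^ 2 <= (1 + t) v ^ 2 + (1 + 1/t) (v - u) ^ 2], small enough
    that two uses of them leave the constant below one. *)
Lemma dilation_factor {R : realType} (r : R) : 0 <= r -> r < 1 ->
  0 < (1 - r) / 8 /\ (1 + (1 - r) / 8) ^+ 2 * r <= (1 + r) / 2.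
Proof. by move=> r0 r1; split; [lra|nra]. Qed.

(** The final arithmetic: [A + B] is the energy of [psi], [C + D] that of its approximation [phi],
    [X + Y] their scalar product, [P + Q] the energy of the difference; [Z], [J], [K] are the
    weighted integrals of [psi phi], [psi ^ 2] and [phi ^ 2]. *)
Lemma energy_balance {R : realType} (A B C D X Y P Q Z J K r e : R) :
  P = A - 2 * X + C -> Q = B - 2 * Y + D -> P + Q <= e -> X + Y = Z ->
  2 * Z <= J + K -> J <= (1 + r) / 2 * (A + B) -> K <= C + D ->
  (1 - r) / 2 * (A + B) <= e.
Proof. by move=> -> -> h1 <- h2 h3 h4; lra. Qed.

(** * No positive ground state when the energy constant is below one *)

Section Subcritical.
Context {R : realType}.
Local Notation area := (@lebesgue_measure R \x @lebesgue_measure R)%E.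
Local Notation plane := (measurableTypeR R * measurableTypeR R)%type.
Variables (l : R) (V psi : R * R -> R) (N : set plane) (rho : R).
Hypothesis l0 : 0 < l.
Hypothesis V0 : forall x, 0 < V x.
Hypothesis mN : measurable N.
Hypothesis N0 : area N = 0.
Hypothesis mV : measurable_fun (fdom l : set plane) V.
Hypothesis Vbounded : forall a b, 0 < a -> b < l -> exists2 S, 0 < S &
  forall x, a <= x.1 <= b -> 0 <= x.2 <= 2 * pi -> ~ N x -> V x <= S.
Local Notation box a b := (`[a, b] `*` `[0, 2 * pi[ : set plane).
Local Notation "'int' f" := (\int[area]_(x in fdom l) f x) (at level 10, f at level 9).
Local Notation integrable_l f := (area.-integrable (fdom l : set plane) (EFin \o f)).

Lemma measurable_box (a b : R) : measurable (box a b).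
Proof. by apply: measurableX; exact: measurable_itv. Qed.

Lemma weight_integrable a b h : 0 < a -> b < l ->
  area.-integrable (box a b) (EFin \o h) ->
  area.-integrable (box a b) (EFin \o (fun x => V x * h x)).
Proof.
move=> a0 bl hi; have [S S0 VS] := Vbounded a0 bl.
have mD := measurable_box a b.
have mh : measurable_fun (box a b) h by apply/measurable_EFinP; case/integrableP: hi.
have mVD : measurable_fun (box a b) V.
  exact: (measurable_funS (measurable_fdom l) (subset_box_fdom a0 bl) mV).
have mDN : measurable (box a b `\` N) by exact: measurableD.
apply/(@negligible_integrable _ plane R area (box a b) N) => //.
  by apply/measurable_EFinP; exact: measurable_funM.
have hi' : area.-integrable (box a b `\` N) (EFin \o h).
  by apply: (@integrableS _ plane R area (box a b) (box a b `\` N) _ mD mDN _ hi) => x [].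
have h2 : area.-integrable (box a b `\` N) (EFin \o (fun x => h x * V x)).
  apply: (@integrable_mul_bounded _ plane R area _ h V S mDN hi').
    by apply: (@measurable_funS _ _ plane _ (box a b)) => // x [].
  move=> x [[/=]]; rewrite !in_itv/= => x1 /andP[x2 x3] nx.
  by rewrite gtr0_norm//; apply: VS => //; rewrite x2 ltW.
by apply: eq_integrable h2 => // x _ /=; rewrite mulrC.
Qed.

Hypothesis rho0 : 0 <= rho.
Hypothesis rho1 : rho < 1.
Hypothesis energy : forall phi, test_function l phi ->
  int (fun x => V x * phi x ^+ 2) <=
  rho * int (fun x => dt phi x ^+ 2 + dtheta phi x ^+ 2).

Variables g1 g2 : R * R -> R.
Hypothesis psiH1 : H1_grad l psi g1 g2.
Hypothesis psiH10 : forall e : R, 0 < e -> exists phi, test_function l phi /\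
      ((\int[area]_(x in fdom l)
         ((psi x - phi x) ^+ 2 + (g1 x - dt phi x) ^+ 2
            + (g2 x - dtheta phi x) ^+ 2)%:E) < e%:E)%E.

Lemma H10_approx e : 0 < e -> exists phi,
  [/\ test_function l phi, int (fun x => (psi x - phi x) ^+ 2) <= e &
    int (fun x => (g1 x - dt phi x) ^+ 2) + int (fun x => (g2 x - dtheta phi x) ^+ 2) <= e].
Proof.
move=> e0; have [phi [tphi He]] := psiH10 e0; exists phi.
have [Lp L1 L2' _] := psiH1; have [t1 t2] := test_derivatives tphi.
have i0 := L2_sqr_integrable (L2_B Lp (test_L2 tphi)).
have i1 := L2_sqr_integrable (L2_B L1 (test_L2 t1)).
have i2 := L2_sqr_integrable (L2_B L2' (test_L2 t2)).
have mD := @measurable_fdom R l.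
have i01 := @integrableD _ plane R area (fdom l) mD _ _ i0 i1.
have i := @integrableD _ plane R area (fdom l) mD _ _ i01 i2.
have E : int (fun x => (psi x - phi x) ^+ 2 + (g1 x - dt phi x) ^+ 2
            + (g2 x - dtheta phi x) ^+ 2) < e.
  rewrite -lte_fin fineK//.
  exact: (@integrable_fin_num _ plane R area (fdom l) mD _ i).
rewrite (@RintegralD _ plane R area _ _ _ mD i01 i2) in E.
rewrite (@RintegralD _ plane R area _ _ _ mD i0 i1) in E.
have p0 : 0 <= int (fun x => (psi x - phi x) ^+ 2).
  by apply: Rintegral_ge0 => x _; exact: sqr_ge0.
have p1 : 0 <= int (fun x => (g1 x - dt phi x) ^+ 2).
  by apply: Rintegral_ge0 => x _; exact: sqr_ge0.
have p2 : 0 <= int (fun x => (g2 x - dtheta phi x) ^+ 2).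
  by apply: Rintegral_ge0 => x _; exact: sqr_ge0.
have aux (x y z w : R) : 0 <= x -> 0 <= y -> 0 <= z -> x + y + z < w ->
    x <= w /\ y + z <= w.
  move=> x0 y0 z0 /ltW h; split; apply: le_trans h; first by rewrite -addrA lerDl addr_ge0.
  by rewrite -addrA lerDr.
by have [h1 h2] := aux _ _ _ _ p0 p1 p2 E; split; [exact: tphi|exact: h1|exact: h2].
Qed.

Local Notation E := (int (fun x => g1 x ^+ 2) + int (fun x => g2 x ^+ 2)).

Lemma grad_sqr_le t phi : 0 < t -> test_function l phi ->
  int (fun x => dt phi x ^+ 2 + dtheta phi x ^+ 2) <=
  (1 + t) * E + (1 + t^-1) *
    (int (fun x => (g1 x - dt phi x) ^+ 2) + int (fun x => (g2 x - dtheta phi x) ^+ 2)).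
Proof.
move=> t0 tphi; have [_ L1 L2' _] := psiH1; have [/test_L2 t1 /test_L2 t2] := test_derivatives tphi.
have mD := @measurable_fdom R l.
have sq (u v : R) : u ^+ 2 <= (1 + t) * v ^+ 2 + (1 + t^-1) * (v - u) ^+ 2.
  have : 0 <= t^-1 * ((v - u) + t * v) ^+ 2 by rewrite mulr_ge0 ?sqr_ge0 ?invr_ge0 ?ltW.
  have -> : t^-1 * ((v - u) + t * v) ^+ 2 =
    (1 + t) * v ^+ 2 + (1 + t^-1) * (v - u) ^+ 2 - u ^+ 2.
    by field; exact: lt0r_neq0.
  by rewrite subr_ge0.
have step g f : L2 l g -> L2 l f -> int (fun x => f x ^+ 2) <=
    (1 + t) * int (fun x => g x ^+ 2) + (1 + t^-1) * int (fun x => (g x - f x) ^+ 2).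
  move=> Lg Lf; have ig := L2_sqr_integrable Lg; have igf := L2_sqr_integrable (L2_B Lg Lf).
  have j1 : integrable_l (fun x => (1 + t) * g x ^+ 2).
    exact: (@integrableZl _ plane R area (fdom l) mD (1 + t) _ ig).
  have j2 : integrable_l (fun x => (1 + t^-1) * (g x - f x) ^+ 2).
    exact: (@integrableZl _ plane R area (fdom l) mD (1 + t^-1) _ igf).
  rewrite -(@RintegralZl _ plane R area _ _ _ mD ig) -(@RintegralZl _ plane R area _ _ _ mD igf).
  rewrite -(@RintegralD _ plane R area _ _ _ mD j1 j2).
  apply: (@le_Rintegral _ plane R area _ _ _ mD (L2_sqr_integrable Lf)).
    exact: (@integrableD _ plane R area (fdom l) mD _ _ j1 j2).
  by move=> x _; exact: sq.
rewrite (@RintegralD _ plane R area _ _ _ mD (L2_sqr_integrable t1) (L2_sqr_integrable t2)).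
rewrite !mulrDr addrACA; apply: lerD; exact: step.
Qed.

(** The energy inequality passes to the limit from test functions to [psi]: on a fixed box the
    weight is bounded almost everywhere, so convergence in [L^2] suffices. The bound obtained does
    not depend on the box. *)
Lemma box_weight_le t a b : 0 < t -> 0 < a -> b < l ->
  \int[area]_(x in box a b) (V x * psi x ^+ 2) <= (1 + t) ^+ 2 * rho * E.
Proof.
move=> t0 a0 bl; have [S S0 VS] := Vbounded a0 bl.
have mD := measurable_box a b; have Dl := subset_box_fdom a0 bl.
have mL := @measurable_fdom R l.
have [Lp L1 L2' _] := psiH1.
have t1 : 0 < 1 + t by rewrite addr_gt0.
have t2 : 0 < 1 + t^-1 by rewrite addr_gt0// invr_gt0.
pose C := (1 + t) * (rho * (1 + t^-1)) + (1 + t^-1) * S.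
have C0 : 0 <= C by rewrite addr_ge0// ?mulr_ge0// ltW.
apply/ler_addgt0Pr => kap kap0.
have e0 : 0 < kap / (C + 1) by rewrite divr_gt0// ltr_wpDl.
have [phi [tphi h1 h2]] := H10_approx e0.
set e := kap / (C + 1) in e0 h1 h2.
have Lphi := test_L2 tphi.
have sub h : integrable_l h -> area.-integrable (box a b) (EFin \o h).
  by move=> hi; exact: (@integrableS _ plane R area (fdom l) (box a b) _ mL mD Dl hi).
have i1 := weight_integrable a0 bl (sub _ (L2_sqr_integrable Lp)).
have i2 := weight_integrable a0 bl (sub _ (L2_sqr_integrable Lphi)).
have i3 := sub _ (L2_sqr_integrable (L2_B Lp Lphi)).
have j2 : area.-integrable (box a b) (EFin \o (fun x => (1 + t) * (V x * phi x ^+ 2))).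
  exact: (@integrableZl _ plane R area (box a b) mD (1 + t) _ i2).
have j3 : area.-integrable (box a b) (EFin \o (fun x => (1 + t^-1) * S * (psi x - phi x) ^+ 2)).
  exact: (@integrableZl _ plane R area (box a b) mD ((1 + t^-1) * S) _ i3).
have k1 : \int[area]_(x in box a b) (V x * psi x ^+ 2) <=
    (1 + t) * \int[area]_(x in box a b) (V x * phi x ^+ 2) +
    (1 + t^-1) * S * \int[area]_(x in box a b) ((psi x - phi x) ^+ 2).
  rewrite -(@RintegralZl _ plane R area _ _ _ mD i2) -(@RintegralZl _ plane R area _ _ _ mD i3).
  rewrite -(@RintegralD _ plane R area _ _ _ mD j2 j3).
  apply: (@le_Rintegral_null _ plane R area (box a b) N _ _ mD mN N0 i1).
    exact: (@integrableD _ plane R area (box a b) mD _ _ j2 j3).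
  move=> x [/=]; rewrite !in_itv/= => x1 /andP[x2 x3] nx.
  have VxS : V x <= S by apply: VS => //; rewrite x2 ltW.
  have : 0 <= t^-1 * ((psi x - phi x) - t * phi x) ^+ 2.
    by rewrite mulr_ge0 ?sqr_ge0 ?invr_ge0 ?ltW.
  have -> : t^-1 * ((psi x - phi x) - t * phi x) ^+ 2 =
    (1 + t) * phi x ^+ 2 + (1 + t^-1) * (psi x - phi x) ^+ 2 - psi x ^+ 2.
    by field; exact: lt0r_neq0.
  rewrite subr_ge0 => sq.
  apply: (@le_trans _ _ (V x * ((1 + t) * phi x ^+ 2 + (1 + t^-1) * (psi x - phi x) ^+ 2))).
    by rewrite ler_wpM2l// ltW.
  rewrite mulrDr mulrCA lerD2l mulrCA -mulrA ler_wpM2l ?(ltW t2)//.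
  by rewrite ler_wpM2r// sqr_ge0.
have k2 : \int[area]_(x in box a b) (V x * phi x ^+ 2) <= int (fun x => V x * phi x ^+ 2).
  apply: (@Rintegral_subset _ plane R area _ _ _ mD mL Dl).
    have [_ _ [a' [b' [a'0 b'l phi0]]]] := tphi.
    apply: (integrable_fdom_box a'0 b'l).
      by move=> x _ h; apply: phi0; apply: contraNneq h => ->; rewrite expr0n mulr0.
    apply: (weight_integrable a'0 b'l); apply: integrable_box => x _.
    by have C1 := test_C1 tphi; continuity; have [h _ _ _ _] := C1 x; exact: h.
  by move=> x _; rewrite mulr_ge0 ?sqr_ge0// ltW.
have k3 : \int[area]_(x in box a b) ((psi x - phi x) ^+ 2) <= e.
  apply: le_trans h1; apply: (@Rintegral_subset _ plane R area _ _ _ mD mL Dl).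
    exact: (L2_sqr_integrable (L2_B Lp Lphi)).
  by move=> x _; exact: sqr_ge0.
have k4 : int (fun x => V x * phi x ^+ 2) <= rho * ((1 + t) * E + (1 + t^-1) * e).
  apply: (le_trans (energy tphi)); rewrite ler_wpM2l//.
  apply: (le_trans (grad_sqr_le t0 tphi)).
  by rewrite lerD2l ler_wpM2l// ltW.
have k5 : (1 + t) * \int[area]_(x in box a b) (V x * phi x ^+ 2) <=
    (1 + t) * (rho * ((1 + t) * E + (1 + t^-1) * e)).
  by rewrite ler_wpM2l ?(ltW t1)//; exact: le_trans k4.
have k6 : (1 + t^-1) * S * \int[area]_(x in box a b) ((psi x - phi x) ^+ 2) <=
    (1 + t^-1) * S * e.
  by rewrite ler_wpM2l// ltW// mulr_gt0.
apply: (le_trans k1); apply: (le_trans (lerD k5 k6)).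
have -> : (1 + t) * (rho * ((1 + t) * E + (1 + t^-1) * e)) + (1 + t^-1) * S * e =
  (1 + t) ^+ 2 * rho * E + C * e by rewrite /C; ring.
rewrite lerD2l; apply: (@le_trans _ _ ((C + 1) * e)).
  by rewrite ler_wpM2r ?(ltW e0)// lerDl.
by rewrite /e mulrCA divff ?mulr1// lt0r_neq0// ltr_wpDl.
Qed.

Hypothesis psi0 : forall x, strip l x -> 0 < psi x.
Hypothesis psi_weak : forall phi, test_function l phi ->
  int (fun x => psi x * laplacian phi x + V x * psi x * phi x) = 0.

(** The definition of the weak gradient is used with the test functions [dt phi] and [dtheta phi],
    which moves one derivative back to [psi]. *)
Lemma weak_equation phi : test_function l phi ->
  int (fun x => g1 x * dt phi x) + int (fun x => g2 x * dtheta phi x) =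
  int (fun x => V x * (psi x * phi x)).
Proof.
move=> tphi; have [Lp L1 L2' ibp] := psiH1.
have [t1 t2] := test_derivatives tphi.
have [t11 _] := test_derivatives t1; have [_ t22] := test_derivatives t2.
have [_ _ [a [b [a0 bl phi0]]]] := tphi.
have mL := @measurable_fdom R l.
have i1 := L2_mul Lp (test_L2 t11); have i2 := L2_mul Lp (test_L2 t22).
have i3 : integrable_l (fun x => V x * (psi x * phi x)).
  apply: (integrable_fdom_box a0 bl).
    by move=> x _ h; apply: phi0; apply: contraNneq h => ->; rewrite !mulr0.
  apply: (weight_integrable a0 bl).
  exact: (@integrableS _ plane R area (fdom l) (box a b) _ mL (measurable_box a b)
    (subset_box_fdom a0 bl) (L2_mul Lp (test_L2 tphi))).
have i12 := @integrableD _ plane R area (fdom l) mL _ _ i1 i2.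
have := psi_weak tphi.
have -> : (fun x => psi x * laplacian phi x + V x * psi x * phi x) =
  (fun x => psi x * dt (dt phi) x + psi x * dtheta (dtheta phi) x + V x * (psi x * phi x)).
  by apply/funext => x; rewrite /laplacian; ring.
rewrite (@RintegralD _ plane R area _ _ _ mL i12 i3).
rewrite (@RintegralD _ plane R area _ _ _ mL i1 i2).
have [e1 _] := ibp _ t1; have [_ e2] := ibp _ t2.
have aux (A B C X Y : R) : A = - X -> B = - Y -> A + B + C = 0 -> X + Y = C.
  by move=> -> -> /eqP; rewrite addrC -opprD subr_eq0 => /eqP.
exact: (aux _ _ _ _ _ e1 e2).
Qed.

(** Testing with [phi] close to [psi] makes the energy nearly equal to the weighted integral of
    [psi phi]. This is at most half the sum of those of [psi ^ 2], on a box containing the support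
    of [phi], and of [phi ^ 2]; the first is at most [(1 + rho) / 2] times the energy. *)
Lemma gradient_eq0 : E <= 0.
Proof.
pose t := (1 - rho) / 8.
have [t0 tr] : 0 < t /\ (1 + t) ^+ 2 * rho <= (1 + rho) / 2 by exact: dilation_factor.
have pr : 0 < (1 - rho) / 2 by rewrite divr_gt0// subr_gt0.
rewrite -(pmulr_rle0 _ pr); apply/ler_addgt0Pr => e e0; rewrite add0r.
have [phi [tphi _ he]] := H10_approx e0.
have [Lp L1 L2' _] := psiH1; have [/test_L2 t1 /test_L2 t2] := test_derivatives tphi.
have Lphi := test_L2 tphi.
have [_ _ [a [b [a0 bl phi0]]]] := tphi.
have mL := @measurable_fdom R l; have mD := measurable_box a b.
have sub h : integrable_l h -> area.-integrable (box a b) (EFin \o h).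
  by move=> hi; exact: (@integrableS _ plane R area (fdom l) (box a b) _ mL mD (subset_box_fdom a0 bl) hi).
have hw := weak_equation tphi.
have h1 := L2_sqrB L1 t1; have h2 := L2_sqrB L2' t2.
have hE := energy tphi.
rewrite (@RintegralD _ plane R area _ _ _ mL (L2_sqr_integrable t1) (L2_sqr_integrable t2)) in hE.
have F1 : 0 <= int (fun x => dt phi x ^+ 2) by apply: Rintegral_ge0 => x _; exact: sqr_ge0.
have F2 : 0 <= int (fun x => dtheta phi x ^+ 2) by apply: Rintegral_ge0 => x _; exact: sqr_ge0.
have E0 : 0 <= E by apply: addr_ge0; apply: Rintegral_ge0 => x _; exact: sqr_ge0.
have E1 : int (fun x => V x * (psi x * phi x)) = \int[area]_(x in box a b) (V x * (psi x * phi x)).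
  apply: (integral_fdom_box a0 bl) => x _ h.
  by apply: phi0; apply: contraNneq h => ->; rewrite !mulr0.
have E2 : int (fun x => V x * phi x ^+ 2) = \int[area]_(x in box a b) (V x * phi x ^+ 2).
  apply: (integral_fdom_box a0 bl) => x _ h.
  by apply: phi0; apply: contraNneq h => ->; rewrite expr0n mulr0.
have i1 := weight_integrable a0 bl (sub _ (L2_sqr_integrable Lp)).
have i2 := weight_integrable a0 bl (sub _ (L2_sqr_integrable Lphi)).
have i3 := weight_integrable a0 bl (sub _ (L2_mul Lp Lphi)).
have i23 : area.-integrable (box a b) (EFin \o (fun x => 2 * (V x * (psi x * phi x)))).
  exact: (@integrableZl _ plane R area (box a b) mD 2 _ i3).
have k1 : 2 * \int[area]_(x in box a b) (V x * (psi x * phi x)) <=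
    \int[area]_(x in box a b) (V x * psi x ^+ 2) + \int[area]_(x in box a b) (V x * phi x ^+ 2).
  rewrite -(@RintegralZl _ plane R area _ _ _ mD i3) -(@RintegralD _ plane R area _ _ _ mD i1 i2).
  apply: (@le_Rintegral _ plane R area _ _ _ mD i23).
    exact: (@integrableD _ plane R area (box a b) mD _ _ i1 i2).
  move=> x _; rewrite -subr_ge0.
  have -> : V x * psi x ^+ 2 + V x * phi x ^+ 2 - 2 * (V x * (psi x * phi x)) =
    V x * (psi x - phi x) ^+ 2 by ring.
  by rewrite mulr_ge0 ?sqr_ge0// ltW.

have k2 : \int[area]_(x in box a b) (V x * psi x ^+ 2) <= (1 + t) ^+ 2 * rho * E := box_weight_le t0 a0 bl.
have k3 : (1 + t) ^+ 2 * rho * E <= (1 + rho) / 2 * E by rewrite ler_wpM2r.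
have k3' : \int[area]_(x in box a b) (V x * psi x ^+ 2) <= (1 + rho) / 2 * E.
  by apply: (@le_trans _ _ ((1 + t) ^+ 2 * rho * E)).
have k4 : rho * (int (fun x => dt phi x ^+ 2) + int (fun x => dtheta phi x ^+ 2)) <=
    int (fun x => dt phi x ^+ 2) + int (fun x => dtheta phi x ^+ 2).
  exact: ler_piMl (addr_ge0 F1 F2) (ltW rho1).
have k4' : int (fun x => V x * phi x ^+ 2) <= int (fun x => dt phi x ^+ 2) + int (fun x => dtheta phi x ^+ 2).
  exact: (@le_trans _ _ _ _ _ hE k4).
have k1' : 2 * int (fun x => V x * (psi x * phi x)) <= 
   \int[area]_(x in box a b) (V x * psi x ^+ 2) + int (fun x => V x * phi x ^+ 2).
  by rewrite E1 E2.
exact: (energy_balance h1 h2 he hw k1' k3' k4').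
Qed.

(** A vanishing gradient forces the weighted integral of [psi ^ 2] to vanish on every compact box,
    whereas its integrand is positive on a box of positive area. *)
Lemma no_subcritical_ground_state : False.
Proof.
have [a0 bl] : 0 < l / 4 /\ 3 * l / 4 < l by have h := l0; split; lra.
have mD := measurable_box (l / 4) (3 * l / 4).
have [Lp _ _ _] := psiH1.
have mL := @measurable_fdom R l.
have ip : area.-integrable (box (l / 4) (3 * l / 4)) (EFin \o (fun x => psi x ^+ 2)).
  exact: (@integrableS _ plane R area (fdom l) _ _ mL mD (subset_box_fdom a0 bl) (L2_sqr_integrable Lp)).
have iV := weight_integrable a0 bl ip.
have J0 : \int[area]_(x in box (l / 4) (3 * l / 4)) (V x * psi x ^+ 2) = 0.
  apply/eqP; rewrite eq_le; apply/andP; split; last first.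
    by apply: Rintegral_ge0 => x _; rewrite mulr_ge0 ?sqr_ge0// ltW.
  apply: (le_trans (box_weight_le ltr01 a0 bl)).
  by apply: mulr_ge0_le0; [rewrite mulr_ge0 ?sqr_ge0|exact: gradient_eq0].
have pos x : box (l / 4) (3 * l / 4) x -> 0 < V x * psi x ^+ 2.
  move=> /(subset_box_fdom a0 bl)[/=]; rewrite in_itv/= => xl _.
  by rewrite mulr_gt0// exprn_gt0//; exact: psi0.
have J1 : (\int[area]_(x in box (l / 4)%R (3 * l / 4)%R) `|(V x * psi x ^+ 2)%:E| = 0)%E.
  transitivity (\int[area]_(x in box (l / 4)%R (3 * l / 4)%R) (V x * psi x ^+ 2)%:E)%E.
    apply: eq_integral => x /set_mem /pos h.
    by rewrite gee0_abs// lee_fin ltW.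
  have fin : (\int[area]_(x in box (l / 4)%R (3 * l / 4)%R) (V x * psi x ^+ 2)%:E)%E \is a fin_num.
    exact: (@integrable_fin_num _ plane R area _ mD _ iV).
  by rewrite -(fineK fin); congr EFin.
have [mV' _] := integrableP _ _ _ iV.
have [Z [mZ Z0 sZ]] := (@ae_eq_integral_abs _ plane R area _ mD _ mV').1 J1.
have : area (box (l / 4) (3 * l / 4)) = 0.
  apply: (@subset_measure0 _ plane R area _ Z mD mZ) => // x Dx; apply: sZ => /= h.
  have [] := h Dx => h0; have := pos _ Dx; by rewrite h0 ltxx.
have -> : area (box (l / 4) (3 * l / 4)) = (l / 2 * (2 * pi))%:E.
  transitivity ((@lebesgue_measure R `[(l / 4)%R, (3 * l / 4)%R] * @lebesgue_measure R `[0%R, (2 * pi)%R[)%E).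
    by apply: product_measure1E; exact: measurable_itv.
  rewrite !lebesgue_measure_itv/= !lte_fin.
  have -> : l / 4 < 3 * l / 4 by have h := l0; lra.
  rewrite mulr_gt0 ?pi_gt0// -!EFinB -EFinM subr0; congr ((_ * _)%:E).
  by field.
move=> [] /eqP; rewrite mulf_eq0 => /orP[|]; apply/negP; rewrite lt0r_neq0//.
  by rewrite divr_gt0.
by rewrite mulr_gt0 ?pi_gt0.
Qed.

End Subcritical.

(** * The lower bound for the mass on long cylinders *)

Section MassLowerBound.
Context {R : realType}.
Local Notation area := (@lebesgue_measure R \x @lebesgue_measure R)%E.
Local Notation plane := (measurableTypeR R * measurableTypeR R)%type.

Lemma mass_lower_bound (eps : R) : 0 < eps -> eps <= 1 -> exists2 L, 0 < L &
  forall l (m : nat) (q : 'I_m -> R * R) (beta : 'I_m -> R) U psi, L <= l ->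
  (forall j, closed_strip l (q j)) -> (forall j, 0 <= beta j) ->
  liouville l q beta U -> dirichlet_ground_state l U psi ->
  (8 - eps) * (2 * pi / l) <= \int[area]_(x in fdom l) expR (U x).
Proof.
move=> eps0 eps1.
(* The numbers [8 - eps], [8 - eps / 2] and [8 - 4 d = 8 - eps / 4] leave two gaps: the first is
   spent on the factor [lam], the second gives the strict mass inequality. *)
pose d := eps / 16; have d0 : 0 < d by rewrite divr_gt0.
have d1 : d <= 1 by rewrite /d; lra.
have C0 := energy_const_ge0 d0; set C := energy_const d in C0.
have e8 : 0 < 8 - eps by lra.
pose lam := (8 - eps / 2) / (8 - eps).
have lamE : lam * (8 - eps) = 8 - eps / 2 by rewrite /lam divfK// lt0r_neq0.
have lam1 : 1 < lam by rewrite /lam ltr_pdivlMr//; lra.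
have lam0 : 0 < lam by lra.
have lamB : 0 < lam - 1 by lra.
(* As [mm <= 8 / l], the three terms give [mm <= 1], [pi * mm <= 1] and [C * mm < lam - 1]; the last
   one means [rho < 1]. *)
pose L := 8 + 8 * pi + 8 * (C + 1) / (lam - 1).
have pi0 : 0 < pi :> R := pi_gt0 R.
have Q0 : 0 <= 8 * (C + 1) / (lam - 1).
  by rewrite divr_ge0 ?(ltW lamB)// mulr_ge0// addr_ge0.
have L0 : 0 < L by rewrite /L; lra.
exists L => // l m q beta U psi Ll qP beta0 HU Hpsi.
have l0 : 0 < l by exact: lt_le_trans Ll.
have l4 : 4 <= l by apply: le_trans Ll; rewrite /L; lra.
rewrite leNgt; apply/negP => small.
pose mm := (8 - 4 * d) / l.
have mml : mm * l = 8 - 4 * d by rewrite /mm divfK// lt0r_neq0.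
have n0 : 0 < 8 - 4 * d by rewrite /d; lra.
have mm0 : 0 < mm by rewrite divr_gt0.
have mm8 : mm <= 8 / l by rewrite ler_pM2r ?invr_gt0//; lra.
have mm1 : mm <= 1.
  by apply: (le_trans mm8); rewrite ler_pdivrMr// mul1r; apply: le_trans Ll; rewrite /L; lra.
have pim : pi * mm <= 1.
  apply: (@le_trans _ _ (pi * (8 / l))); first by rewrite ler_wpM2l// ltW.
  rewrite mulrA ler_pdivrMr// mul1r; apply: le_trans Ll; rewrite /L; lra.
have mm2 : (2 * pi) ^+ 2 / 4 * mm ^+ 2 <= 1.
  have -> : (2 * pi) ^+ 2 / 4 * mm ^+ 2 = (pi * mm) ^+ 2 by field.
  by rewrite expr_le1// mulr_ge0// ltW.
have Cm : C * mm < lam - 1.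
  apply: (@le_lt_trans _ _ (C * (8 / l))); first by rewrite ler_wpM2l.
  rewrite mulrA ltr_pdivrMr// -ltr_pdivrMl// mulrC [C * 8]mulrC.
  apply: lt_le_trans Ll; rewrite /L.
  have : 8 * C / (lam - 1) <= 8 * (C + 1) / (lam - 1).
    by rewrite ler_pM2r ?invr_gt0//; lra.
  by lra.
pose rho := (1 + C * mm) / lam.
have rho0 : 0 <= rho by rewrite divr_ge0 ?(ltW lam0)// addr_ge0// mulr_ge0// ltW.
have rho1 : rho < 1 by rewrite /rho ltr_pdivrMr//; lra.
set M := \int[area]_(x in fdom l) expR (U x) in small.
have massV : lam * M < 2 * pi * mm.
  apply: (@lt_le_trans _ _ (lam * ((8 - eps) * (2 * pi / l)))); first by rewrite ltr_pM2l.
  rewrite mulrA lamE /mm.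
  have -> : 2 * pi * ((8 - 4 * d) / l) = (8 - 4 * d) * (2 * pi / l) by ring.
  by apply: ler_wpM2r; [rewrite divr_ge0 ?mulr_ge0 ?ltW|rewrite /d; lra].
have energy phi : test_function l phi ->
    \int[area]_(x in fdom l) (expR (U x) * phi x ^+ 2) <=
    rho * \int[area]_(x in fdom l) (dt phi x ^+ 2 + dtheta phi x ^+ 2).
  move=> tphi.
  have mml' : mm * l <= 8 - 4 * d by rewrite mml.
  have h := weighted_energy l4 qP beta0 HU mm0 mm2 mm1 d0 d1 mml' (ltW lam1) massV tphi.
  by rewrite /rho mulrAC ler_pdivlMr// mulrC.
have [mN N0] := null_vertical_lines q.
have [_ iV _ _ _] := HU.
have mV : measurable_fun (fdom l : set plane) (fun x => expR (U x)).
  by apply/measurable_EFinP; case/integrableP: iV.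
have [_ [g1 [g2 [H1 H10e]]] psi0 weak] := Hpsi.
apply: (@no_subcritical_ground_state R l (fun x => expR (U x)) psi _ rho l0 _ mN N0 mV _ rho0 rho1 energy g1 g2 H1 H10e psi0 weak).
  by move=> x; exact: expR_gt0.
move=> a b a0 bl; have [S S0 HS] := expR_U_bounded beta0 HU a0 bl.
exists S => // x x1 x2 nx; apply: HS => //; exact: nonsing_off_lines.
Qed.

End MassLowerBound.

(** * The radial solution *)

Section HyperbolicTangent.
Context {R : realType}.
Implicit Types (z t : R).

(** The hyperbolic tangent, written so that its monotonicity and the bound by one are immediate. *)
Definition htan z : R := 1 - 2 / (1 + expR (2 * z)).

Lemma htan_den_gt0 z : 0 < 1 + expR (2 * z).
Proof. by rewrite addr_gt0// expR_gt0. Qed.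

Lemma is_derive_htan z : is_derive z 1 htan (1 - htan z ^+ 2).
Proof.
have n0 := lt0r_neq0 (htan_den_gt0 z).
rewrite /htan; derivation; first exact: n0.
by move: n0; move: (expR _) => E n0; field.
Qed.

Lemma htanN z : htan (- z) = - htan z.
Proof.
rewrite /htan mulrN expRN; move: (htan_den_gt0 z) (expR_gt0 (2 * z)).
move: (expR _) => E h1 h2; field.
by rewrite !lt0r_neq0//= addrC.
Qed.

Lemma htan_lt z t : z < t -> htan z < htan t.
Proof.
move=> zt; rewrite /htan ltrD2l ltrN2 ltr_pM2l//.
by rewrite ltf_pV2 ?posrE ?htan_den_gt0// ltrD2l ltr_expR ltr_pM2l.
Qed.

Lemma htan_lt1 z : htan z < 1.
Proof. by rewrite /htan gtrBl divr_gt0// htan_den_gt0. Qed.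

Lemma htan0 : htan 0 = 0.
Proof. by rewrite /htan mulr0 expR0 divff ?subrr// lt0r_neq0. Qed.

Lemma mul_htan_ge0 z : 0 <= z * htan z.
Proof.
have H t : 0 <= t -> 0 <= t * htan t.
  rewrite le_eqVlt => /orP[/eqP <-|t0]; first by rewrite mul0r.
  by rewrite mulr_ge0 ?(ltW t0)// -htan0 ltW// htan_lt.
have [z0|z0] := leP 0 z; first exact: H.
by have := H (- z); rewrite htanN mulrNN oppr_ge0 (ltW z0) => /(_ isT).
Qed.

Lemma mul_htan_norm z : z * htan z = `|z| * htan `|z|.
Proof.
have [z0|z0] := leP 0 z; first by rewrite ger0_norm.
by rewrite ltr0_norm// htanN mulrNN.
Qed.

Lemma mul_htan_lt z t : `|z| < t -> z * htan z < t * htan t.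
Proof.
rewrite mul_htan_norm; move: (`|z|) (normr_ge0 z) => w w0 wt.
have ht : 0 < htan t by rewrite -htan0; apply: htan_lt; exact: le_lt_trans wt.
apply: (@le_lt_trans _ _ (w * htan t)).
  by rewrite ler_wpM2l// ltW// htan_lt.
by rewrite ltr_pM2r.
Qed.

(** The value at 1 is below one, and at 2 it is at least one because [e^4 >= 3]. *)
Lemma mul_htan_root : exists2 x0 : R, 0 < x0 & x0 * htan x0 = 1.
Proof.
have ch : {within `[1 : R, 2], continuous (fun z : R => z * htan z)}.
  apply: continuous_in_subspaceT => z _.
  have dh := is_derive_htan z.
  have : is_derive z 1 (fun z : R => z * htan z) (1 * htan z + z * (1 - htan z ^+ 2)).
    by derivation.
  exact: is_derive_continuous.
have le12 : 1 <= 2 :> R by rewrite ler1n.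
have [|z] := @IVT R (fun z => z * htan z) 1 2 1 le12 ch.
- rewrite ge_min le_max; apply/andP; split; apply/orP; [left|right].
    by rewrite mul1r ltW// htan_lt1.
  have e4 : 3 <= expR (2 * 2) :> R by apply: le_trans (expR_ge1Dx _); lra.
  rewrite /htan -ler_pdivrMl// mulr1 lerBrDr -lerBrDl.
  rewrite ler_pdivrMr ?htan_den_gt0//; lra.
- by rewrite in_itv/= => /andP[z1 _] zE; exists z => //; exact: lt_le_trans z1.
Qed.

Lemma smooth_htan : smooth htan.
Proof.
apply: smoothB; first exact: smooth_cst.
apply: smoothM; first exact: smooth_cst.
apply: smoothV; first by move=> z; exact/lt0r_neq0/htan_den_gt0.
apply: smoothD; first exact: smooth_cst.
apply: smooth_comp; first exact: smooth_expR.
by apply: smoothM; [exact: smooth_cst|exact: smooth_id].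
Qed.

End HyperbolicTangent.

(** * The radial profile and its linearization *)

Section SechProfile.
Context {R : realType}.
Variables (l x0 : R).
Hypothesis l0 : 0 < l.
Hypothesis x00 : 0 < x0.
Hypothesis x0E : x0 * htan x0 = 1.
Implicit Types (t : R).

Definition slope := 2 * x0 / l.
Definition phase t := slope * (t - l / 2).
(** The logarithm of [2 a ^ 2 / cosh ^ 2], with [a = slope], expanded so that only
    [1 + expR (2 * phase t)] occurs. The slope is such that [phase] takes the values [- x0] and [x0]
    at the two ends. *)
Definition profile t : R :=
  ln (8 * slope ^+ 2) + 2 * phase t - 2 * ln (1 + expR (2 * phase t)).
(** Up to a constant this is the derivative of the profile with respect to [slope] about the
    midpoint, hence a solution of the linearized equation. *)
Definition ground t : R := 1 - phase t * htan (phase t).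
Definition ground1 t : R :=
  - slope * (htan (phase t) + phase t * (1 - htan (phase t) ^+ 2)).

Lemma slope_gt0 : 0 < slope.
Proof. by rewrite divr_gt0// mulr_gt0. Qed.

Lemma expR_profile t :
  expR (profile t) = 2 * slope ^+ 2 * (1 - htan (phase t) ^+ 2).
Proof.
have d0 := htan_den_gt0 (phase t).
have s0 : 0 < 8 * slope ^+ 2 by rewrite mulr_gt0// exprn_gt0// slope_gt0.
have e2 : expR (2 * ln (1 + expR (2 * phase t))) = (1 + expR (2 * phase t)) ^+ 2.
  have -> : 2 * ln (1 + expR (2 * phase t)) =
    ln (1 + expR (2 * phase t)) + ln (1 + expR (2 * phase t)) by ring.
  by rewrite expRD lnK ?expr2// posrE.
rewrite /profile expRB expRD lnK ?posrE// e2 /htan.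
move: d0; move: (expR _) slope => E s d0; field.
by rewrite lt0r_neq0.
Qed.

Lemma is_derive_phase t : is_derive t 1 phase slope.
Proof. by rewrite /phase; derivation; ring. Qed.

Lemma is_derive_htan_phase t :
  is_derive t 1 (fun s => htan (phase s)) ((1 - htan (phase t) ^+ 2) * slope).
Proof. exact: (is_derive1_comp2 (is_derive_phase t) (is_derive_htan (phase t))). Qed.

Lemma is_derive_profile t :
  is_derive t 1 profile (- (2 * slope) * htan (phase t)).
Proof.
have dp := is_derive_phase t; have d0 := htan_den_gt0 (phase t).
rewrite /profile; derivation; first exact: d0.
rewrite /htan; move: d0; move: (expR _) slope => E s d0; field.
by rewrite lt0r_neq0.
Qed.

Lemma is_derive_profile1 t :
  is_derive t 1 (fun s => - (2 * slope) * htan (phase s)) (- expR (profile t)).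
Proof.
have dT := is_derive_htan_phase t; rewrite expR_profile.
by derivation; ring.
Qed.

Lemma is_derive_ground t : is_derive t 1 ground (ground1 t).
Proof.
have dp := is_derive_phase t; have dT := is_derive_htan_phase t.
by rewrite /ground; derivation; rewrite /ground1; ring.
Qed.

Lemma is_derive_ground1 t :
  is_derive t 1 ground1 (- (expR (profile t) * ground t)).
Proof.
have dp := is_derive_phase t; have dT := is_derive_htan_phase t.
rewrite expR_profile /ground /ground1; derivation.
by rewrite expr1 mulr2n; ring.
Qed.

Lemma smooth_phase : smooth phase.
Proof.
apply: smoothM; first exact: smooth_cst.
by apply: smoothB; [exact: smooth_id|exact: smooth_cst].
Qed.

Lemma smooth_ground : smooth ground.
Proof.
apply: smoothB; first exact: smooth_cst.
by apply: smoothM; [exact: smooth_phase|exact: smooth_comp smooth_htan smooth_phase].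
Qed.

Lemma smooth_profile : smooth profile.
Proof.
case=> [//|n]; apply: (derivable_n_is_derive is_derive_profile).
by apply: smoothM; [exact: smooth_cst|exact: smooth_comp smooth_htan smooth_phase].
Qed.

Lemma phase_lt t : (`|phase t| < x0) = (0 < t < l).
Proof.
rewrite /phase normrM (gtr0_norm slope_gt0) /slope.
have -> : 2 * x0 / l * `|t - l / 2| = x0 * (`|t - l / 2| / (l / 2)).
  by field; rewrite lt0r_neq0.
rewrite gtr_pMr// ltr_pdivrMr ?divr_gt0// mul1r ltr_norml.
have h := l0; apply/andP/andP => -[h1 h2]; split; lra.
Qed.

Lemma ground_gt0 t : 0 < t < l -> 0 < ground t.
Proof. by rewrite -phase_lt => h; rewrite /ground subr_gt0 -[ltRHS]x0E mul_htan_lt. Qed.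

Lemma ground_le0 t : ~ (0 < t < l) -> ground t <= 0.
Proof.
rewrite -phase_lt => /negP; rewrite -leNgt => h.
rewrite /ground subr_le0 -[leLHS]x0E [leRHS]mul_htan_norm.
move: h; rewrite le_eqVlt => /orP[/eqP <-//|h]; apply: ltW.
by apply: mul_htan_lt; rewrite gtr0_norm.
Qed.

Lemma ground_ends : ground 0 = 0 /\ ground l = 0.
Proof.
have p1 : phase l = x0 by rewrite /phase /slope; field; rewrite lt0r_neq0.
have p0 : phase 0 = - x0 by rewrite /phase /slope; field; rewrite lt0r_neq0.
by rewrite /ground p1 p0 htanN mulrNN x0E subrr.
Qed.

Lemma ground_le1 t : ground t <= 1.
Proof. by rewrite /ground gerBl mul_htan_ge0. Qed.

Lemma expR_profile_le t : expR (profile t) <= 2 * slope ^+ 2.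
Proof.
rewrite expR_profile; apply: ler_piMr; last by rewrite gerBl sqr_ge0.
by apply: mulr_ge0; [exact: ler0n|exact: sqr_ge0].
Qed.

(** The density is minus the derivative of the slope of [profile], so its integral is
    [4 * slope * htan x0], and [htan x0 = 1 / x0]. *)
Lemma int1_expR_profile : int1 0 l (fun t => expR (profile t)) = 8 / l.
Proof.
have h : int1 0 l (fun t => - expR (profile t)) =
    - (2 * slope) * htan (phase l) - - (2 * slope) * htan (phase 0).
  apply: (@int1_FTC _ 0 l (fun s => - (2 * slope) * htan (phase s))); first exact: ltW.
    move=> t _; have := is_derive_continuous (is_derive_profile t) => cp.
    by continuity; exact: cp.
  by move=> t _; exact: is_derive_profile1.
have p1 : phase l = x0 by rewrite /phase /slope; field; rewrite lt0r_neq0.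
have p0 : phase 0 = - x0 by rewrite /phase /slope; field; rewrite lt0r_neq0.
have cE : cont1 0 l (fun t => - expR (profile t)).
  move=> t _; have := is_derive_continuous (is_derive_profile t) => cp.
  by continuity; exact: cp.
have -> : (fun t => expR (profile t)) = (fun t => (-1) * - expR (profile t)).
  by apply/funext => t; rewrite mulN1r opprK.
rewrite int1Z// h p1 p0 htanN /slope.
have hx : htan x0 = x0^-1 by rewrite -[LHS](mulKf (lt0r_neq0 x00)) x0E mulr1.
rewrite hx; field.
by rewrite !lt0r_neq0.
Qed.

End SechProfile.

(** * Weak formulations for functions of [t] alone *)

Section RadialEquations.
Context {R : realType}.
Local Notation area := (@lebesgue_measure R \x @lebesgue_measure R)%E.
Local Notation plane := (measurableTypeR R * measurableTypeR R)%type.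
Implicit Types (l a b t : R) (f : R -> R) (phi : R * R -> R) (x : R * R).

(** The divergence theorem for the field [(P, Q)]: [P] vanishes on the two ends of the box, and the
    two angular sides cancel by periodicity. *)
Lemma integral_divergence0 a b l (P Pt Q Qy : R * R -> R) :
  0 < a -> a <= b -> b < l ->
  (forall x, {for x, continuous Pt}) -> (forall x, {for x, continuous Qy}) ->
  (forall x, is_derive x.1 1 (fun s => P (s, x.2)) (Pt x)) ->
  (forall x, is_derive x.2 1 (fun s => Q (x.1, s)) (Qy x)) ->
  (forall y, P (a, y) = 0) -> (forall y, P (b, y) = 0) ->
  (forall t, Q (t, 2 * pi) = Q (t, 0)) ->
  (forall x, ~ (a <= x.1 <= b) -> Pt x + Qy x = 0) ->
  \int[area]_(x in fdom l) (Pt x + Qy x) = 0.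
Proof.
move=> a0 ab bl cP cQ dP dQ Pa Pb Qper PQ0.
have p2 : 0 <= 2 * pi :> R by rewrite mulr_ge0// pi_ge0.
have c1 x : a <= x.1 <= b -> {for x, continuous (fun x => Pt x + Qy x)}.
  by move=> _; continuity; [exact: cP|exact: cQ].
rewrite (integral_fdom_box a0 bl); last first.
  by move=> x _ h; apply: contrapT => /PQ0 h0; rewrite h0 eqxx in h.
rewrite (integral_box c1).
have -> : int1 a b (fun t => int1 0 (2 * pi) (fun y => Pt (t, y) + Qy (t, y))) =
    int1 a b (fun t => int1 0 (2 * pi) (fun y => Pt (t, y))).
  apply: int1_eq => t _.
  have cPt : cont1 0 (2 * pi) (fun y => Pt (t, y)).
    by move=> y _; apply: continuous_section2; exact: cP.
  have cQt : cont1 0 (2 * pi) (fun y => Qy (t, y)).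
    by move=> y _; apply: continuous_section2; exact: cQ.
  rewrite int1D//.
  have -> : int1 0 (2 * pi) (fun y => Qy (t, y)) = Q (t, 2 * pi) - Q (t, 0).
    by apply: (@int1_FTC _ 0 (2 * pi) (fun y => Q (t, y))) => // y _; exact: (dQ (t, y)).
  by rewrite Qper subrr addr0.
rewrite (@int1_swap _ a b 0 (2 * pi) Pt); last by move=> x _ _; exact: cP.
transitivity (int1 0 (2 * pi) (fun=> 0 : R)).
  apply: int1_eq => y _.
  have cPy : cont1 a b (fun t => Pt (t, y)).
    by move=> t _; apply: continuous_section1; exact: cP.
  have -> : int1 a b (fun t => Pt (t, y)) = P (b, y) - P (a, y).
    by apply: (@int1_FTC _ a b (fun t => P (t, y))) => // t _; exact: (dP (t, y)).
  by rewrite Pa Pb subrr.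
by rewrite int1_cst// mul0r.
Qed.

Lemma continuous_radial f (x : R * R) : (forall t : R, {for t, continuous f}) ->
  {for x, continuous (fun x : R * R => f x.1)}.
Proof. by move=> cf; apply: continuous_fst_at; exact: cf. Qed.

Lemma test_flat l phi a b : (forall x, [\/ phi x != 0, dt phi x != 0 | dtheta phi x != 0] ->
    a < x.1 < b) -> forall x, ~ (a < x.1 < b) -> [/\ phi x = 0, dt phi x = 0 & dtheta phi x = 0].
Proof.
move=> supp x nx; split; apply: contrapT => /eqP h; apply: nx; apply: supp.
- exact: Or31.
- exact: Or32.
- exact: Or33.
Qed.

(** The integrand is the divergence of [(f * dt phi - f1 * phi, f * dtheta phi)]. It serves both the
    profile and its ground state. *)
Lemma radial_weak l f f1 f2 phi : 0 < l ->
  (forall t, is_derive t 1 f (f1 t)) -> (forall t, is_derive t 1 f1 (f2 t)) ->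
  (forall t : R, {for t, continuous f2}) -> test_function l phi ->
  \int[area]_(x in fdom l) (f x.1 * laplacian phi x - f2 x.1 * phi x) = 0.
Proof.
move=> l0 df df1 cf2 tphi.
have [a [b [a0 bl ba supp]]] := test_box l0 tphi.
have ab : a <= b by lra.
have flat := test_flat l supp.
have [td1 td2] := test_derivatives tphi.
have C0 := test_C1 tphi; have C1 := test_C1 td1; have C2 := test_C1 td2.
have cf (t : R) : {for t, continuous f} := is_derive_continuous (df t).
have [pphi _ _] := tphi; have [pd2 _ _] := td2.
have -> : (fun x => f x.1 * laplacian phi x - f2 x.1 * phi x) =
  (fun x => (f x.1 * dt (dt phi) x - f2 x.1 * phi x) + f x.1 * dtheta (dtheta phi) x).
  by apply/funext => x; rewrite /laplacian; ring.
apply: (@integral_divergence0 a b l (fun x => f x.1 * dt phi x - f1 x.1 * phi x) _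
  (fun x => f x.1 * dtheta phi x) _ a0 ab bl).
- move=> x; have [c0 _ _ _ _] := C0 x; have [_ c1 _ _ _] := C1 x.
  by continuity; [exact: continuous_radial|exact: c1|exact: continuous_radial|exact: c0].
- move=> x; have [_ _ c1 _ _] := C2 x.
  by continuity; [exact: continuous_radial|exact: c1].
- move=> x; have [_ _ _ d1 _] := C0 x; have [_ _ _ d2 _] := C1 x.
  have e1 := df x.1; have e2 := df1 x.1.
  by derivation => /=; case: x {C0 C1 C2 d1 d2 e1 e2} => s y /=; ring.
- move=> x; have [_ _ _ _ d2] := C2 x.
  rewrite /=; derivation; rewrite mul0r add0r.
  by case: x {d2}.
- move=> y; have [|-> -> _] := flat (a, y); last by rewrite !mulr0 subrr.
  by rewrite /= ltxx.
- move=> y; have [|-> -> _] := flat (b, y); last by rewrite !mulr0 subrr.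
  by rewrite /= ltxx andbF.
- by move=> t; congr (_ * _); have := pd2 (t, 0); rewrite /= add0r.
- move=> x nx; have nx' : ~ (a < x.1 < b).
    by move=> /andP[/ltW h1 /ltW h2]; apply: nx; rewrite h1.
  have [p0 _ _] := flat x nx'.
  have d1 : ~ (a <= x.1 <= b) -> dt (dt phi) x = 0 /\ dtheta (dtheta phi) x = 0.
    move=> _; have [_ _ _ e1 _] := C1 x; have [_ _ _ _ e2] := C2 x.
    have s1 z : dt phi z != 0 -> a <= z.1 <= b.
      by move=> h; have /andP[/ltW -> /ltW ->] := supp z (Or32 _ _ h).
    have s2 z : dtheta phi z != 0 -> a <= z.1 <= b.
      by move=> h; have /andP[/ltW -> /ltW ->] := supp z (Or33 _ _ h).
    have [z1 _] := flat_derivatives s1 nx; have [_ z2] := flat_derivatives s2 nx.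
    by split; [exact: is_derive_unique e1 z1|exact: is_derive_unique e2 z2].
  by have [-> ->] := d1 nx; rewrite p0 !mulr0 subrr addr0.
Qed.

Lemma radial_ibp l f f1 phi : 0 < l -> (forall t, is_derive t 1 f (f1 t)) ->
  (forall t : R, {for t, continuous f1}) -> test_function l phi ->
  \int[area]_(x in fdom l) (f x.1 * dt phi x + f1 x.1 * phi x) = 0 /\
  \int[area]_(x in fdom l) (f x.1 * dtheta phi x) = 0.
Proof.
move=> l0 df cf1 tphi.
have [a [b [a0 bl ba supp]]] := test_box l0 tphi.
have ab : a <= b by lra.
have flat := test_flat l supp.
have C0 := test_C1 tphi.
have cf (t : R) : {for t, continuous f} := is_derive_continuous (df t).
have [pphi _ _] := tphi.
have nn x : ~ (a <= x.1 <= b) -> ~ (a < x.1 < b).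
  by move=> nx /andP[/ltW h1 /ltW h2]; apply: nx; rewrite h1.
have c0 (x : R * R) : {for x, continuous (fun=> 0 : R)} by exact: continuous_at_cst.
split.
- have -> : (fun x => f x.1 * dt phi x + f1 x.1 * phi x) =
      (fun x => (f x.1 * dt phi x + f1 x.1 * phi x) + (fun=> 0) x).
    by apply/funext => x; rewrite addr0.
  apply: (@integral_divergence0 a b l (fun x => f x.1 * phi x) _ (fun=> 0) _ a0 ab bl) => //.
  + move=> x; have [h0 h1 _ _ _] := C0 x.
    by continuity; [exact: continuous_radial|exact: h1|exact: continuous_radial|exact: h0].
  + move=> x; have [_ _ _ d1 _] := C0 x; have e1 := df x.1.
    by derivation => /=; case: x {d1 e1} => s y /=; ring.
  + by move=> x; exact: is_derive1_cst.
  + by move=> y; have [|-> _ _] := flat (a, y); rewrite ?mulr0//= ltxx.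
  + by move=> y; have [|-> _ _] := flat (b, y); rewrite ?mulr0//= ltxx andbF.
  + by move=> x /nn/flat[-> -> _]; rewrite !mulr0 !addr0.
- have -> : (fun x => f x.1 * dtheta phi x) =
      (fun x => (fun=> 0) x + f x.1 * dtheta phi x).
    by apply/funext => x; rewrite add0r.
  apply: (@integral_divergence0 a b l (fun=> 0) _ (fun x => f x.1 * phi x) _ a0 ab bl) => //.
  + move=> x; have [_ _ h1 _ _] := C0 x.
    by continuity; [exact: continuous_radial|exact: h1].
  + by move=> x; exact: is_derive1_cst.
  + move=> x; have [_ _ _ _ d1] := C0 x.
    rewrite /=; derivation; rewrite mul0r add0r.
    by case: x {d1}.
  + by move=> t; congr (_ * _); have := pphi (t, 0); rewrite /= add0r.
  + by move=> x /nn/flat[_ _ ->]; rewrite mulr0 addr0.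
Qed.

Lemma radial_integrable l f : (forall t : R, {for t, continuous f}) ->
  area.-integrable (fdom l) (EFin \o (fun x => f x.1)).
Proof.
move=> cf; apply: (@integrable_rectangle _ _ 0 l 0 (2 * pi)).
- exact: measurable_itv.
- exact: measurable_itv.
- by apply: subset_itvScc; rewrite bnd_simp.
- by apply: subset_itvl; rewrite bnd_simp.
- by move=> x _; exact: continuous_radial.
Qed.

Lemma radial_L2 l f : (forall t : R, {for t, continuous f}) -> L2 l (fun x => f x.1).
Proof.
move=> cf; split; first by apply: continuous_at_measurable2 => [|x _];
  [exact: measurable_fdom|exact: continuous_radial].
apply: (@radial_integrable l (fun t => f t ^+ 2)) => t.
by continuity; exact: cf.
Qed.

Lemma radial_integral l f : 0 < l -> (forall t : R, {for t, continuous f}) ->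
  \int[area]_(x in fdom l) f x.1 = 2 * pi * int1 0 l f.
Proof.
move=> l0 cf.
have [|||x|y|h1 _] := @Fubini_rectangle _ (fun x => f x.1) `]0, l[ `[0, 2 * pi[.
- exact: measurable_itv.
- exact: measurable_itv.
- exact: radial_integrable.
- move=> _; apply: (@integrable_segment _ _ 0 (2 * pi)) => //.
    by apply: subset_itvl; rewrite bnd_simp.
  by move=> y _; exact: continuous_at_cst.
- move=> _; apply: (@integrable_segment _ _ 0 l) => //.
  by apply: subset_itvScc; rewrite bnd_simp.
apply: (etrans h1).
have p2 : 0 <= 2 * pi :> R by rewrite mulr_ge0// pi_ge0.
transitivity (\int[@lebesgue_measure R]_(t in `]0, l[) (2 * pi * f t)).
  apply: eq_Rintegral => t _; rewrite -[RHS]mulrC.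
  have := int1_cst (f t) p2; rewrite subr0 => <-.
  rewrite /int1 -Rintegral_itv_bndo_bndc//.
  apply: (@integrable_segment _ _ 0 (2 * pi)) => //.
    by apply: subset_itvl; rewrite bnd_simp.
  by move=> y _; exact: continuous_at_cst.
rewrite -int1Z; last by move=> t _; exact: cf.
have iop : (@lebesgue_measure R).-integrable `]0, l[ (EFin \o (fun t => 2 * pi * f t)).
  apply: (@integrable_segment _ _ 0 l) => //.
    by apply: subset_itvScc; rewrite bnd_simp.
  by move=> t _; continuity; exact: cf.
have ioc : (@lebesgue_measure R).-integrable `[0, l[ (EFin \o (fun t => 2 * pi * f t)).
  apply: (@integrable_segment _ _ 0 l) => //.
    by apply: subset_itvl; rewrite bnd_simp.
  by move=> t _; continuity; exact: cf.
rewrite /int1 -Rintegral_itv_bndo_bndc//.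
by rewrite Rintegral_itv_obnd_cbnd.
Qed.

Lemma classC_sub k (O O' : set (R * R)) g : O `<=` O' -> classC k O' g -> classC k O g.
Proof.
move=> OO'; elim: k g => [|k ih] g [cg h]; (split; first by move=> x /OO'; exact: cg) => //.
by have [dg /ih h1 /ih h2] := h; split => // x /OO'; exact: dg.
Qed.

Lemma classC_radial k f : smooth f -> classC k setT (fun x : R * R => f x.1).
Proof.
move=> sf; have := classC_tensor k sf (@smooth_cst R 1).
by congr (classC _ _ _); apply/funext => x; rewrite mulr1.
Qed.

End RadialEquations.

(** * Approximation of the ground state by test functions *)

Section SoftThreshold.
Context {R : realType}.
Implicit Types (d x : R).

(** A smooth substitute for the positive part of [x - d]: for [x > d] it is
    [(x - d) exp (- d ^ 2 / (x - d))]. Composed with a function vanishing at the boundary it has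
    compact support. *)
Definition soft d x : R := (x - d) * exp_inv 0 ((x - d) / d ^+ 2).
Definition soft1 d x : R :=
  exp_inv 0 ((x - d) / d ^+ 2) + (x - d) / d ^+ 2 * exp_inv 2 ((x - d) / d ^+ 2).

Lemma is_derive_soft d x : is_derive x 1 (soft d) (soft1 d x).
Proof.
have dw : is_derive x 1 (fun x : R => (x - d) / d ^+ 2) (d ^+ 2)^-1.
  by derivation; ring.
have h := is_derive1_comp2 dw (is_derive_exp_inv 0 ((x - d) / d ^+ 2)).
by rewrite /soft; derivation; rewrite /soft1; ring.
Qed.

Lemma smooth_soft d : smooth (soft d).
Proof.
apply: smoothM; first by apply: smoothB; [exact: smooth_id|exact: smooth_cst].
apply: smooth_exp_inv_comp; apply: smoothM; last exact: smooth_cst.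
by apply: smoothB; [exact: smooth_id|exact: smooth_cst].
Qed.

Lemma continuous_soft1 d x : {for x, continuous (soft1 d)}.
Proof.
have <- : derive1 (soft d) = soft1 d.
  by apply/funext => v; rewrite derive1E; have [_ ->] := is_derive_soft d v.
exact: smooth_continuous (smooth_derive1 (smooth_soft d)).
Qed.

Lemma soft_eq0 d x : x <= d -> soft d x = 0.
Proof.
move=> xd; rewrite /soft exp_inv_le0 ?mulr0//.
by rewrite mulr_le0_ge0 ?subr_le0// invr_ge0 sqr_ge0.
Qed.

(** With [z = d ^ 2 / (x - d)], the exponential costs at most [(x - d) z = d ^ 2 <= d] and the shift
    costs [d]; the slope is [(1 + z) exp (- z)], which lies in [[0, 1]]. *)
Lemma soft_bounds d x : 0 < d -> d <= 1 -> 0 <= x ->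
  0 <= x - soft d x <= 2 * d /\ 0 <= soft1 d x <= 1.
Proof.
move=> d0 d1 x0; have [xd|dx] := leP x d.
  rewrite soft_eq0// /soft1 !exp_inv_le0 ?mulr0 ?addr0 ?subr0 ?x0 ?lexx ?ler01; last 2 first.
  - by rewrite mulr_le0_ge0 ?subr_le0// invr_ge0 sqr_ge0.
  - by rewrite mulr_le0_ge0 ?subr_le0// invr_ge0 sqr_ge0.
  by split => //=; rewrite (le_trans xd)// ler_peMl ?(ltW d0)// ler1n.
have y0 : 0 < x - d by rewrite subr_gt0.
have dd : 0 < d ^+ 2 by exact: exprn_gt0.
have w0 : 0 < (x - d) / d ^+ 2 by exact: divr_gt0.
pose z := d ^+ 2 / (x - d); have z0 : 0 < z by exact: divr_gt0.
have wz : ((x - d) / d ^+ 2)^-1 = z by rewrite invf_div.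
have yz : (x - d) * z = d ^+ 2 by rewrite /z mulrCA divff ?mulr1// lt0r_neq0.
have -> : soft d x = (x - d) * expR (- z).
  by rewrite /soft /exp_inv w0 wz expr0 mul1r.
have -> : soft1 d x = (1 + z) * expR (- z).
  rewrite /soft1 /exp_inv w0 wz expr0 mul1r.
  have -> : (x - d) / d ^+ 2 = z^-1 by rewrite -wz invrK.
  by field; rewrite lt0r_neq0.
have e0 : 0 < expR (- z) by exact: expR_gt0.
have e1 : 1 - z <= expR (- z) by exact: expR_ge1Dx.
have e2 : expR (- z) <= 1 by rewrite expR_le1 oppr_le0 ltW.
have e3 : (1 + z) * expR (- z) <= 1.
  by rewrite expRN ler_pdivrMr ?expR_gt0// mul1r expR_ge1Dx.
have d2 : d ^+ 2 <= d by rewrite expr2 ler_piMl// ltW.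
have h1 : (x - d) * (1 - z) <= (x - d) * expR (- z) by rewrite ler_wpM2l// ltW.
have h2 : (x - d) * expR (- z) <= (x - d) * 1 by rewrite ler_wpM2l// ltW.
have e4 : 0 <= (1 + z) * expR (- z).
  by apply: mulr_ge0; [exact: addr_ge0 ler01 (ltW z0)|exact: ltW].
rewrite e3 e4.
move: h1 h2; rewrite mulrBr mulr1 yz; move: ((x - d) * expR (- z)) d2 d0.
move: (d ^+ 2) => D s d2 d0 h1 h2; split => //; apply/andP; split; lra.
Qed.

End SoftThreshold.

Section Example.
Context {R : realType}.
Local Notation area := (@lebesgue_measure R \x @lebesgue_measure R)%E.
Local Notation plane := (measurableTypeR R * measurableTypeR R)%type.
Variables (l x0 : R).
Hypothesis l0 : 0 < l.
Hypothesis x00 : 0 < x0.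
Hypothesis x0E : x0 * htan x0 = 1.
Local Notation p := (ground l x0).
Local Notation p1 := (ground1 l x0).
Local Notation u := (profile l x0).
Local Notation s := (slope l x0).

(** The ground state is nonpositive outside []0, l[] and, vanishing at the ends, stays below [d]
    near them; so [soft d] cuts it to a compact support. *)
Lemma soft_ground_test d : 0 < d -> test_function l (fun x => soft d (p x.1)).
Proof.
move=> d0; split; first by [].
  by move=> k; exact: (classC_radial k (smooth_comp (smooth_soft d) (smooth_ground l x0))).
have [g0 gl] := ground_ends l0 x0E.
have cp (t : R) : {for t, continuous p} := is_derive_continuous (is_derive_ground l x0 t).
have near_lt (t : R) : p t = 0 -> exists2 r, 0 < r & forall v, `|v - t| < r -> p v < d.
  move=> pt; have pd : p t < d by rewrite pt.
  have near_pt : \forall v \near t, p v < d by exact: (cvgr_lt _ (cp t) _ pd).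
  move/nbhs_ballP : near_pt => [r /= r0 hr].
  by exists r => // v hv; apply: hr; rewrite /ball/= distrC.
have [r r0 hr] := near_lt 0 g0; have [r' r'0 hr'] := near_lt l gl.
exists r, (l - r'); split => //; first by rewrite gtrBl.
move=> x hx; have dp : d < p x.1.
  by rewrite ltNge; apply/negP => /soft_eq0 h; rewrite h eqxx in hx.
have /andP[x1 x2] : 0 < x.1 < l.
  apply: contrapT => /(ground_le0 l0 x00 x0E) h.
  by have := lt_le_trans dp h; rewrite ltNge ltW.
apply/andP; split; rewrite leNgt; apply/negP => h.
- have : p x.1 < d by apply: hr; rewrite subr0 gtr0_norm.
  by rewrite ltNge ltW.
- have : p x.1 < d.
    apply: hr'; rewrite distrC gtr0_norm ?subr_gt0//.
    by rewrite ltrBlDr addrC -ltrBlDr.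
  by rewrite ltNge ltW.
Qed.

Lemma ground_range t : 0 <= t <= l -> 0 <= p t.
Proof.
have [g0 gl] := ground_ends l0 x0E.
move=> /andP[]; rewrite le_eqVlt => /orP[/eqP <- _|t0]; first by rewrite g0.
rewrite le_eqVlt => /orP[/eqP ->|tl]; first by rewrite gl.
by apply: ltW; apply: (ground_gt0 l0 x00 x0E); rewrite t0.
Qed.

(* Since [0 <= 1 - soft1 <= 1], the second square is at most [(1 - soft1) p1^2],
   whose integral is that of [- (p - soft) p'' = (p - soft) e^u p]. *)
Lemma soft_ground_error d : 0 < d -> d <= 1 ->
  int1 0 l (fun t => (p t - soft d (p t)) ^+ 2 + (p1 t - soft1 d (p t) * p1 t) ^+ 2)
  <= l * (4 + 4 * s ^+ 2) * d.
Proof.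
move=> d0 d1.
have dp t := is_derive_ground l x0 t.
have dp1 t := is_derive_ground1 l0 x00 t.
have du t := is_derive_profile l x0 t.
have cp (t : R) : {for t, continuous p} := is_derive_continuous (dp t).
have cp1 (t : R) : {for t, continuous p1} := is_derive_continuous (dp1 t).
have cu (t : R) : {for t, continuous u} := is_derive_continuous (du t).
have dS t := is_derive1_comp2 (dp t) (is_derive_soft d (p t)).
have cS (t : R) : {for t, continuous (fun t => soft d (p t))} := is_derive_continuous (dS t).
have cS1 (t : R) : {for t, continuous (fun t => soft1 d (p t))}.
  by apply: continuous_at_comp (cp t) _; exact: continuous_soft1.
have [g0 gl] := ground_ends l0 x0E.
pose A t := (1 - soft1 d (p t)) * p1 t ^+ 2.
pose Bf t := (p t - soft d (p t)) * (expR (u t) * p t).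
have cA : cont1 0 l A.
  by move=> t _; rewrite /A; continuity; [exact: cS1|exact: cp1].
have cB : cont1 0 l Bf.
  by move=> t _; rewrite /Bf; continuity; [exact: cp|exact: cS|exact: cu|exact: cp].
have AB : int1 0 l (fun t => A t - Bf t) = 0.
  transitivity ((p l - soft d (p l)) * p1 l - (p 0 - soft d (p 0)) * p1 0); last first.
    by rewrite g0 gl soft_eq0 ?(ltW d0)// subrr !mul0r subrr.
  apply: (@int1_FTC _ 0 l (fun t => (p t - soft d (p t)) * p1 t)); first exact: ltW.
    by move=> t tl; apply: continuous_atB; [exact: (cA t tl)|exact: (cB t tl)].
  move=> t _; have h1 := dp t; have h2 := dS t; have h3 := dp1 t.
  by derivation; rewrite /A /Bf; ring.
have {AB} AB : int1 0 l A = int1 0 l Bf by apply/eqP; rewrite -subr_eq0 -int1B// AB.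
have s2 : 0 <= s ^+ 2 by exact: sqr_ge0.
apply: (@le_trans _ _ (int1 0 l (fun t => 4 * d + A t))).
  apply: int1_le.
  - by move=> t _; continuity; [exact: cp|exact: cS|exact: cp1|exact: cS1|exact: cp1].
  - by move=> t tl; continuity; exact: cA.
  move=> t tl; have [/andP[b1 b2] /andP[b3 b4]] := soft_bounds d0 d1 (ground_range tl).
  apply: lerD.
    apply: (@le_trans _ _ ((2 * d) ^+ 2)); first by rewrite ler_sqr ?nnegrE// (le_trans b1).
    have -> : (2 * d) ^+ 2 = 4 * (d * d) by ring.
    by rewrite ler_wpM2l// ler_piMl// ltW.
  rewrite /A; have -> : (p1 t - soft1 d (p t) * p1 t) ^+ 2 =
    (1 - soft1 d (p t)) * (1 - soft1 d (p t)) * p1 t ^+ 2 by ring.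
  rewrite ler_wpM2r ?sqr_ge0// ler_piMl ?subr_ge0//.
  by rewrite gerBl.
rewrite int1D//; last by move=> t _; exact: continuous_at_cst.
have -> := int1_cst (4 * d) (ltW l0); rewrite subr0 AB.
have Ble : int1 0 l Bf <= int1 0 l (fun=> 2 * d * (2 * s ^+ 2)).
  apply: int1_le => //; first by move=> t _; exact: continuous_at_cst.
  move=> t tl; have [/andP[b1 b2] _] := soft_bounds d0 d1 (ground_range tl).
  have v0 : 0 <= expR (u t) * p t.
    by apply: mulr_ge0; [exact: expR_ge0|exact: ground_range].
  have v1 : expR (u t) * p t <= 2 * s ^+ 2.
    apply: (@le_trans _ _ (expR (u t) * 1)).
      by rewrite ler_wpM2l ?expR_ge0// ground_le1.
    by rewrite mulr1; exact: (expR_profile_le l0 x00).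
  by rewrite /Bf ler_pM.
apply: (le_trans (lerD (lexx _) Ble)).
have -> := int1_cst (2 * d * (2 * s ^+ 2)) (ltW l0); rewrite subr0.
by rewrite le_eqVlt; apply/orP; left; apply/eqP; ring.
Qed.

Lemma ground_H10 : H10 l (fun x => p x.1).
Proof.
have dp t := is_derive_ground l x0 t.
have dp1 t := is_derive_ground1 l0 x00 t.
have cp (t : R) : {for t, continuous p} := is_derive_continuous (dp t).
have cp1 (t : R) : {for t, continuous p1} := is_derive_continuous (dp1 t).
exists (fun x => p1 x.1), (fun=> 0); split.
  have Lp := radial_L2 l cp; have Lp1 := radial_L2 l cp1.
  split => //; first exact: (radial_L2 l (f := fun=> 0) (fun t => @continuous_at_cst R R 0 t)).
  move=> phi tphi; have [h1 h2] := radial_ibp l0 dp cp1 tphi.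
  have [t1 _] := test_derivatives tphi.
  have i1 := L2_mul Lp (test_L2 t1); have i2 := L2_mul Lp1 (test_L2 tphi).
  have mL := @measurable_fdom R l.
  rewrite (@RintegralD _ plane R area _ _ _ mL i1 i2) in h1.
  split; first by apply/eqP; rewrite -subr_eq0 opprK; apply/eqP; exact: h1.
  rewrite h2 (_ : (fun x => 0 * phi x) = fun=> 0); last by apply/funext => x; rewrite mul0r.
  by rewrite Rintegral_cst//= ?mul0r ?oppr0.
move=> e e0.
have Q0 : 0 <= 2 * pi * (l * (4 + 4 * s ^+ 2)).
  apply: mulr_ge0; first by rewrite mulr_ge0 ?pi_ge0.
  by apply: mulr_ge0; [exact: ltW|rewrite addr_ge0// mulr_ge0 ?sqr_ge0].
(* By [soft_ground_error] the squared [H^1] error is at most [Q * d], which the choice of [d] makes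
   smaller than [e]. *)
set Q := 2 * pi * (l * (4 + 4 * s ^+ 2)) in Q0.
have Q1 : 0 < Q + 1 by rewrite ltr_wpDl.
have eQ : 0 < e / (Q + 1) by exact: divr_gt0.
have d0 : 0 < Num.min 1 (e / (Q + 1)) by rewrite lt_min ltr01.
have [d1 de] : Num.min 1 (e / (Q + 1)) <= 1 /\ Num.min 1 (e / (Q + 1)) <= e / (Q + 1).
  by rewrite !ge_min !lexx orbT.
set d := Num.min _ _ in d0 d1 de.
have tphi := soft_ground_test d0.
exists (fun x => soft d (p x.1)); split => //.
have dS t := is_derive1_comp2 (dp t) (is_derive_soft d (p t)).
pose F t := (p t - soft d (p t)) ^+ 2 + (p1 t - soft1 d (p t) * p1 t) ^+ 2.
have cS (t : R) : {for t, continuous (fun t => soft d (p t))} := is_derive_continuous (dS t).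
have cS1 (t : R) : {for t, continuous (fun t => soft1 d (p t))}.
  by apply: continuous_at_comp (cp t) _; exact: continuous_soft1.
have cF (t : R) : {for t, continuous F}.
  by rewrite /F; continuity; [exact: cp|exact: cS|exact: cp1|exact: cS1|exact: cp1].
have -> : (fun x => ((p x.1 - soft d (p x.1)) ^+ 2 +
    (p1 x.1 - dt (fun x : R * R => soft d (p x.1)) x) ^+ 2 +
    (0 - dtheta (fun x : R * R => soft d (p x.1)) x) ^+ 2)%:E) = (fun x => (F x.1)%:E).
  apply/funext => x; congr EFin.
  have -> : dt (fun x : R * R => soft d (p x.1)) x = soft1 d (p x.1) * p1 x.1.
    by apply: dtE; exact: dS.
  have -> : dtheta (fun x : R * R => soft d (p x.1)) x = 0.
    by apply: dthetaE; exact: (is_derive1_cst x.2 (soft d (p x.1))).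
  by rewrite subr0 expr0n addr0.
have iF := radial_integrable l cF.
have mL := @measurable_fdom R l.
have fin : (\int[area]_(x in fdom l) (F x.1)%:E)%E \is a fin_num.
  exact: (@integrable_fin_num _ plane R area _ mL _ iF).
rewrite -(fineK fin) lte_fin.
have -> : fine (\int[area]_(x in fdom l) (F x.1)%:E)%E = 2 * pi * int1 0 l F.
  exact: (radial_integral l0 cF).
apply: (@le_lt_trans _ _ (Q * (e / (Q + 1)))).
  apply: (@le_trans _ _ (2 * pi * (l * (4 + 4 * s ^+ 2) * d))).
    by rewrite ler_wpM2l ?mulr_ge0 ?pi_ge0//; exact: soft_ground_error.
  by rewrite mulrA ler_wpM2l.
rewrite mulrA ltr_pdivrMr// mulrC ltr_pM2l// ltrDl//.
Qed.

Lemma profile_liouville (q : 'I_0 -> R * R) (beta : 'I_0 -> R) :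
  liouville l q beta (fun x => u x.1).
Proof.
have du t := is_derive_profile l x0 t; have du1 t := is_derive_profile1 l0 x00 t.
have cu (t : R) : {for t, continuous u} := is_derive_continuous (du t).
have ceu (t : R) : {for t, continuous (fun t => expR (u t))} by continuity; exact: cu.
split => //.
- exact: (radial_integrable l ceu).
- by apply: (@classC_sub _ _ _ setT) => //; exact: (classC_radial 2 (smooth_profile l x0)).
- by case.
move=> phi tphi; rewrite big_ord0.
have cm (t : R) : {for t, continuous (fun t => - expR (u t))} by continuity; exact: cu.
rewrite -[RHS](radial_weak l0 du du1 cm tphi); congr (fine (integral _ _ _)).
by apply/funext => x; rewrite mulNr opprK.
Qed.

Lemma ground_dirichlet : dirichlet_ground_state l (fun x => u x.1) (fun x => p x.1).
Proof.
have dp t := is_derive_ground l x0 t; have dp1 t := is_derive_ground1 l0 x00 t.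
have du t := is_derive_profile l x0 t.
have cu (t : R) : {for t, continuous u} := is_derive_continuous (du t).
have cp (t : R) : {for t, continuous p} := is_derive_continuous (dp t).
split => //.
- exact: ground_H10.
- by move=> x xl; exact: (ground_gt0 l0 x00 x0E).
move=> phi tphi.
have cm (t : R) : {for t, continuous (fun t => - (expR (u t) * p t))}.
  by continuity; [exact: cu|exact: cp].
rewrite -[RHS](radial_weak l0 dp dp1 cm tphi); congr (fine (integral _ _ _)).
by apply/funext => x; rewrite mulNr opprK.
Qed.

Lemma profile_mass :
  (\int[area]_(x in fdom l) (expR (u x.1))%:E = (8 * (2 * pi / l))%:E)%E.
Proof.
have du t := is_derive_profile l x0 t.
have cu (t : R) : {for t, continuous u} := is_derive_continuous (du t).
have ceu (t : R) : {for t, continuous (fun t => expR (u t))} by continuity; exact: cu.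
have iF := radial_integrable l ceu.
have fin : (\int[area]_(x in fdom l) (expR (u x.1))%:E)%E \is a fin_num.
  exact: (@integrable_fin_num _ plane R area _ (@measurable_fdom R l) _ iF).
rewrite -(fineK fin); congr EFin.
transitivity (2 * pi * int1 0 l (fun t => expR (u t))); first exact: (radial_integral l0 ceu).
by rewrite (int1_expR_profile l0 x00 x0E); ring.
Qed.

End Example.

(** * The two bounds for the infimum *)

Lemma B_le {R : realType} (c : R) : 0 < c -> (B c <= (8 * c)%:E)%E.
Proof.
move=> c0; have p2 : 0 < 2 * pi :> R by rewrite mulr_gt0// pi_gt0.
have l0 : 0 < cyl_length c by rewrite divr_gt0.
have [x0 x00 x0E] := @mul_htan_root R.
apply: ereal_inf_lbound; exists (fun x => profile (cyl_length c) x0 x.1).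
  exists 0%N, (fun=> (0, 0)), (fun=> 0), (fun x => ground (cyl_length c) x0 x.1).
  split; [by case|by case|by case| |].
  - exact: profile_liouville.
  - exact: ground_dirichlet.
rewrite profile_mass//; congr (_ * _)%:E.
by rewrite /cyl_length invf_div mulrCA divff ?mulr1// lt0r_neq0.
Qed.

Lemma B_ge {R : realType} (eps : R) : 0 < eps -> eps <= 1 -> exists2 c0, 0 < c0 &
  forall c, 0 < c -> c <= c0 -> (((8 - eps) * c)%:E <= B c)%E.
Proof.
move=> eps0 eps1; have [L L0 HL] := mass_lower_bound eps0 eps1.
have p2 : 0 < 2 * pi :> R by rewrite mulr_gt0// pi_gt0.
exists (2 * pi / L); first exact: divr_gt0.
move=> c c0 cL; apply: le_ereal_inf_tmp => _ [U [m [q [beta [psi [qP _ beta0 HU Hpsi]]]]] <-].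
have Ll : L <= cyl_length c.
  by rewrite /cyl_length ler_pdivlMr// mulrC -ler_pdivlMr.
have h := HL _ _ _ _ _ _ Ll qP beta0 HU Hpsi.
have cE : 2 * pi / cyl_length c = c.
  by rewrite /cyl_length invf_div mulrCA divff ?mulr1// lt0r_neq0.
rewrite cE in h.
have [_ iV _ _ _] := HU.
have fin := @integrable_fin_num _ (measurableTypeR R * measurableTypeR R)%type R _ _
  (@measurable_fdom R (cyl_length c)) _ iV.
by rewrite -(fineK fin) lee_fin.
Qed.

(** Finiteness near zero is part of the statement because [fine] sends infinite values to 0; it
    follows from the same two-sided bound [(8 - eps) c <= B c <= 8 c] as the asymptotics. *)
Theorem theorem4p3 (R : realType) :
  (\forall c \near (0 : R)^'+, B c \is a fin_num) /\
  (forall c : R, fine (B c) = 8 * c +o_(c \near (0 : R)^'+) c).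
Proof.
have bounds (eps : R) : 0 < eps -> eps <= 1 ->
    \forall c \near (0 : R)^'+, B c \is a fin_num /\ `|fine (B c) - 8 * c| <= eps * `|c|.
  move=> eps0 eps1; have [c0 c00 Hc] := B_ge eps0 eps1.
  near=> c.
  have c1 : 0 < c by near: c; exact: nbhs_right_gt.
  have c2 : c <= c0 by apply: ltW; near: c; exact: nbhs_right_lt.
  have lo := Hc _ c1 c2; have up := B_le c1.
  have fin : B c \is a fin_num.
    rewrite fin_numE; apply/andP; split; apply/eqP => h.
    - by move: lo; rewrite h leeNy_eq.
    - by move: up; rewrite h leye_eq.
  split => //; move: lo up; rewrite -(fineK fin) !lee_fin => lo up.
  rewrite (gtr0_norm c1) ler_norml; apply/andP; split; last by nra.
  by rewrite lerBrDl; apply: le_trans lo; rewrite mulrBl.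
split; first by have := bounds 1 ltr01 (lexx _); apply: filterS => c [].
suff H (eps : R) : 0 < eps -> \forall c \near (0 : R)^'+,
    `|((fun c : R => fine (B c)) - (fun c => 8 * c)) c| <= eps * `|c|.
  have h := (@eqaddoP _ _ _ _ _ (fun c : R => fine (B c)) (fun c => 8 * c) (fun c => c)).2 H.
  by move=> c; exact: (congr1 (fun f : R -> R => f c) h).
move=> eps0.
have e0 : 0 < Num.min eps 1 by rewrite lt_min eps0 ltr01.
have e1 : Num.min eps 1 <= 1 by rewrite ge_min lexx orbT.
have := bounds _ e0 e1; apply: filterS => c [_ h].
by apply: (le_trans h); rewrite ler_wpM2r// ge_min lexx.
Unshelve. all: by end_near. Qed.
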